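(* Let $Q:\mathbb S^2\to[0,\infty]$ be an external field on $\mathbb S^2$ that is rotationally invariant about the polar axis $x_3$, and write $Q=Q(\varphi)$. Let $Q\in C^2(N)$, where $N$ is an open neighborhood of $S_Q$ in $\mathbb S^2$. Assume that $S_Q$ is a spherical cap $C_{N,\alpha}$ centered at the North Pole, with $0<\alpha\le\pi$. Let $$F(\varphi)=\frac{2}{\pi}\,\frac{1}{\sin\varphi}\,\frac{d}{d\varphi}\int_\varphi^\alpha\frac{g(t)\sin t\,dt}{\sqrt{\cos\varphi-\cos t}},\qquad\text{where}\qquad g(t)=\frac{1}{4\pi}\,\frac{d}{dt}\int_0^t\frac{Q(\xi)\sin\xi\,d\xi}{\sqrt{\cos\xi-\cos t}}.$$ Then the density $f$ of the equilibrium measure $\mu_Q$ (that is, $d\mu_Q=f(\varphi)\sin\varphi\,d\theta\,d\varphi$) is given by $$f(\varphi)=\frac{F_Q}{4\pi}\left\{1+\frac{2}{\pi}\left[\sqrt{\frac{1+\cos\alpha}{\cos\varphi-\cos\alpha}}-\tan^{-1}\sqrt{\frac{1+\cos\alpha}{\cos\varphi-\cos\alpha}}\,\right]\right\}+F(\varphi),\qquad 0\le\varphi\le\alpha,$$ and the constant $F_Q$ is uniquely defined by $$F_Q=\frac{\pi}{\sin\alpha+\alpha}\left\{1-2\pi\int_0^\alpha F(\varphi)\sin\varphi\,d\varphi\right\}.$$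
   Context: $\mathbb S^2=\{x\in\mathbb R^3:|x|=1\}$, with $|\cdot|$ the Euclidean norm. Spherical coordinates are $(r,\theta,\varphi)$ with $0\le\varphi\le\pi$ the polar angle measured from the positive $x_3$-axis (so $x_3=r\cos\varphi$) and $0\le\theta\le2\pi$ the azimuthal angle. For $0<\alpha\le\pi$, $C_{N,\alpha}=\{(r,\theta,\varphi): r=1,\ 0\le\varphi\le\alpha,\ 0\le\theta\le2\pi\}$. An external field on $\mathbb S^2$ is a non-negative lower semicontinuous function $Q:\mathbb S^2\to[0,\infty]$ that is finite on a set of positive Lebesgue surface measure. It is rotationally invariant about the polar axis if $Q(x)$ depends only on $x_3$ (equivalently only on $\varphi$). For a unit positive Borel measure $\mu$ on $\mathbb S^2$ put $I(\mu)=\iint\frac{1}{|x-y|}\,d\mu(x)\,d\mu(y)$ and $I_Q(\mu)=I(\mu)+2\int Q\,d\mu$. Let $V_Q$ be the infimum of $I_Q(\mu)$ over all unit positive Borel measures $\mu$ on $\mathbb S^2$. The extremal (equilibrium) measure $\mu_Q$ is the unit positive Borel measure on $\mathbb S^2$ with $I_Q(\mu_Q)=V_Q$, $S_Q=\operatorname{supp}\mu_Q$, and $F_Q=V_Q-\int Q\,d\mu_Q$, which is the constant for which $\int\frac{1}{|x-y|}\,d\mu_Q(y)+Q(x)=F_Q$ for $x\in S_Q$. *)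

(* Defs.v *)
From HB Require Import structures.
From mathcomp Require Import all_boot all_order all_algebra.
From mathcomp Require Import all_classical all_reals all_analysis.
Import Order.TTheory GRing.Theory Num.Theory.
Import numFieldNormedType.Exports.

Set Implicit Arguments.
Unset Strict Implicit.
Unset Printing Implicit Defensive.

Local Open Scope classical_set_scope.
Local Open Scope ring_scope.

(* Points of R^3 are row vectors (indices 0, 1, 2 for x_1, x_2, x_3), with the
   Borel sigma-algebra generated by the open sets. *)
Notation borelR3 R := (g_sigma_algebraType (@open 'rV[R]_3)).

(* The library norm `|x| on 'rV_3 is the sup norm (same topology). *)
Definition enorm (R : realType) (x : 'rV[R]_3) : R :=
  Num.sqrt (\sum_(i < 3) x 0 i ^+ 2).

Definition sphere2 (R : realType) : set 'rV[R]_3 := [set x | enorm x = 1].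

Definition sph (R : realType) (theta phi : R) : 'rV[R]_3 :=
  \row_(i < 3) [:: cos theta * sin phi; sin theta * sin phi; cos phi]`_i.

Definition north_cap (R : realType) (alpha : R) : set 'rV[R]_3 :=
  [set sph z.1 z.2 | z in [set z : R * R | 0 <= z.1 <= 2 * pi /\
                                           0 <= z.2 <= alpha]].

(* The set function h(phi) sin(phi) dtheta dphi on the cap 0 <= phi <= alpha. *)
Definition zonal_integral (R : realType) (alpha : R) (h : R -> R)
    (A : set 'rV[R]_3) : \bar R :=
  (\int[lebesgue_measure]_(phi in `[0%R, alpha])
     \int[lebesgue_measure]_(theta in `[0%R, (2 * pi)%R])
       (\1_A (sph theta phi) * h phi * sin phi)%:E)%E.

Definition surface_measure (R : realType) (A : set 'rV[R]_3) : \bar R :=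
  zonal_integral pi (cst 1) A.

(* Q is a function on the sphere: its values off the sphere are never used.
   The topology of [subspace] restricts semicontinuity to the sphere. *)
Definition external_field (R : realType) (Q : 'rV[R]_3 -> \bar R) : Prop :=
  [/\ forall x, sphere2 x -> (0 <= Q x)%E,
      lower_semicontinuous (Q : subspace (@sphere2 R) -> \bar R)
    & (0 < surface_measure [set x | sphere2 x /\ (Q x < +oo)%E])%E].

Definition rotation_invariant (R : realType) (Q : 'rV[R]_3 -> \bar R) : Prop :=
  forall x y, sphere2 x -> sphere2 y ->
    x 0 ord_max = y 0 ord_max -> Q x = Q y.

Definition C2_on (R : realType) (U : set 'rV[R]_3) (G : 'rV[R]_3 -> R) : Prop :=
  forall x, U x -> {for x, continuous G} /\
  forall i : 'I_3, let e k := delta_mx 0 k : 'rV[R]_3 in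
    [/\ derivable G x (e i),
        {for x, continuous (fun y => 'D_(e i) G y)}
      & forall j : 'I_3,
          derivable (fun y => 'D_(e i) G y) x (e j) /\
          {for x, continuous (fun y => 'D_(e j) (fun z => 'D_(e i) G z) y)}].

(* C^2 on a subset of the sphere: finite there and, locally, the restriction
   of a C^2 function on an open set of R^3. *)
Definition sphere_C2_on (R : realType) (N : set 'rV[R]_3)
    (Q : 'rV[R]_3 -> \bar R) : Prop :=
  forall x, N x -> exists (U : set 'rV[R]_3) (G : 'rV[R]_3 -> R),
    [/\ open U, U x, C2_on U G & forall y, N y -> U y -> Q y = (G y)%:E].

Definition sphere_open (R : realType) (N : set 'rV[R]_3) : Prop :=
  exists2 U : set 'rV[R]_3, open U & N = U `&` @sphere2 R.

(* In \bar R the inverse of 0 is +oo, so the kernel is +oo on the diagonal. *)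
Definition energy (R : realType) (mu : probability (borelR3 R) R) : \bar R :=
  (\int[mu]_(x in @sphere2 R) \int[mu]_(y in @sphere2 R)
     ((enorm (x - y : 'rV[R]_3))%:E)^-1)%E.

Definition weighted_energy (R : realType) (Q : 'rV[R]_3 -> \bar R)
    (mu : probability (borelR3 R) R) : \bar R :=
  (energy mu + 2%:E * \int[mu]_(x in @sphere2 R) Q x)%E.

(* Unit Borel measures on the sphere are the Borel probability measures on R^3
   that are carried by the sphere. *)
Definition on_sphere (R : realType) (mu : probability (borelR3 R) R) : Prop :=
  mu (@sphere2 R) = 1%E.

Definition VQ (R : realType) (Q : 'rV[R]_3 -> \bar R) : \bar R :=
  ereal_inf [set weighted_energy Q mu | mu in @on_sphere R].

Definition equilibrium_measure (R : realType) (Q : 'rV[R]_3 -> \bar R)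
    (mu : probability (borelR3 R) R) : Prop :=
  on_sphere mu /\ weighted_energy Q mu = VQ Q.

Definition FQ (R : realType) (Q : 'rV[R]_3 -> \bar R)
    (mu : probability (borelR3 R) R) : \bar R :=
  (VQ Q - \int[mu]_(x in @sphere2 R) Q x)%E.

Definition msupport (R : realType) (mu : probability (borelR3 R) R) :
    set 'rV[R]_3 :=
  [set x | forall U : set 'rV[R]_3, open U -> U x -> (0 < mu U)%E].

(* Q as a function of the polar angle, read off along the meridian theta = 0. *)
Definition profile (R : realType) (Q : 'rV[R]_3 -> \bar R) (phi : R) : R :=
  fine (Q (sph 0 phi)).

Definition g_integrand (R : realType) (q : R -> R) (t xi : R) : R :=
  q xi * sin xi / Num.sqrt (cos xi - cos t).

Definition g_integral (R : realType) (q : R -> R) (t : R) : R :=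
  \int[lebesgue_measure]_(xi in `[0, t]) g_integrand q t xi.

Definition g_fun (R : realType) (q : R -> R) (t : R) : R :=
  1 / (4 * pi) * derive1 (g_integral q) t.

Definition F_integrand (R : realType) (q : R -> R) (phi t : R) : R :=
  g_fun q t * sin t / Num.sqrt (cos phi - cos t).

Definition F_integral (R : realType) (q : R -> R) (alpha phi : R) : R :=
  \int[lebesgue_measure]_(t in `[phi, alpha]) F_integrand q phi t.

Definition F_fun (R : realType) (q : R -> R) (alpha phi : R) : R :=
  2 / pi * (1 / sin phi) * derive1 (F_integral q alpha) phi.

Definition density (R : realType) (q : R -> R) (alpha c phi : R) : R :=
  let s := Num.sqrt ((1 + cos alpha) / (cos phi - cos alpha)) in
  c / (4 * pi) * (1 + 2 / pi * (s - atan s)) + F_fun q alpha phi.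

(* Main.v *)
From HB Require Import structures.
Require Import Defs.
From mathcomp Require Import all_boot all_order all_algebra.
From mathcomp Require Import all_classical all_reals all_analysis.
From mathcomp Require Import measurable_realfun.
From mathcomp Require Import ring lra.
Import Order.TTheory GRing.Theory Num.Theory.
Import numFieldNormedType.Exports.

(** Why the theorem holds. The proof recovers the law of the third coordinate
    of the equilibrium measure by inverting two Abel transforms, and then shows
    that the measure is rotation invariant, so that this law determines it.

    Write x for the third coordinate, c = cos alpha, and F_Q for the modified
    Robin constant. Variation of the energy at its minimum (euler_lagrange) gives
    U + Q <= F_Q on the support of mu, where U is the potential of mu
    (potential_support), hence the averages over circles of latitude satisfy
    the same bound at every height in ]c, 1[; testing against the uniform measure
    on the cap turns the bound into an equality at almost every height
    (avg_potential_ae). The circle mean of 1 / |p - p'| over a latitude x is, up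
    to the factor 1 / pi, the integral over z of
      1 / (sqrt (z - x) sqrt (z - y) sqrt (1 - z^2)),   z > max (x, y),
    where y is the height of the pole p' (circle_mean_kernel, proved with Gauss's
    transformation of elliptic integrals). It is thus a superposition of products
    of Abel kernels. One Abel transform of the equality of averages produces the
    mean S(z) of 1 / sqrt (z - x) under mu, weighted by 1 / sqrt (1 - z^2)
    (abel_avg_potential), and a second one produces the distribution function of
    the height (abel_Smean). Since Q is of class C^2 near the support, both
    transforms can be differentiated (Abel_C1, Abel_C2), and the distribution
    function is M(y) = (F_Q E(y) - 4 pi H(y)) / pi, where E is an elementary
    function, the field-free part, and H (cos phi) is the integral whose
    derivative defines F (cdf_formula). Differentiating once more in the polar
    angle gives the density (integral_latitude).

    The inversion requires that mu charges neither the north pole nor the rim of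
    the cap. A point mass at the pole would make the energy infinite, and a mass
    on the rim would make the averaged potential unbounded near the rim,
    contrary to the bound by F_Q (mu_pole, mu_rim).

    Rotation invariance is not assumed. The mean of mu over the rotations about
    the axis satisfies the same averaged equation, whence its energy, the energy
    of mu and their mutual energy coincide; the two measures are then equal
    because the kernel is strictly positive definite (energy2_eq). The latter is
    elementary: on the sphere the kernel is an increasing limit of polynomials in
    x.y with nonnegative coefficients, each of which is a sum of products of
    monomials in the coordinates, so that equality of the energies forces
    equality of all moments, and these determine a measure on the sphere.

    The formula for F_Q says that the total mass is 1, the field-free part
    contributing F_Q E(1) / pi with E(1) = sin alpha + alpha (integral_capd). *)

Set Implicit Arguments.
Unset Strict Implicit.
Unset Printing Implicit Defensive.

Local Open Scope classical_set_scope.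
Local Open Scope ring_scope.
#[local] Remove Hints is_derive1_comp : typeclass_instances.

(** * Improper integrals over open intervals *)

Section exhaustion.
Context {R : realType}.
Notation lam := (@lebesgue_measure R).
Implicit Types (a b l r : R) (f F G : R -> R).

(** Margins shrinking to 0: the closed intervals [a + inset, b - inset]
    exhaust ]a, b[, which reduces an integral over ]a, b[ to proper ones by
    monotone convergence. The offset in n.+2 keeps the two margins from
    meeting. *)
Definition inset a b (n : nat) : R := (b - a) / 2 / n.+2%:R.

Lemma cvgr_le_cst {T} {H : set_system T} {PH : ProperFilter H} (u : T -> R) l a :
  u x @[x --> H] --> l -> (\forall x \near H, u x <= a) -> l <= a.
Proof. by move=> ul ua; exact: (closed_cvg _ (@closed_le _ a) ua _ ul). Qed.

Lemma cvgr_ge_cst {T} {H : set_system T} {PH : ProperFilter H} (u : T -> R) l a :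
  u x @[x --> H] --> l -> (\forall x \near H, a <= u x) -> a <= l.
Proof. by move=> ul ua; exact: (closed_cvg _ (@closed_ge _ a) ua _ ul). Qed.

Lemma inset_gt0 a b n : a < b -> 0 < inset a b n.
Proof. by move=> ab; rewrite divr_gt0// divr_gt0// subr_gt0. Qed.

Lemma inset_lt a b n : a < b -> a + inset a b n < b - inset a b n.
Proof.
move=> ab; rewrite -subr_gt0.
have -> : b - inset a b n - (a + inset a b n) = (b - a) * (1 - n.+2%:R^-1).
  by rewrite /inset; field; rewrite [_ + _]addrC -natrD addn2 pnatr_eq0.
by rewrite mulr_gt0 ?subr_gt0// invf_lt1 ?ltr1n.
Qed.

Lemma inset_noninc a b m n : a < b -> (m <= n)%N -> inset a b n <= inset a b m.
Proof.
move=> ab mn; rewrite ler_wpM2l ?lef_pV2 ?posrE ?ler_nat//.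
by rewrite divr_ge0// ltW// subr_gt0.
Qed.

Lemma inset_cvg0 a b : inset a b n @[n --> \oo] --> (0 : R).
Proof.
rewrite -[X in _ --> X](mulr0 ((b - a) / 2)).
apply: cvgMr; have := @cvg_harmonic R.
by rewrite -(@cvg_shiftS R (fun n : nat => n.+1%:R^-1 : R) (nbhs (0:R))).
Qed.

Lemma inset_cvgr a b F l : a < b ->
  F x @[x --> a^'+] --> l -> F (a + inset a b n) @[n --> \oo] --> l.
Proof.
move=> ab /cvg_at_rightP; apply; split=> [n|]; first by rewrite ltrDl inset_gt0.
by rewrite -[X in _ --> X](addr0 a); apply: cvgD; [exact: cvg_cst|exact: inset_cvg0].
Qed.

Lemma inset_cvgl a b F l : a < b ->
  F x @[x --> b^'-] --> l -> F (b - inset a b n) @[n --> \oo] --> l.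
Proof.
move=> ab /cvg_at_leftP; apply; split=> [n|].
  by rewrite ltrBlDr ltrDl inset_gt0.
by rewrite -[X in _ --> X](subr0 b); apply: cvgB; [exact: cvg_cst|exact: inset_cvg0].
Qed.

Lemma bigcup_inset a b : a < b ->
  \bigcup_n [set` `[a + inset a b n, b - inset a b n]] = [set` `]a, b[] :> set R.
Proof.
move=> ab; apply/seteqP; split=> x.
  move=> [n _] /=; rewrite !in_itv/= => /andP[ax xb].
  rewrite (lt_le_trans _ ax) ?ltrDl ?inset_gt0//=.
  by rewrite (le_lt_trans xb)// ltrBlDr ltrDl inset_gt0.
rewrite /= in_itv/= => /andP[ax xb].
have e0 : 0 < Num.min (x - a) (b - x) by rewrite lt_min !subr_gt0 ax.
have /cvgr0Pnorm_lt /(_ _ e0)[n _ /(_ _ (leqnn n))] := inset_cvg0 a b.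
rewrite ger0_norm ?(ltW (inset_gt0 _ ab))// lt_min => /andP[h1 h2].
exists n => //=; rewrite in_itv/=; apply/andP; split; lra.
Qed.

Lemma ge0_integral_oo_cvg a b (h : R -> \bar R) : a < b ->
  measurable_fun `]a, b[ h -> (forall x, a < x < b -> (0 <= h x)%E) ->
  (\int[lam]_(x in `[(a + inset a b n)%R, (b - inset a b n)%R]) h x
     @[n --> \oo] --> \int[lam]_(x in `]a, b[) h x)%E.
Proof.
move=> ab mh h0; rewrite -bigcup_inset//.
have sub n : `[a + inset a b n, b - inset a b n] `<=` `]a, b[.
  by rewrite -bigcup_inset// => x xn; exists n.
apply: ge0_nondecreasing_set_cvg_integral => //.
- move=> m n mn; apply/subsetPset => x /=; rewrite !in_itv/= => /andP[ax xb].
  have := inset_noninc ab mn => hh; apply/andP; split; lra.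
- by move=> n; apply: measurable_funS mh => //; exact: sub.
- by move=> n x /sub /=; rewrite in_itv/= => /h0.
Qed.

Lemma measurable_fun_oo a b f : (forall x, a < x < b -> {for x, continuous f}) ->
  measurable_fun `]a, b[ f.
Proof.
move=> cf; apply: open_continuous_measurable_fun => // x.
by rewrite inE/= in_itv/=; exact: cf.
Qed.

Lemma within_cc_oo a b c d f : (forall x, a < x < b -> {for x, continuous f}) ->
  a < c -> d < b -> {within `[c, d], continuous f}.
Proof.
move=> cf ac db; apply: continuous_in_subspaceT => x.
by rewrite inE/= in_itv/= => /andP[cx xd]; apply: cf; lra.
Qed.

(** The integrand may blow up at both ends: only the one-sided limits of the
    primitive enter, and monotone convergence along the exhaustion of ]a, b[
    gives integrability for free. *)
Lemma ge0_FTC_oo f F a b l r : a < b ->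
  (forall x, a < x < b -> is_derive x 1 F (f x)) ->
  (forall x, a < x < b -> {for x, continuous f}) -> (forall x, a < x < b -> 0 <= f x) ->
  F x @[x --> a^'+] --> l -> F x @[x --> b^'-] --> r ->
  (\int[lam]_(x in `]a, b[) (f x)%:E = (r - l)%:E)%E.
Proof.
move=> ab dF cf f0 Fl Fr.
have dFx x : x \in `]a, b[ -> derivable F x 1.
  by rewrite in_itv/= => xab; have [] := dF _ xab.
have mf : measurable_fun `]a, b[ (EFin \o f).
  by apply/measurable_EFinP; exact: measurable_fun_oo.
have h := @ge0_integral_oo_cvg a b (EFin \o f) ab mf f0.
apply: (cvg_unique _ h) => //.
have E n : (\int[lam]_(x in `[(a + inset a b n)%R, (b - inset a b n)%R]) (f x)%:E =
    (F (b - inset a b n) - F (a + inset a b n))%:E)%E.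
  have := inset_gt0 n ab; have := inset_lt n ab => h1 h2.
  rewrite (continuous_FTC2 (F := F)) ?EFinB//.
  - by apply: within_cc_oo cf _ _; lra.
  - split.
    + by move=> x; rewrite in_itv/= => h3; apply: dFx; rewrite in_itv/=; lra.
    + apply: cvg_at_right_filter; apply/differentiable_continuous/derivable1_diffP.
      by apply: dFx; rewrite in_itv/=; lra.
    + apply: cvg_at_left_filter; apply/differentiable_continuous/derivable1_diffP.
      by apply: dFx; rewrite in_itv/=; lra.
  - move=> x; rewrite in_itv/= => h3; rewrite derive1E.
    by have [|_ ->//] := dF x; lra.
rewrite /=; under eq_fun do rewrite E.
apply: cvg_EFin; first by near=> n.
by apply: cvgB; [exact: inset_cvgl|exact: inset_cvgr].
Unshelve. all: by end_near. Qed.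

Let ge0_substitution f F G a b l r : a < b ->
  (forall x, a < x < b -> is_derive x 1 F (f x)) ->
  (forall x, a < x < b -> {for x, continuous f}) -> (forall x, a < x < b -> f x < 0) ->
  F x @[x --> a^'+] --> r -> F x @[x --> b^'-] --> l ->
  (forall x, l < x < r -> {for x, continuous G}) -> (forall x, l < x < r -> 0 <= G x) ->
  (\int[lam]_(x in `]l, r[) (G x)%:E =
   \int[lam]_(x in `]a, b[) (G (F x) * - f x)%:E)%E.
Proof.
move=> ab dF cf f0 Fr Fl cG G0.
have dFx x : x \in `]a, b[ -> derivable F x 1.
  by rewrite in_itv/= => xab; have [] := dF _ xab.
have F'E x : x \in `]a, b[ -> derive1 F x = f x.
  by rewrite in_itv/= => xab; rewrite derive1E; have [_ ->] := dF _ xab.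
have cF x : x \in `]a, b[ -> {for x, continuous F}.
  by move=> xab; apply/differentiable_continuous/derivable1_diffP/dFx.
have decF : {in `]a, b[ &, {homo F : x y /~ x < y}}.
  apply: ltr0_derive1_lt_oo => //.
    by move=> x xab; rewrite F'E// f0//; move: xab; rewrite in_itv.
  by move=> x; rewrite inE/=; exact: cF.
pose aa n := a + inset a b n; pose bb n := b - inset a b n.
have aab n : a < aa n < b.
  by have := inset_gt0 n ab; have := inset_lt n ab; rewrite /aa => *; lra.
have bbb n : a < bb n < b.
  by have := inset_gt0 n ab; have := inset_lt n ab; rewrite /bb => *; lra.
have aabb n : aa n < bb n by exact: inset_lt.
have Faa : F (aa n) @[n --> \oo] --> r by exact: inset_cvgr.
have Fbb : F (bb n) @[n --> \oo] --> l by exact: inset_cvgl.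
have aad m n : (m <= n)%N -> aa n <= aa m.
  by move=> mn; rewrite /aa lerD2l inset_noninc.
have bbd m n : (m <= n)%N -> bb m <= bb n.
  by move=> mn; rewrite /bb lerD2l lerN2 inset_noninc.
have decF' : {in `]a, b[ &, {homo F : x y /~ x <= y}}.
  move=> x y xab yab; rewrite le_eqVlt => /predU1P[->//|xy].
  by rewrite ltW// decF.
have Flr x : a < x < b -> l < F x < r.
  move=> xab.
  have [n _ hn] : \forall n \near \oo, inset a b n < Num.min (x - a) (b - x).
    have /cvgr0Pnorm_lt := inset_cvg0 a b; move/(_ (Num.min (x - a) (b - x))).
    rewrite lt_min !subr_gt0 => /(_ xab); apply: filterS => n.
    by rewrite ger0_norm ?ltW ?inset_gt0.
  have {}hn m : (n <= m)%N -> aa m < x < bb m.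
    by move=> /hn /=; rewrite lt_min /aa /bb => /andP[? ?]; lra.
  have h1 : F (bb n) < F x < F (aa n).
    have := hn n (leqnn _) => /andP[? ?].
    by rewrite !decF ?in_itv/= ?aab ?bbb.
  apply/andP; split.
    have [_ h] := andP h1; rewrite (le_lt_trans _ (andP h1).1)//.
    apply: (cvgr_le_cst Fbb).
    by near=> m; rewrite decF' ?in_itv/= ?bbb// bbd//; near: m; exists n.
  rewrite (lt_le_trans (andP h1).2)//.
  apply: (cvgr_ge_cst Faa).
  by near=> m; rewrite decF' ?in_itv/= ?aab// aad//; near: m; exists n.
have cup : \bigcup_n [set` `[F (bb n), F (aa n)]] = [set` `]l, r[] :> set R.
  apply/seteqP; split=> x.
    move=> [n _] /=; rewrite !in_itv/= => /andP[h1 h2].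
    have := Flr _ (aab n); have := Flr _ (bbb n) => /andP[h3 _] /andP[_ h4].
    by rewrite (lt_le_trans h3)//= (le_lt_trans h2).
  rewrite /= in_itv/= => /andP[lx xr].
  have := @cvgr_lt _ _ _ _ _ _ Fbb _ lx.
  have := @cvgr_gt _ _ _ _ _ _ Faa _ xr.
  move=> [n1 _ h1] [n2 _ h2]; exists (maxn n1 n2) => //=.
  by rewrite in_itv/=; rewrite !ltW// ?h1 ?h2//= ?leq_maxl ?leq_maxr.
have cvgL : (\int[lam]_(x in `[F (bb n), F (aa n)]) (G x)%:E @[n --> \oo]
    --> \int[lam]_(x in `]l, r[) (G x)%:E)%E.
  rewrite -cup; apply: ge0_nondecreasing_set_cvg_integral => //.
  - move=> m n mn; apply/subsetPset => x /=; rewrite !in_itv/= => /andP[h1 h2].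
    by rewrite (le_trans _ h1) ?(le_trans h2)// decF' ?in_itv/= ?aab ?bbb// ?aad ?bbd.
  - move=> n; apply: measurable_funS (_ : measurable_fun `]l, r[ _) => //.
      by rewrite -cup => x xn; exists n.
    by apply/measurable_EFinP; exact: measurable_fun_oo.
  - move=> n x xn; rewrite lee_fin; apply: G0.
    have : [set` `]l, r[] x by rewrite -cup; exists n.
    by rewrite /= in_itv.
have cvgR := @ge0_integral_oo_cvg a b (fun x => (G (F x) * - f x)%:E) ab _ _.
apply: (cvg_unique _ cvgL) => //.
have E n : (\int[lam]_(x in `[F (bb n), F (aa n)]) (G x)%:E =
    \int[lam]_(x in `[aa n, bb n]) (G (F x) * - f x)%:E)%E.
  have sub x : aa n <= x <= bb n -> x \in `]a, b[.
    by have := aab n; have := bbb n; rewrite in_itv/= => *; lra.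
  have nf x : aa n < x < bb n -> \near x, derive1 F x = f x.
    move=> xn; near=> y; apply: F'E; apply: sub.
    have : y \in `]aa n, bb n[ by near: y; apply: near_in_itvoo; rewrite in_itv.
    by rewrite in_itv/= => /andP[? ?]; rewrite !ltW.
  have lF (G1 : set_system R) (FG : Filter G1) x : aa n <= x <= bb n ->
      G1 --> x -> (\forall y \near G1, a < y < b) -> derive1 F y @[y --> G1] --> f x.
    move=> xn Gx Gab; have : f y @[y --> G1] --> f x.
      have xab : a < x < b by move: (sub _ xn); rewrite in_itv.
      by apply: cvg_trans (cf x xab); exact: cvg_app.
    apply: cvg_trans; apply: near_eq_cvg; near=> y; rewrite F'E// in_itv/=.
    by near: y.
  have nab x : aa n <= x <= bb n -> \near x, a < x < b.
    by move=> /sub xab; have := near_in_itvoo xab; apply: filterS => y; rewrite in_itv.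
  rewrite (integration_by_substitution_decreasing (F := F)) ?ltW//.
  - apply: eq_integral => x; rewrite inE/= in_itv/= => xn.
    by rewrite -(F'E _ (sub _ xn)).
  - by move=> x y; rewrite !in_itv/= => xn yn; apply: decF; exact: sub.
  - move=> x; rewrite in_itv/= => /andP[h1 h2].
    have xn : aa n <= x <= bb n by rewrite !ltW.
    by rewrite /continuous_at F'E ?sub//; apply: lF => //; exact: nab.
  - apply: (@cvgP _ _ (f (aa n))); apply: lF.
    + by rewrite lexx ltW.
    + by apply: cvg_at_right_filter; exact: cvg_id.
    + by apply: (@cvg_within _ (nbhs (aa n))); apply: nab; rewrite lexx ltW.
  - apply: (@cvgP _ _ (f (bb n))); apply: lF.
    + by rewrite lexx ltW.
    + by apply: cvg_at_left_filter; exact: cvg_id.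
    + by apply: (@cvg_within _ (nbhs (bb n))); apply: nab; rewrite lexx ltW.
  - split.
    + by move=> x; rewrite in_itv/= => /andP[h1 h2]; apply/dFx/sub; rewrite !ltW.
    + by apply: cvg_at_right_filter; apply: cF; rewrite sub// lexx ltW.
    + by apply: cvg_at_left_filter; apply: cF; rewrite sub// lexx ltW.
  - apply: within_cc_oo cG _ _.
      by have /andP[] := Flr _ (bbb n).
    by have /andP[] := Flr _ (aab n).
rewrite /=; under eq_fun do rewrite E.
apply: cvgR.
- apply/measurable_EFinP; apply: measurable_fun_oo => x xab.
  apply: cvgM; last by apply: cvgN; exact: cf.
  by apply: continuous_comp; [apply: cF; rewrite in_itv|apply: cG; rewrite Flr].
- by move=> x xab; rewrite lee_fin mulr_ge0 ?G0 ?Flr// oppr_ge0 ltW// f0.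
Unshelve. all: by end_near. Qed.

(** Positive and negative parts are substituted separately, along an
    exhaustion of the open intervals, so that both sides may be infinite
    together. *)
Lemma substitution_decreasing_oo f F G a b l r : a < b ->
  (forall x, a < x < b -> is_derive x 1 F (f x)) ->
  (forall x, a < x < b -> {for x, continuous f}) ->
  (forall x, a < x < b -> f x < 0) ->
  F x @[x --> a^'+] --> r -> F x @[x --> b^'-] --> l ->
  (forall x, l < x < r -> {for x, continuous G}) ->
  (\int[lam]_(x in `]l, r[) (G x)%:E =
   \int[lam]_(x in `]a, b[) (G (F x) * - f x)%:E)%E.
Proof.
move=> ab dF cf f0 Fr Fl cG.
rewrite [LHS]integralE [RHS]integralE; congr (_ - _)%E.
- transitivity (\int[lam]_(x in `]l, r[) (Num.max (G x) 0)%:E)%E.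
    by apply: eq_integral => x _; rewrite funeposE -EFin_max.
  rewrite (@ge0_substitution f F (fun x => Num.max (G x) 0) a b)//.
  + apply: eq_integral => x; rewrite inE/= in_itv/= => xab.
    by rewrite funeposE -EFin_max maxr_pMl ?mul0r// oppr_ge0 ltW// f0.
  + move=> x /cG cGx; apply: (@continuous_comp _ _ _ G (fun y => Num.max y 0)) => //.
    by apply: continuous_max => ?; [exact: cvg_id|exact: cvg_cst].
  + by move=> x _; rewrite le_max lexx orbT.
- transitivity (\int[lam]_(x in `]l, r[) (Num.max (- G x) 0)%:E)%E.
    by apply: eq_integral => x _; rewrite funenegE -EFinN -EFin_max.
  rewrite (@ge0_substitution f F (fun x => Num.max (- G x) 0) a b)//.
  + apply: eq_integral => x; rewrite inE/= in_itv/= => xab.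
    by rewrite funenegE -EFinN -EFin_max maxr_pMl ?mul0r ?mulNr// oppr_ge0 ltW// f0.
  + move=> x /cG cGx; apply: (@continuous_comp _ _ _ G (fun y => Num.max (- y) 0)) => //.
    by apply: continuous_max => ?; [exact: opp_continuous|exact: cvg_cst].
  + by move=> x _; rewrite le_max lexx orbT.
Qed.

Lemma integral_oo_opp G l r : (forall x, l < x < r -> {for x, continuous G}) ->
  (\int[lam]_(x in `]l, r[) (G x)%:E =
   \int[lam]_(x in `](- r)%R, (- l)%R[) (G (- x))%:E)%E.
Proof.
move=> cG; have [rl|lr] := leP r l.
  by rewrite !set_itv_ge ?bnd_simp -?leNgt ?lerN2// !integral_set0.
rewrite (@substitution_decreasing_oo (cst (-1)) (@GRing.opp R) G (- r) (- l) l r)//.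
- by apply: eq_integral => x _ /=; rewrite opprK mulr1.
- by rewrite ltrN2.
- by move=> x _; exact: cst_continuous.
- by move=> x _ /=; rewrite oppr_lt0.
- rewrite -[X in _ --> X]opprK; apply: cvg_at_right_filter; exact: opp_continuous.
- rewrite -[X in _ --> X]opprK; apply: cvg_at_left_filter; exact: opp_continuous.
Qed.

Lemma substitution_increasing_oo f F G a b l r : a < b ->
  (forall x, a < x < b -> is_derive x 1 F (f x)) ->
  (forall x, a < x < b -> {for x, continuous f}) ->
  (forall x, a < x < b -> 0 < f x) ->
  F x @[x --> a^'+] --> l -> F x @[x --> b^'-] --> r ->
  (forall x, l < x < r -> {for x, continuous G}) ->
  (\int[lam]_(x in `]l, r[) (G x)%:E =
   \int[lam]_(x in `]a, b[) (G (F x) * f x)%:E)%E.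
Proof.
move=> ab dF cf f0 Fr Fl cG; rewrite integral_oo_opp//.
have dNF x : a < x < b -> is_derive x 1 (fun x => - F x) (- f x).
  by move=> /dF ?; exact: is_deriveN.
rewrite (@substitution_decreasing_oo _ _ (fun x => G (- x)) a b (- r) (- l) ab dNF)//.
- by apply: eq_integral => x _ /=; rewrite !opprK.
- by move=> x /cf ?; exact: cvgN.
- by move=> x /f0; rewrite oppr_lt0.
- exact: cvgN.
- exact: cvgN.
- move=> x xlr; apply: (@continuous_comp _ _ _ (@GRing.opp R) G); first exact: opp_continuous.
  by apply: cG; lra.
Qed.

End exhaustion.

(** * Derivatives and Abel-type integrals in closed form *)

Section integrals.
Context {R : realType}.
Notation lam := (@lebesgue_measure R).
Implicit Types (a b c w x y z : R).

Lemma cvg_eq {T} {H : set_system T} (u : T -> R) (l l' : R) :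
  u x @[x --> H] --> l -> l = l' -> u x @[x --> H] --> l'.
Proof. by move=> ul <-. Qed.

Section derive_rules.
Implicit Types (f g : R -> R).

(** The rules below are meant to be composed into one proof term for the
    derivative of a composite expression, whose value is then normalized with
    der_eq. *)
Lemma derD f g x a b : is_derive x 1 f a -> is_derive x 1 g b ->
  is_derive x 1 (fun y => f y + g y) (a + b).
Proof. exact: is_deriveD. Qed.

Lemma derB f g x a b : is_derive x 1 f a -> is_derive x 1 g b ->
  is_derive x 1 (fun y => f y - g y) (a - b).
Proof. exact: is_deriveB. Qed.

Lemma derN f x a : is_derive x 1 f a -> is_derive x 1 (fun y => - f y) (- a).
Proof. exact: is_deriveN. Qed.

Lemma der_eq f x a b : is_derive x 1 f a -> a = b -> is_derive x 1 f b.
Proof. by move=> df <-. Qed.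

Lemma derM f g x a b : is_derive x 1 f a -> is_derive x 1 g b ->
  is_derive x 1 (fun y => f y * g y) (a * g x + f x * b).
Proof.
move=> df dg; apply: (der_eq (is_deriveM df dg)).
by rewrite /GRing.scale/= addrC [g x * a]mulrC.
Qed.

Lemma derV f x a : is_derive x 1 f a -> f x != 0 ->
  is_derive x 1 (fun y => (f y)^-1) (- a / f x ^+ 2).
Proof.
move=> df f0; apply: (der_eq (is_deriveV f0 df)).
by rewrite /GRing.scale/= mulNr mulrC mulNr.
Qed.

Lemma derX f x a n : is_derive x 1 f a ->
  is_derive x 1 (fun y => f y ^+ n.+1) (n.+1%:R * f x ^+ n * a).
Proof.
move=> df; elim: n => [|n ih]; first by apply: (der_eq df); rewrite expr0 !mul1r.
suff -> : (fun y => f y ^+ n.+2) = (fun y => f y * f y ^+ n.+1).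
  by apply: (der_eq (derM df ih)); rewrite exprS -[n.+2]addn1 natrD; ring.
by apply/funext => y; rewrite exprS.
Qed.

Lemma der_comp f g x a b : is_derive x 1 g b -> is_derive (g x) 1 f a ->
  is_derive x 1 (fun y => f (g y)) (a * b).
Proof. by move=> dg df; exact: is_derive1_comp. Qed.

Lemma der_sqrt f x a : is_derive x 1 f a -> 0 < f x ->
  is_derive x 1 (fun y => Num.sqrt (f y)) (a / (2 * Num.sqrt (f x))).
Proof.
by move=> df f0; apply: (der_eq (der_comp df (is_derive1_sqrt f0))); rewrite mulrC.
Qed.

Lemma der_atan f x a : is_derive x 1 f a ->
  is_derive x 1 (fun y => atan (f y)) (a / (1 + f x ^+ 2)).
Proof.
by move=> df; apply: (der_eq (der_comp df (is_derive1_atan (f x)))); rewrite mulrC.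
Qed.

Lemma der_cst k x : is_derive x 1 (fun _ : R => k) (0 : R).
Proof. exact: is_derive_cst. Qed.

Lemma der_id x : is_derive x 1 (fun y : R => y) (1 : R).
Proof. exact: is_derive_id. Qed.

Lemma der_continuous f x a : is_derive x 1 f a -> {for x, continuous f}.
Proof.
by move=> [df _]; apply/differentiable_continuous/derivable1_diffP.
Qed.

Lemma is_derive_derive1 f x a : is_derive x 1 f a -> derive1 f x = a.
Proof. by move=> df; rewrite derive1E; have [_ ->] := df. Qed.

End derive_rules.

Lemma is_derive_sqrtBl w x : w < x ->
  is_derive x 1 (fun x => Num.sqrt (x - w)) (2 * Num.sqrt (x - w))^-1.
Proof.
move=> wx; have h : 0 < x - w by rewrite subr_gt0.
apply: (der_eq (der_sqrt (derB (der_id x) (der_cst w x)) h)).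
by rewrite subr0 mul1r.
Qed.

Lemma is_derive_sqrtBr z x : x < z ->
  is_derive x 1 (fun x => Num.sqrt (z - x)) (- (2 * Num.sqrt (z - x))^-1).
Proof.
move=> xz; have h : 0 < z - x by rewrite subr_gt0.
apply: (der_eq (der_sqrt (derB (der_cst z x) (der_id x)) h)).
by rewrite sub0r mulN1r.
Qed.

Lemma continuous_sqrtBl w : continuous (fun x => Num.sqrt (x - w)).
Proof.
move=> x; apply: (@continuous_comp _ _ _ (fun x => x - w) (@Num.sqrt R)); last exact: sqrt_continuous.
by apply: cvgB; [exact: cvg_id|exact: cvg_cst].
Qed.

Lemma continuous_sqrtBr z : continuous (fun x => Num.sqrt (z - x)).
Proof.
move=> x; apply: (@continuous_comp _ _ _ (fun x => z - x) (@Num.sqrt R)); last exact: sqrt_continuous.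
by apply: cvgB; [exact: cvg_cst|exact: cvg_id].
Qed.

Lemma is_derive_atan_sqrt w z x : w < x < z ->
  is_derive x 1 (fun x => atan (Num.sqrt (x - w) / Num.sqrt (z - x)))
    (2 * (Num.sqrt (x - w) * Num.sqrt (z - x)))^-1.
Proof.
move=> /andP[wx xz].
have A0 : 0 < Num.sqrt (x - w) by rewrite sqrtr_gt0 subr_gt0.
have B0 : 0 < Num.sqrt (z - x) by rewrite sqrtr_gt0 subr_gt0.
have dA := is_derive_sqrtBl wx; have dB := is_derive_sqrtBr xz.
apply: (der_eq (der_atan (derM dA (derV dB (lt0r_neq0 B0))))).
field.
have -> : Num.sqrt (z - x) ^+ 2 + Num.sqrt (x - w) ^+ 2 = z - w.
  by rewrite !sqr_sqrtr ?subr_ge0 ?ltW//; ring.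
by rewrite !gt_eqF// subr_gt0 (lt_trans wx).
Qed.

Lemma cvg_atan_sqrt_right w z : w < z ->
  atan (Num.sqrt (x - w) / Num.sqrt (z - x)) @[x --> z^'-] --> pi / 2.
Proof.
move=> wz.
apply: (@cvg_comp _ _ _ (fun x => Num.sqrt (x - w) / Num.sqrt (z - x)) atan _ _ _ _ (@cvgy_atan R)).
apply/gtr0_cvgV0.
  near=> x; rewrite divr_gt0// sqrtr_gt0 subr_gt0; first by near: x; exact: nbhs_left_gt.
  by near: x; exact: nbhs_left_lt.
rewrite [X in X @ _ --> _](_ : _ = (fun x => Num.sqrt (z - x) / Num.sqrt (x - w))); last first.
  by apply/funext => x; rewrite /= invf_div.
apply: cvg_at_left_filter.
have h : Num.sqrt (z - w) != 0 by rewrite gt_eqF// sqrtr_gt0 subr_gt0.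
rewrite -[X in _ --> X](mul0r (Num.sqrt (z - w))^-1).
apply: cvgM; last by apply: cvgV => //; exact: continuous_sqrtBl.
by have := @continuous_sqrtBr z z; rewrite /continuous_at subrr sqrtr0.
Unshelve. all: by end_near. Qed.

Lemma continuous_atan_sqrt w z x : x < z ->
  {for x, continuous (fun x => atan (Num.sqrt (x - w) / Num.sqrt (z - x)))}.
Proof.
move=> xz; apply: continuous_comp; last exact: continuous_atan.
apply: cvgM; first exact: continuous_sqrtBl.
by apply: cvgV; [rewrite gt_eqF// sqrtr_gt0 subr_gt0|exact: continuous_sqrtBr].
Qed.

Lemma continuous_inv_sqrtM w z x : w < x < z ->
  {for x, continuous (fun x => (Num.sqrt (x - w) * Num.sqrt (z - x))^-1)}.
Proof.
move=> /andP[wx xz]; apply: cvgV.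
  by rewrite gt_eqF// mulr_gt0// sqrtr_gt0 subr_gt0.
by apply: cvgM; [exact: continuous_sqrtBl|exact: continuous_sqrtBr].
Qed.

(** Euler's beta integral B(1/2, 1/2). It is the reason why Abel's kernel can
    be inverted: composing two half integrals produces the constant pi. *)
Lemma integral_beta w z : w < z ->
  (\int[lam]_(x in `]w, z[) ((Num.sqrt (x - w) * Num.sqrt (z - x))^-1)%:E = pi%:E)%E.
Proof.
move=> wz.
rewrite -[in RHS](subr0 pi).
have dF x : w < x < z -> is_derive x 1
    (fun x => 2 * atan (Num.sqrt (x - w) / Num.sqrt (z - x)))
    (Num.sqrt (x - w) * Num.sqrt (z - x))^-1.
  move=> xwz; apply: (der_eq (derM (der_cst 2 x) (is_derive_atan_sqrt xwz))).
  by rewrite mul0r add0r invfM mulrA divff ?mul1r.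
apply: (ge0_FTC_oo wz dF).
- by move=> x; exact: continuous_inv_sqrtM.
- by move=> x _; rewrite invr_ge0 mulr_ge0// sqrtr_ge0.
- apply: cvg_at_right_filter.
  apply: cvg_eq; first exact: cvgMr (continuous_atan_sqrt (w := w) wz).
  by rewrite subrr sqrtr0 mul0r atan0 mulr0.
- apply: cvg_eq; first exact: cvgMr (cvg_atan_sqrt_right wz).
  by rewrite mulrCA divff// mulr1.
Qed.

Lemma integral_inv_sqrtl w b : w < b ->
  (\int[lam]_(x in `]w, b[) ((Num.sqrt (x - w))^-1)%:E = (2 * Num.sqrt (b - w))%:E)%E.
Proof.
move=> wb.
rewrite -[in RHS](subr0 (2 * Num.sqrt (b - w))).
have dF x : w < x < b -> is_derive x 1
    (fun x => 2 * Num.sqrt (x - w)) (Num.sqrt (x - w))^-1.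
  move=> /andP[wx _]; apply: (der_eq (derM (der_cst 2 x) (is_derive_sqrtBl wx))).
  by rewrite mul0r add0r invfM mulrA divff ?mul1r.
apply: (ge0_FTC_oo wb dF).
- move=> x /andP[wx _]; apply: cvgV; last exact: continuous_sqrtBl.
  by rewrite gt_eqF// sqrtr_gt0 subr_gt0.
- by move=> x _; rewrite invr_ge0 sqrtr_ge0.
- apply: cvg_at_right_filter.
  apply: cvg_eq; first exact: cvgMr (@continuous_sqrtBl w w).
  by rewrite subrr sqrtr0 mulr0.
- by apply: cvg_at_left_filter; exact: cvgMr (@continuous_sqrtBl w b).
Qed.

Lemma integral_inv_sqrtr a z : a < z ->
  (\int[lam]_(x in `]a, z[) ((Num.sqrt (z - x))^-1)%:E = (2 * Num.sqrt (z - a))%:E)%E.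
Proof.
move=> az; rewrite integral_oo_opp.
  under eq_integral do rewrite opprK addrC -[X in _ + X]opprK.
  by rewrite integral_inv_sqrtl ?ltrN2// opprK addrC.
move=> x /andP[_ xz]; apply: cvgV; last exact: continuous_sqrtBr.
by rewrite gt_eqF// sqrtr_gt0 subr_gt0.
Qed.

(** Closed form of the half integral of sqrt (1 + z) over ]c, y[; it carries
    the field-free part of the equilibrium distribution. *)
Definition capE c y : R :=
  Num.sqrt (1 + c) * Num.sqrt (y - c) +
  (1 + y) * (pi / 2 - atan (Num.sqrt (1 + c) / Num.sqrt (y - c))).

Lemma integral_capE c y : -1 <= c -> c < y ->
  (\int[lam]_(z in `]c, y[) (Num.sqrt (1 + z) / Num.sqrt (y - z))%:E = (capE c y)%:E)%E.
Proof.
move=> c1 cy.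
have shE x : 1 + x = x - (-1) by rewrite opprK addrC.
pose P x := - (Num.sqrt (x - (-1)) * Num.sqrt (y - x)) +
  (1 + y) * atan (Num.sqrt (x - (-1)) / Num.sqrt (y - x)).
under eq_integral do rewrite shE.
have cP x : x < y -> {for x, continuous P}.
  move=> xy; apply: cvgD.
    by apply: cvgN; apply: cvgM; [exact: continuous_sqrtBl|exact: continuous_sqrtBr].
  by apply: cvgMr; exact: continuous_atan_sqrt.
have -> : capE c y = (1 + y) * (pi / 2) - P c.
  by rewrite /P /capE -!shE; ring.
have dP x : c < x < y -> is_derive x 1 P (Num.sqrt (x - (-1)) / Num.sqrt (y - x)).
  move=> /andP[cx xy].
  have x1 : -1 < x by apply: le_lt_trans cx.
  have A0 : 0 < Num.sqrt (x - (-1)) by rewrite sqrtr_gt0 subr_gt0.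
  have B0 : 0 < Num.sqrt (y - x) by rewrite sqrtr_gt0 subr_gt0.
  have h : -1 < x < y by rewrite x1.
  apply: (der_eq (derD (derN (derM (is_derive_sqrtBl x1) (is_derive_sqrtBr xy)))
    (derM (der_cst (1 + y) x) (is_derive_atan_sqrt h)))).
  have e1 : Num.sqrt (x - (-1)) ^+ 2 = x + 1 by rewrite sqr_sqrtr ?subr_ge0 ?ltW// opprK.
  have e2 : Num.sqrt (y - x) ^+ 2 = y - x by rewrite sqr_sqrtr ?subr_ge0 ?ltW.
  have -> : 1 + y = Num.sqrt (x - (-1)) ^+ 2 + Num.sqrt (y - x) ^+ 2 by rewrite e1 e2; ring.
  by field; rewrite !gt_eqF.
apply: (ge0_FTC_oo cy dP).
- move=> x /andP[cx xy]; apply: cvgM; first exact: continuous_sqrtBl.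
  by apply: cvgV; [rewrite gt_eqF// sqrtr_gt0 subr_gt0|exact: continuous_sqrtBr].
- by move=> x _; rewrite divr_ge0// sqrtr_ge0.
- by apply: cvg_at_right_filter; exact: cP.
- rewrite -[X in _ --> X]add0r; apply: cvgD; last first.
    by apply: cvgMr; apply: cvg_atan_sqrt_right; apply: le_lt_trans cy.
  apply: cvg_at_left_filter.
  apply: cvg_eq.
    by apply: cvgN; apply: cvgM; [exact: continuous_sqrtBl|exact: continuous_sqrtBr].
  by rewrite subrr sqrtr0 mulr0 oppr0.
Qed.

(** With s = sqrt ((1 + c) / (y - c)), this derivative is, up to the factor 2
    / pi, the bracket 1 + (2 / pi) (s - atan s) of the density. *)
Lemma is_derive_capE c y : -1 <= c -> c < y ->
  let s := Num.sqrt (1 + c) / Num.sqrt (y - c) in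
  is_derive y 1 (capE c) (pi / 2 + (s - atan s)).
Proof.
move=> c1 cy s.
have B0 : 0 < Num.sqrt (y - c) by rewrite sqrtr_gt0 subr_gt0.
have dB := is_derive_sqrtBl cy.
have ds := derM (der_cst (Num.sqrt (1 + c)) y) (derV dB (lt0r_neq0 B0)).
have d1 := derM (der_cst (Num.sqrt (1 + c)) y) dB.
have d2 := derM (derD (der_cst 1 y) (der_id y)) (derB (der_cst (pi / 2) y) (der_atan ds)).
apply: (der_eq (derD d1 d2)).
rewrite /= -/s.
have e1 : Num.sqrt (1 + c) ^+ 2 = 1 + c by rewrite sqr_sqrtr// -lerBlDl sub0r.
have e2 : Num.sqrt (y - c) ^+ 2 = y - c by rewrite sqr_sqrtr ?subr_ge0 ?ltW.
have h : 1 + y = Num.sqrt (1 + c) ^+ 2 + Num.sqrt (y - c) ^+ 2 by rewrite e1 e2; ring.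
rewrite h /s; field.
rewrite [Num.sqrt (y - c) ^+ 2 + _]addrC -h.
by rewrite !gt_eqF// -ltrBlDl sub0r (le_lt_trans c1).
Qed.

End integrals.

(** * Smoothness of the Abel transform *)

Section C1.
Context {R : realType}.
Notation lam := (@lebesgue_measure R).
Implicit Types (a b c d u v w x y z : R) (f g p psi om : R -> R).

(** A local condition on the open interval: the functions of interest are
    singular at its end points. *)
Definition C1 a b f := forall x, a < x < b ->
  derivable f x 1 /\ {for x, continuous (derive1 f)}.

Lemma near_oo a b x : a < x < b -> \forall y \near x, a < y < b.
Proof.
move=> xab; have /near_in_itvoo : x \in `]a, b[ by rewrite in_itv.
by apply: filterS => y; rewrite in_itv.
Qed.

Lemma near_eq_continuous f g x : (\near x, f x = g x) ->
  {for x, continuous f} -> {for x, continuous g}.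
Proof.
move=> fg; have fgx : f x = g x := nbhs_singleton fg.
move=> cf; rewrite /prop_for /continuous_at -fgx; move: cf.
by apply: cvg_trans; apply: near_eq_cvg; apply: filterS fg => y ->.
Qed.

Lemma C1_der a b f x : C1 a b f -> a < x < b -> is_derive x 1 f (derive1 f x).
Proof. by move=> /[apply] -[df _]; rewrite derive1E; exact: derivableP. Qed.

Lemma C1_continuous a b f x : C1 a b f -> a < x < b -> {for x, continuous f}.
Proof. by move=> hf xab; exact: der_continuous (C1_der hf xab). Qed.

Lemma C1I a b f g : (forall x, a < x < b -> is_derive x 1 f (g x)) ->
  (forall x, a < x < b -> {for x, continuous g}) -> C1 a b f.
Proof.
move=> dfg cg x xab; split; first by have [] := dfg _ xab.
apply: (near_eq_continuous _ (cg _ xab)).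
by apply: filterS (near_oo xab) => y yab; rewrite (is_derive_derive1 (dfg _ yab)).
Qed.

Lemma eq_derive1 a b f g x : (forall x, a < x < b -> f x = g x) ->
  a < x < b -> derive1 f x = derive1 g x.
Proof.
move=> fg xab; rewrite !derive1E; apply: near_eq_derive.
by apply: filterS (near_oo xab) => y /fg.
Qed.

Lemma eq_is_derive a b f g x l : (forall x, a < x < b -> f x = g x) ->
  a < x < b -> is_derive x 1 f l -> is_derive x 1 g l.
Proof.
move=> fg xab; apply: near_eq_is_derive.
by apply: filterS (near_oo xab) => y /fg.
Qed.

Lemma eq_C1 a b f g : (forall x, a < x < b -> f x = g x) -> C1 a b f -> C1 a b g.
Proof.
move=> fg hf; apply: (C1I (g := derive1 f)).
  by move=> x xab; apply: (eq_is_derive fg xab); exact: C1_der hf xab.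
by move=> x xab; have [] := hf _ xab.
Qed.

Lemma C1D a b f g : C1 a b f -> C1 a b g -> C1 a b (fun x => f x + g x).
Proof.
move=> hf hg; apply: (C1I (g := fun x => derive1 f x + derive1 g x)) => x xab.
  by apply: derD; [exact: C1_der hf xab|exact: C1_der hg xab].
by apply: cvgD; [have [] := hf _ xab|have [] := hg _ xab].
Qed.

Lemma C1M a b f g : C1 a b f -> C1 a b g -> C1 a b (fun x => f x * g x).
Proof.
move=> hf hg; apply: (C1I (g := fun x => derive1 f x * g x + f x * derive1 g x)) => x xab.
  by apply: derM; [exact: C1_der hf xab|exact: C1_der hg xab].
have [_ h1] := hf _ xab; have [_ h2] := hg _ xab.
apply: cvgD; apply: cvgM => //; first exact: C1_continuous hg xab.
exact: C1_continuous hf xab.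
Qed.

Lemma C1_cst a b (k : R) : C1 a b (fun=> k).
Proof.
apply: (C1I (g := fun=> (0 : R))) => x _; exact: cvg_cst.
Qed.

Lemma C1V a b f : C1 a b f -> (forall x, a < x < b -> f x != 0) ->
  C1 a b (fun x => (f x)^-1).
Proof.
move=> hf f0; apply: (C1I (g := fun x => - derive1 f x / f x ^+ 2)) => x xab.
  by apply: derV; [exact: C1_der hf xab|exact: f0].
have [_ h1] := hf _ xab; have h2 := C1_continuous hf xab.
apply: cvgM; first exact: cvgN.
apply: cvgV; first by rewrite expf_neq0// f0.
by rewrite /GRing.exp /=; apply: cvgM.
Qed.

Lemma C1_sqrt a b f : C1 a b f -> (forall x, a < x < b -> 0 < f x) ->
  C1 a b (fun x => Num.sqrt (f x)).
Proof.
move=> hf f0.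
apply: (C1I (g := fun x => derive1 f x / (2 * Num.sqrt (f x)))) => x xab.
  by apply: der_sqrt; [exact: C1_der hf xab|exact: f0].
have [_ h1] := hf _ xab; have h2 := C1_continuous hf xab.
apply: cvgM => //; apply: cvgV.
  by rewrite mulf_neq0// gt_eqF// sqrtr_gt0 f0.
apply: cvgMr; apply: (@continuous_comp _ _ _ f (@Num.sqrt R)) => //.
exact: sqrt_continuous.
Qed.

Lemma C1_comp a b c d f g : C1 c d g -> C1 a b f ->
  (forall x, c < x < d -> a < g x < b) -> C1 c d (fun x => f (g x)).
Proof.
move=> hg hf cdab.
apply: (C1I (g := fun x => derive1 f (g x) * derive1 g x)) => x xcd.
  by apply: der_comp; [exact: C1_der hg xcd|apply: C1_der hf (cdab _ xcd)].
have [_ h1] := hg _ xcd; have [_ h2] := hf _ (cdab _ xcd).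
apply: cvgM => //; apply: (@continuous_comp _ _ _ g (derive1 f)) => //.
exact: C1_continuous hg xcd.
Qed.

Lemma C1_id a b : C1 a b id.
Proof.
apply: (C1I (g := fun=> (1 : R))) => x _; exact: cvg_cst.
Qed.

Lemma continuous_bounded a b c d f :
  (forall x, a < x < b -> {for x, continuous f}) -> a < c -> d < b ->
  exists2 M, 0 <= M & forall x, c <= x <= d -> `|f x| <= M.
Proof.
move=> cf ac db; have [cd|dc] := leP c d; last first.
  by exists 0 => // x /andP[cx xd]; exfalso; lra.
have cf' : {within `[c, d], continuous (fun x => `|f x|)}.
  apply: within_cc_oo ac db => x xab.
  by apply: (@continuous_comp _ _ _ f Num.norm); [exact: cf|exact: norm_continuous].
have [e _ he] := EVT_max cd cf'; exists `|f e|; first exact: normr_ge0.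
by move=> x xcd; exact: he.
Qed.

(** Differentiation under the integral sign, with the continuity of the
    derivative obtained from dominated convergence with the same dominating
    function H. *)
Lemma param_C1 (B : set R) u v (f f1 : R -> R -> R) (H : R -> R) :
  measurable B ->
  (forall w, u < w < v -> lam.-integrable B (EFin \o f w)) ->
  (forall w x, u < w < v -> B x -> is_derive w 1 (f ^~ x) (f1 w x)) ->
  (forall w x, u < w < v -> B x -> {for w, continuous (f1 ^~ x)}) ->
  (forall w, u < w < v -> measurable_fun B (f1 w)) ->
  (forall x, 0 <= H x) -> lam.-integrable B (EFin \o H) ->
  (forall w x, u < w < v -> B x -> `|f1 w x| <= H x) ->
  let F w := \int[lam]_(x in B) f w x in
  C1 u v F /\
  forall w, u < w < v -> derive1 F w = \int[lam]_(x in B) f1 w x.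
Proof.
move=> mB intf df cf1 mf1 H0 intH f1H F.
have f1E w x : u < w < v -> B x -> partial1of2 f w x = f1 w x.
  by move=> wuv Bx; rewrite /partial1of2 (is_derive_derive1 (df _ _ wuv Bx)).
have intf1 w : u < w < v -> lam.-integrable B (EFin \o f1 w).
  move=> wuv; apply: le_integrable intH => //.
    by apply/measurable_EFinP; exact: mf1.
  by move=> x Bx /=; rewrite lee_fin (le_trans (f1H _ _ wuv Bx))// ler_norm.
have dF w : u < w < v -> is_derive w 1 F (\int[lam]_(x in B) f1 w x).
  move=> wuv; have wI : [set` `]u, v[] w by rewrite /= in_itv.
  have intf' x : [set` `]u, v[] x -> lam.-integrable B (EFin \o f x).
    by rewrite /= in_itv/=; exact: intf.
  have df' x y : [set` `]u, v[] x -> B y -> derivable (f ^~ y) x 1.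
    by rewrite /= in_itv/= => xuv By; have [] := df _ _ xuv By.
  have ub x y : [set` `]u, v[] x -> B y -> `|partial1of2 f x y| <= H y.
    by rewrite /= in_itv/= => xuv By; rewrite f1E// f1H.
  have h1 := @derivable_under_integral R _ _ lam f B mB w u v wI intf' df' H H0 intH ub.
  have h2 := @differentiation_under_integral R _ _ lam f B mB w u v wI intf' df' H H0 intH ub.
  apply: DeriveDef => //; rewrite -derive1E h2.
  by apply: eq_Rintegral => x; rewrite inE => Bx; rewrite f1E.
split; last by move=> w wuv; exact: is_derive_derive1 (dF _ wuv).
apply: (C1I dF) => w wuv.
apply: (@continuity_under_integral _ _ _ lam f1 B mB u v _ _ H intH).
- by move=> x /=; rewrite in_itv/=; exact: intf1.
- by apply: aeW => y By x; rewrite inE/= in_itv/= => xuv; exact: cf1.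
- by move=> x; rewrite /= in_itv/= => xuv; apply: aeW => y By; exact: f1H.
- by rewrite inE/= in_itv.
Qed.

(** After x = w + (d - w) z^2 the part of the Abel integral near its
    singularity w becomes, up to the factor 2 sqrt (d - w), an integral of p
    over a fixed interval, with a bounded weight om: the singularity has
    disappeared and w enters only through the argument of p. *)
Definition near_Abel om p d w :=
  \int[lam]_(z in `[0, 1]) (om z * p (w + (d - w) * z ^+ 2)).

(** Away from the singularity the kernel psi (x - w) is smooth in w, and p
    need only be integrable up to b. *)
Definition far_Abel p psi d b w := \int[lam]_(x in `]d, b[) (p x * psi (x - w)).

Definition Abel p b w := \int[lam]_(x in `]w, b[) (p x / Num.sqrt (x - w)).

(** Differentiating in w brings out the factor 1 - z^2 from w + (d - w) z^2,
    so the derivative has the same shape with p replaced by its derivative;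
    this is what makes the argument iterate in Abel_C2. *)
Lemma near_Abel_C1 a b d om p : continuous om -> C1 a b p -> a < d < b ->
  C1 a d (near_Abel om p d) /\ forall w, a < w < d ->
  derive1 (near_Abel om p d) w = near_Abel (fun z => om z * (1 - z ^+ 2)) (derive1 p) d w.
Proof.
move=> com hp adb.
suff key w0 : a < w0 < d -> exists u v, [/\ u < w0 < v, C1 u v (near_Abel om p d) &
    forall w, u < w < v -> derive1 (near_Abel om p d) w =
      near_Abel (fun z => om z * (1 - z ^+ 2)) (derive1 p) d w].
  by split=> w /key[u [v [wuv h1 h2]]]; [exact: h1|exact: h2].
move=> w0ad; pose u := (a + w0) / 2; pose v := (w0 + d) / 2.
have [[au uw] [wv vd]] : (a < u /\ u < w0) /\ (w0 < v /\ v < d).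
  by rewrite /u /v; split; split; lra.
have cdp x : a < x < b -> {for x, continuous (derive1 p)} by move=> /hp[].
have [M M0 hM] : exists2 M, 0 <= M & forall x, u <= x <= d -> `|derive1 p x| <= M.
  by apply: (continuous_bounded cdp); lra.
have [W W0 hW] : exists2 W, 0 <= W & forall x, 0 <= x <= 1 -> `|om x| <= W.
  by apply: (@continuous_bounded (-1) 2) => *; [exact: com|lra|lra].
have zin w z : u < w < v -> 0 <= z <= 1 -> u < w + (d - w) * z ^+ 2 <= d.
  move=> wuv z01; have z21 : z ^+ 2 <= 1 by apply: exprn_ile1; lra.
  have z20 : 0 <= z ^+ 2 by rewrite sqr_ge0.
  have dw : 0 <= d - w by lra.
  have := mulr_ge0 dw z20; have : (d - w) * z ^+ 2 <= d - w by rewrite ler_piMr.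
  by move=> *; lra.
have cz w : continuous (fun z : R => w + (d - w) * z ^+ 2).
  by move=> z; apply: cvgD; [exact: cvg_cst|apply: cvgMr; exact: exprn_continuous].
have cof (k g : R -> R) w z : continuous k -> (forall x, a < x < b -> {for x, continuous g}) ->
    u < w < v -> 0 <= z <= 1 -> {for z, continuous (fun z => k z * g (w + (d - w) * z ^+ 2))}.
  move=> ck cg wuv z01; apply: cvgM; first exact: ck.
  apply: (@continuous_comp _ _ _ (fun z => w + (d - w) * z ^+ 2) g); first exact: cz.
  by apply: cg; have := zin _ _ wuv z01; lra.
have wcof (k g : R -> R) w : continuous k -> (forall x, a < x < b -> {for x, continuous g}) ->
    u < w < v -> {within `[0, 1], continuous (fun z => k z * g (w + (d - w) * z ^+ 2))}.
  move=> ck cg wuv; apply: continuous_in_subspaceT => z; rewrite inE/= in_itv/=.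
  exact: cof.
have c1z : continuous (fun z : R => om z * (1 - z ^+ 2)).
  move=> z; apply: cvgM; first exact: com.
  by apply: cvgB; [exact: cvg_cst|exact: exprn_continuous].
have hp' x : a < x < b -> {for x, continuous p} by exact: C1_continuous hp.
have : C1 u v (near_Abel om p d) /\ forall w, u < w < v -> derive1 (near_Abel om p d) w =
    near_Abel (fun z => om z * (1 - z ^+ 2)) (derive1 p) d w.
  apply: (@param_C1 `[0, 1] u v (fun w z => om z * p (w + (d - w) * z ^+ 2))
    (fun w z => om z * (1 - z ^+ 2) * derive1 p (w + (d - w) * z ^+ 2)) (fun=> W * M)).
  - by [].
  - move=> w wuv; apply: continuous_compact_integrable; first exact: segment_compact.
    exact: wcof.
  - move=> w z wuv; rewrite /= in_itv/= => z01.
    have zab : a < w + (d - w) * z ^+ 2 < b by have := zin _ _ wuv z01; lra.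
    have d1 := derD (der_id w) (derM (derB (der_cst d w) (der_id w)) (der_cst (z ^+ 2) w)).
    apply: (der_eq (derM (der_cst (om z) w) (der_comp d1 (C1_der hp zab)))).
    ring.
  - move=> w z wuv; rewrite /= in_itv/= => z01; apply: cvgMr.
    apply: (@continuous_comp _ _ _ (fun w => w + (d - w) * z ^+ 2) (derive1 p)).
      apply: cvgD; first exact: cvg_id.
      by apply: cvgMl; apply: cvgB; [exact: cvg_cst|exact: cvg_id].
    by apply: cdp; have := zin _ _ wuv z01; lra.
  - move=> w wuv; apply: subspace_continuous_measurable_fun => //.
    exact: wcof.
  - by move=> _; rewrite mulr_ge0.
  - apply: continuous_compact_integrable; first exact: segment_compact.
    by apply: continuous_subspaceT => ?; exact: cvg_cst.
  - move=> w z wuv; rewrite /= in_itv/= => z01; rewrite !normrM ler_pM ?mulr_ge0//.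
      rewrite -[W]mulr1 ler_pM// ?hW// ger0_norm ?subr_ge0 ?lerBlDr ?lerDl ?sqr_ge0//.
      by apply: exprn_ile1; lra.
    by apply: hM; have := zin _ _ wuv z01; lra.
move=> [h1 h2]; exists u, v; split => //.
by rewrite uw.
Qed.

Lemma far_Abel_C1 a b d p psi : lam.-integrable `]d, b[ (EFin \o p) ->
  (forall m, 0 < m -> C1 0 m psi) -> a < d ->
  C1 a d (far_Abel p psi d b) /\ forall w, a < w < d ->
  derive1 (far_Abel p psi d b) w = far_Abel p (fun s => - derive1 psi s) d b w.
Proof.
move=> ip hpsi ad; have [db|bd] := ltP d b; last first.
  have T0 q : far_Abel p q d b = fun=> 0.
    by apply/funext => w; rewrite /far_Abel set_itv_ge ?Rintegral_set0// bnd_simp -leNgt.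
  rewrite !T0; split; first exact: C1_cst.
  by move=> w _; rewrite (is_derive_derive1 (der_cst 0 w)).
have mp : measurable_fun `]d, b[ p by apply/measurable_EFinP; exact: measurable_int ip.
suff key w0 : a < w0 < d -> exists u v, [/\ u < w0 < v, C1 u v (far_Abel p psi d b) &
    forall w, u < w < v -> derive1 (far_Abel p psi d b) w = far_Abel p (fun s => - derive1 psi s) d b w].
  by split=> w /key[u [v [wuv h1 h2]]]; [exact: h1|exact: h2].
move=> w0ad; pose u := (a + w0) / 2; pose v := (w0 + d) / 2.
have [[au uw] [wv vd]] : (a < u /\ u < w0) /\ (w0 < v /\ v < d).
  by rewrite /u /v; split; split; lra.
have hm s : 0 < s -> derivable psi s 1 /\ {for s, continuous (derive1 psi)}.
  move=> s0; have s1 : 0 < s + 1 by lra.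
  by apply: (hpsi _ s1); lra.
have c1 x : 0 < x < b - u + 1 -> {for x, continuous (derive1 psi)} by move=> /andP[/hm[]].
have c0 x : 0 < x < b - u + 1 -> {for x, continuous psi}.
  by apply: C1_continuous; apply: hpsi; lra.
have [M M0 hM] : exists2 M, 0 <= M & forall x, d - v <= x <= b - u -> `|derive1 psi x| <= M.
  by apply: (continuous_bounded c1); lra.
have [W W0 hW] : exists2 M, 0 <= M & forall x, d - v <= x <= b - u -> `|psi x| <= M.
  by apply: (continuous_bounded c0); lra.
have mpsi (g : R -> R) w : (forall x, 0 < x < b - u + 1 -> {for x, continuous g}) ->
    u < w < v -> measurable_fun `]d, b[ (fun x => g (x - w)).
  move=> cg wuv; apply: measurable_fun_oo => x xdb.
  apply: (@continuous_comp _ _ _ (fun x => x - w) g).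
    by apply: cvgB; [exact: cvg_id|exact: cvg_cst].
  by apply: cg; lra.
have : C1 u v (far_Abel p psi d b) /\ forall w, u < w < v -> derive1 (far_Abel p psi d b) w =
    far_Abel p (fun s => - derive1 psi s) d b w.
  apply: (@param_C1 `]d, b[ u v (fun w x => p x * psi (x - w))
    (fun w x => p x * - derive1 psi (x - w)) (fun x => `|p x| * M)).
  - by [].
  - move=> w wuv; apply: (@integrableMl _ _ _ lam `]d, b[ _ (EFin \o p) (fun x => psi (x - w))) => //.
      exact: mpsi.
    exists W; split; first exact: num_real.
    move=> y Wy x; rewrite /= in_itv/= => xdb; rewrite (le_trans _ (ltW Wy))//.
    by apply: hW; lra.
  - move=> w x wuv; rewrite /= in_itv/= => xdb.
    have xw : 0 < x - w < b - u + 1 by lra.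
    have hd : is_derive (x - w) 1 psi (derive1 psi (x - w)).
      by apply: (@C1_der 0 (b - u + 1)) => //; apply: hpsi; lra.
    apply: (der_eq (derM (der_cst (p x) w) (der_comp (derB (der_cst x w) (der_id w)) hd))).
    ring.
  - move=> w x wuv; rewrite /= in_itv/= => xdb; apply: cvgMr; apply: cvgN.
    apply: (@continuous_comp _ _ _ (fun w => x - w) (derive1 psi)).
      by apply: cvgB; [exact: cvg_cst|exact: cvg_id].
    by apply: c1; lra.
  - move=> w wuv; apply: measurable_funM => //; apply: measurable_funN.
    exact: mpsi.
  - by move=> x; rewrite mulr_ge0.
  - apply: (@integrableMl _ _ _ lam `]d, b[ _ (EFin \o (fun x => `|p x|)) (fun=> M)) => //.
      exact: integrable_norm ip.
    by apply: bounded_cst.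
  - move=> w x wuv; rewrite /= in_itv/= => xdb; rewrite normrM normrN ler_wpM2l//.
    by apply: hM; lra.
move=> [h1 h2]; exists u, v; split => //.
by rewrite uw.
Qed.

Lemma integrable_inv_sqrtl w d : w < d ->
  lam.-integrable `]w, d[ (EFin \o (fun x => (Num.sqrt (x - w))^-1)).
Proof.
move=> wd; apply/integrableP; split.
  apply/measurable_EFinP; apply: measurable_fun_oo => x /andP[wx _].
  by apply: cvgV; [rewrite gt_eqF// sqrtr_gt0 subr_gt0|exact: continuous_sqrtBl].
under eq_integral do rewrite /= ger0_norm ?invr_ge0 ?sqrtr_ge0//.
by rewrite integral_inv_sqrtl// ltry.
Qed.

Lemma integrable_Abel_near a b w d p : (forall x, a < x < b -> {for x, continuous p}) ->
  a < w -> w < d -> d < b ->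
  lam.-integrable `]w, d[ (EFin \o (fun x => p x / Num.sqrt (x - w))).
Proof.
move=> cp aw wd db.
have [M M0 hM] := continuous_bounded cp aw db.
apply: (@integrableMr _ _ _ lam `]w, d[ _ p (EFin \o (fun x => (Num.sqrt (x - w))^-1))) => //.
- by apply: measurable_fun_oo => x xwd; apply: cp; lra.
- exists M; split; first exact: num_real.
  move=> y My x; rewrite /= in_itv/= => xwd; rewrite (le_trans _ (ltW My))//.
  by apply: hM; lra.
- exact: integrable_inv_sqrtl.
Qed.

Lemma integrable_Abel_far w d b p : lam.-integrable `]d, b[ (EFin \o p) -> w < d ->
  lam.-integrable `]d, b[ (EFin \o (fun x => p x / Num.sqrt (x - w))).
Proof.
move=> ip wd.
apply: (@integrableMl _ _ _ lam `]d, b[ _ (EFin \o p) (fun x => (Num.sqrt (x - w))^-1)) => //.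
  apply: measurable_fun_oo => x xdb.
  by apply: cvgV; [rewrite gt_eqF// sqrtr_gt0; lra|exact: continuous_sqrtBl].
exists (Num.sqrt (d - w))^-1; split; first exact: num_real.
move=> y My x; rewrite /= in_itv/= => /andP[dx xb]; rewrite (le_trans _ (ltW My))//.
rewrite ger0_norm ?invr_ge0 ?sqrtr_ge0// lef_pV2 ?posrE ?sqrtr_gt0 ?subr_gt0//.
  by rewrite ler_sqrt ?subr_ge0; lra.
by rewrite (lt_trans wd).
Qed.

Lemma itv_oo_split w d b : w < d -> d < b ->
  [set` `]w, b[] = [set` `]w, d]] `|` [set` `]d, b[] :> set R.
Proof.
move=> wd db; apply/seteqP; split=> x /=; rewrite !in_itv/=.
  by move=> /andP[wx xb]; rewrite wx xb/= andbT; have [xd|dx] := leP x d; [left|right].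
by case=> /andP[h1 h2]; apply/andP; split; lra.
Qed.

Lemma integrable_setU (f : R -> \bar R) (A B : set R) : measurable A -> measurable B ->
  [disjoint A & B] -> lam.-integrable A f -> lam.-integrable B f ->
  lam.-integrable (A `|` B) f.
Proof.
move=> mA mB AB /integrableP[mf1 h1] /integrableP[mf2 h2]; apply/integrableP; split.
  by apply/measurable_funU.
rewrite ge0_integral_setU//; first by rewrite lte_add_pinfty.
by apply: measurableT_comp => //; apply/measurable_funU.
Qed.

Lemma integrable_oo_split (f : R -> R) w d b : w < d -> d < b ->
  lam.-integrable `]w, d[ (EFin \o f) -> lam.-integrable `]d, b[ (EFin \o f) ->
  lam.-integrable `]w, b[ (EFin \o f).
Proof.
move=> wd db i1 i2; rewrite (itv_oo_split wd db).
apply: integrable_setU => //.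
  apply/disj_setPS => x [/=]; rewrite !in_itv/= => /andP[_ xd] /andP[dx _].
  by exfalso; lra.
move/integrableP : i1 => [mf h]; apply/integrableP; split.
  by apply/emeasurable_fun_itv_bndo_bndcP.
by rewrite -integral_itv_bndo_bndc//; exact: measurableT_comp.
Qed.

Lemma Rintegral_oo_split (f : R -> R) w d b : w < d -> d < b ->
  lam.-integrable `]w, d[ (EFin \o f) -> lam.-integrable `]d, b[ (EFin \o f) ->
  \int[lam]_(x in `]w, b[) f x =
    \int[lam]_(x in `]w, d[) f x + \int[lam]_(x in `]d, b[) f x.
Proof.
move=> wd db i1 i2; have iwb := integrable_oo_split wd db i1 i2.
rewrite (itv_oo_split wd db) Rintegral_setU//=.
- by congr (_ + _); rewrite -Rintegral_itv_bndo_bndc.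
- by rewrite -(itv_oo_split wd db).
- apply/disj_setPS => x [/=]; rewrite !in_itv/= => /andP[_ xd] /andP[dx _].
  by exfalso; lra.
Qed.

(** Cutting the integral at an auxiliary point d separates the singularity at
    w from the behaviour at b. *)
Lemma Abel_split a b w d p : (forall x, a < x < b -> {for x, continuous p}) ->
  lam.-integrable `]d, b[ (EFin \o p) -> a < w -> w < d -> d < b ->
  Abel p b w = far_Abel p (fun s => (Num.sqrt s)^-1) d b w +
               2 * Num.sqrt (d - w) * near_Abel (cst 1) p d w.
Proof.
move=> cp ip aw wd db.
rewrite /Abel (Rintegral_oo_split wd db); last 2 first.
- exact: integrable_Abel_near cp aw wd db.
- exact: integrable_Abel_far.
rewrite addrC; congr (_ + _).
have dw0 : 0 < d - w by rewrite subr_gt0.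
have zin z : 0 < z < 1 -> w < w + (d - w) * z ^+ 2 < d.
  move=> /andP[z0 z1]; have z21 : z ^+ 2 < 1 by rewrite expr_lt1// ltW.
  have z20 : 0 < z ^+ 2 by rewrite exprn_gt0.
  have := mulr_gt0 dw0 z20; have : (d - w) * z ^+ 2 < d - w by rewrite gtr_pMr.
  by move=> *; lra.
have dF z : 0 < z < 1 -> is_derive z 1 (fun z : R => w + (d - w) * z ^+ 2) (2 * (d - w) * z).
  move=> _; apply: (der_eq (derD (der_cst w z) (derM (der_cst (d - w) z) (derX 1 (der_id z))))).
  ring.
have cF : continuous (fun z : R => w + (d - w) * z ^+ 2).
  by move=> z; apply: cvgD; [exact: cvg_cst|apply: cvgMr; exact: exprn_continuous].
rewrite /Rintegral (@substitution_increasing_oo _ (fun z => 2 * (d - w) * z) (fun z => w + (d - w) * z ^+ 2) _ 0 1 w d)//.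
- have mpF : measurable_fun `]0 : R, 1 : R[ (fun z => p (w + (d - w) * z ^+ 2)).
    apply: measurable_fun_oo => z /zin h.
    apply: (@continuous_comp _ _ _ (fun z => w + (d - w) * z ^+ 2) p); first exact: cF.
    by apply: cp; lra.
  have -> : near_Abel (cst 1) p d w = \int[lam]_(z in `]0, 1[) p (w + (d - w) * z ^+ 2).
    rewrite /near_Abel /Rintegral; under eq_integral do rewrite mul1r.
    by rewrite integral_itv_bndoo//; exact/measurable_EFinP.
  rewrite -RintegralZl//; last first.
    apply: measurable_bounded_integrable => //.
      by rewrite [X in (X < _)%E](@lebesgue_measure_itv R `]0, 1[)/= lte_fin ltr01 -EFinB ltry.
    have [M M0 hM] := continuous_bounded cp aw db.
    exists M; split; first exact: num_real.
    move=> y My x; rewrite /= in_itv/= => x01; rewrite (le_trans _ (ltW My))//.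
    by apply: hM; have := zin _ x01; lra.
  apply: eq_Rintegral => z; rewrite inE/= in_itv/= => /andP[z0 z1].
  rewrite addrAC subrr add0r sqrtrM ?(ltW dw0)// sqrtr_sqr ger0_norm ?(ltW z0)//.
  rewrite -[X in 2 * X * z](sqr_sqrtr (ltW dw0)).
  have s0 : Num.sqrt (d - w) != 0 by rewrite gt_eqF// sqrtr_gt0.
  by field; rewrite s0 gt_eqF.
- move=> z _; apply: cvgMr; exact: cvg_id.
- by move=> z /andP[z0 _]; rewrite !mulr_gt0.
- apply: cvg_at_right_filter; apply: cvg_eq; first exact: cF.
  by rewrite expr0n mulr0 addr0.
- apply: cvg_at_left_filter; apply: cvg_eq; first exact: cF.
  by rewrite expr1n mulr1 addrC subrK.
- move=> x /andP[wx xd]; apply: cvgM; first by apply: cp; lra.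
  by apply: cvgV; [rewrite gt_eqF// sqrtr_gt0 subr_gt0|exact: continuous_sqrtBl].
Qed.

Let C1_inv_sqrt m : 0 < m -> C1 0 m (fun s : R => (Num.sqrt s)^-1).
Proof.
move=> m0; apply: C1V; first by apply: C1_sqrt; [exact: C1_id|move=> x /andP[]].
by move=> x /andP[x0 _]; rewrite gt_eqF// sqrtr_gt0.
Qed.

Let derive1_inv_sqrt s : 0 < s ->
  derive1 (fun s : R => (Num.sqrt s)^-1) s = - (2 * (s * Num.sqrt s))^-1.
Proof.
move=> s0; have q0 : Num.sqrt s != 0 by rewrite gt_eqF// sqrtr_gt0.
rewrite (is_derive_derive1 (derV (der_sqrt (der_id s) s0) q0)) sqr_sqrtr ?ltW//.
by field; rewrite q0 gt_eqF.
Qed.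

Let C1_derive1_inv_sqrt m : 0 < m ->
  C1 0 m (fun s => - derive1 (fun s : R => (Num.sqrt s)^-1) s).
Proof.
move=> m0; apply: (@eq_C1 _ _ (fun s => (2 * (s * Num.sqrt s))^-1)).
  by move=> x /andP[x0 _]; rewrite derive1_inv_sqrt// opprK.
apply: C1V.
  apply: C1M; first exact: C1_cst; apply: C1M; first exact: C1_id.
  by apply: C1_sqrt; [exact: C1_id|move=> x /andP[]].
by move=> x /andP[x0 _]; rewrite !mulf_neq0// gt_eqF// sqrtr_gt0.
Qed.

Let C1_sqrtBr a d : C1 a d (fun w => 2 * Num.sqrt (d - w)).
Proof.
apply: C1M; first exact: C1_cst.
apply: C1_sqrt; last by move=> x /andP[_ xd]; rewrite subr_gt0.
apply: (C1I (g := fun=> -1)) => x _; last exact: cvg_cst.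
by apply: (der_eq (derB (der_cst d x) (der_id x))); rewrite sub0r.
Qed.

Lemma Abel_C1 a b p : C1 a b p ->
  (forall d, a < d < b -> lam.-integrable `]d, b[ (EFin \o p)) ->
  C1 a b (Abel p b).
Proof.
move=> hp ip w wab; pose d := (w + b) / 2.
have [wd db] : w < d /\ d < b by rewrite /d; split; lra.
have adb : a < d < b by lra.
have wad : a < w < d by lra.
have cp x : a < x < b -> {for x, continuous p} by exact: C1_continuous hp.
have [hT _] := far_Abel_C1 (ip _ adb) C1_inv_sqrt (andP adb).1.
have [hB _] := @near_Abel_C1 a b d (cst 1) p (@cst_continuous _ _ (1 : R)) hp adb.
suff : C1 a d (Abel p b) by apply.
apply: eq_C1; last by apply: C1D; [exact: hT|apply: C1M; [exact: C1_sqrtBr|exact: hB]].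
by move=> x /andP[ax xd] /=; rewrite (Abel_split cp (ip _ adb)).
Qed.

(** The two pieces of Abel_split are differentiated once more: p enters the
    far piece undifferentiated, so that near b only its integrability matters,
    and the near piece through its derivative. *)
Lemma Abel_C2 a b p : C1 a b p -> C1 a b (derive1 p) ->
  (forall d, a < d < b -> lam.-integrable `]d, b[ (EFin \o p)) ->
  C1 a b (derive1 (Abel p b)).
Proof.
move=> hp hp' ip w wab; pose d := (w + b) / 2.
have [wd db] : w < d /\ d < b by rewrite /d; split; lra.
have adb : a < d < b by lra.
have wad : a < w < d by lra.
have cp x : a < x < b -> {for x, continuous p} by exact: C1_continuous hp.
have ad := (andP adb).1.
have [hT dT] := far_Abel_C1 (ip _ adb) C1_inv_sqrt ad.
have [hT' _] := far_Abel_C1 (ip _ adb) C1_derive1_inv_sqrt ad.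
have [hB dB] := @near_Abel_C1 a b d (cst 1) p (@cst_continuous _ _ (1 : R)) hp adb.
have c1z : continuous (fun z : R => cst 1 z * (1 - z ^+ 2)).
  move=> z; apply: cvgMr.
  by apply: cvgB; [exact: cvg_cst|exact: exprn_continuous].
have [hB' _] := @near_Abel_C1 a b d _ (derive1 p) c1z hp' adb.
suff : C1 a d (derive1 (Abel p b)) by apply.
apply: (@eq_C1 _ _ (fun w =>
  far_Abel p (fun s => - derive1 (fun s => (Num.sqrt s)^-1) s) d b w +
  (- (Num.sqrt (d - w))^-1 * near_Abel (cst 1) p d w +
   2 * Num.sqrt (d - w) * near_Abel (fun z => cst 1 z * (1 - z ^+ 2)) (derive1 p) d w))).
  move=> x xad; have /andP[ax xd] := xad.
  have hE y : a < y < d -> Abel p b y = far_Abel p (fun s => (Num.sqrt s)^-1) d b y +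
               2 * Num.sqrt (d - y) * near_Abel (cst 1) p d y.
    by move=> /andP[ay yd]; rewrite (Abel_split cp (ip _ adb)).
  rewrite (eq_derive1 hE xad).
  rewrite (is_derive_derive1 (derD (C1_der hT xad)
    (derM (derM (der_cst 2 x) (is_derive_sqrtBr xd)) (C1_der hB xad)))).
  rewrite -dT// -dB//; congr (_ + (_ * _ + _)).
  by rewrite mul0r add0r invfM mulrN mulrA divff ?mul1r.
apply: C1D; first exact: hT'.
apply: C1D; last by apply: C1M; [exact: C1_sqrtBr|exact: hB'].
apply: C1M; last exact: hB.
apply: (@eq_C1 _ _ (fun w => -2 * (2 * Num.sqrt (d - w))^-1)).
  by move=> x _; rewrite invfM mulrA mulNr divff// mulN1r.
apply: C1M; first exact: C1_cst.
apply: C1V; first exact: C1_sqrtBr.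
by move=> x /andP[_ xd]; rewrite mulf_neq0// gt_eqF// sqrtr_gt0 subr_gt0.
Qed.

End C1.

(** * Densities from distribution functions *)

Section density_measure.
Import HBNNSimple.
Context d (T : measurableType d) (R : realType).
Variables (m : {measure set T -> \bar R}) (f : T -> \bar R).
Hypotheses (mf : measurable_fun setT f) (f0 : forall x, (0 <= f x)%E).
Local Open Scope ereal_scope.

(** The measure with density f. The two proof arguments make the measure
    instance inferable from the term. *)
Definition dens (mf' : measurable_fun setT f) (f0' : forall x, 0 <= f x) :
  set T -> \bar R := fun A => \int[m]_(x in A) f x.

Let dens0 : dens mf f0 set0 = 0. Proof. exact: integral_set0. Qed.

Let dens_ge0 A : 0 <= dens mf f0 A. Proof. exact: integral_ge0. Qed.

Let dens_sigma_additive : semi_sigma_additive (dens mf f0).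
Proof. exact: semi_sigma_additive_nng_induced. Qed.

HB.instance Definition _ := isMeasure.Build _ _ _ (dens mf f0)
  dens0 dens_ge0 dens_sigma_additive.

Let mfT (D : set T) : measurable_fun D f.
Proof. exact: measurable_funTS. Qed.

Let integral_dens_nnsfun (g : {nnsfun T >-> R}) :
  \int[dens mf f0]_x (g x)%:E = \int[m]_x ((g x)%:E * f x).
Proof.
transitivity (\sum_(k \in range g) k%:E * \int[m]_(x in g @^-1` [set k]) f x).
  under eq_integral do rewrite fimfunE -fsumEFin//.
  rewrite ge0_integral_fsum//; last 2 first.
  - by move=> y; exact/measurable_EFinP/measurable_funM.
  - by move=> y x _; rewrite nnfun_muleindic_ge0.
  apply: eq_fsbigr => r _; rewrite integralZl_indic_nnsfun// integral_indic//=.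
  by rewrite setIT.
transitivity (\int[m]_x \sum_(k \in range g) (k * \1_(g @^-1` [set k]) x)%:E * f x).
  rewrite ge0_integral_fsum//; last 2 first.
  - move=> y; apply: emeasurable_funM; last exact: mfT.
    exact/measurable_EFinP/measurable_funM.
  - by move=> y x _; rewrite mule_ge0// nnfun_muleindic_ge0.
  apply: eq_fsbigr => r; rewrite inE => -[y _ yr].
  under [RHS]eq_integral do rewrite EFinM -muleA.
  rewrite ge0_integralZl//.
  - rewrite [in LHS]integral_mkcond; congr (_ * _).
    by apply: eq_integral => x _; rewrite epatch_indic muleC.
  - apply: emeasurable_funM; last exact: mfT.
    by apply/measurable_EFinP; exact: measurable_indic.
  - by move=> x _; rewrite mule_ge0// lee_fin.
  - by rewrite lee_fin -yr.
apply: eq_integral => x _; rewrite -ge0_mule_fsuml; last first.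
  by move=> y; rewrite nnfun_muleindic_ge0.
by rewrite fsumEFin// -fimfunE.
Qed.

(** Checked on simple functions and extended by monotone convergence; f may
    take the value +oo. *)
Lemma ge0_integral_dens (h : T -> \bar R) : measurable_fun setT h ->
  (forall x, 0 <= h x) -> \int[dens mf f0]_x h x = \int[m]_x (h x * f x).
Proof.
move=> mh h0; pose h_ := nnsfun_approx measurableT mh.
transitivity (lim (\int[dens mf f0]_x (h_ n x)%:E @[n --> \oo])).
  rewrite -monotone_convergence//=.
  - apply: eq_integral => x _; apply/esym/cvg_lim => //=.
    exact: cvg_nnsfun_approx.
  - by move=> n; exact/measurable_EFinP/measurable_funTS.
  - by move=> n ? _; rewrite lee_fin.
  - by move=> ? _ ? ? mn; rewrite lee_fin; exact/lefP/nd_nnsfun_approx.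
rewrite [X in lim (X @ _)](_ : _ = fun n => \int[m]_x ((h_ n x)%:E * f x)); last first.
  by apply/funext => n; exact: integral_dens_nnsfun.
rewrite -monotone_convergence//=.
- apply: eq_integral => x _; apply/cvg_lim => //=.
  have := @cvg_nnsfun_approx _ _ _ _ measurableT _ mh (fun x _ => h0 x) x I => hc.
  have [->|fx0] := eqVneq (f x) 0.
    by rewrite mule0; under eq_fun do rewrite mule0; exact: cvg_cst.
  have [fy|/negP fy] := boolP (f x \is a fin_num).
    by apply: cvgeZr.
  have {}fy : f x = +oo by move: fy (f0 x); case: (f x).
  rewrite fy; have [h0x|h0x] := eqVneq (h x) 0.
    rewrite h0x mul0e (_ : (fun n => _) = cst 0); first exact: cvg_cst.
    apply/funext => n; rewrite /h_.
    have := @le_approx _ _ _ setT h n x (fun x _ => h0 x) I.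
    rewrite -(nnsfun_approxE measurableT mh) h0x lee_fin => hn; have -> : nnsfun_approx measurableT mh n x = 0%R.
      by apply/le_anti/andP; split.
    by rewrite mul0e.
  have hx : 0 < h x by rewrite lt_neqAle eq_sym h0x h0.
  rewrite gt0_muley//; apply: cvg_near_cst.
  near=> n; rewrite gt0_muley//.
  by near: n; exact: hc (open_nbhs_nbhs (conj (@open_ereal_gt_ereal _ _) hx)).
- move=> n; apply: emeasurable_funM => //.
  exact/measurable_EFinP/measurable_funTS.
- by move=> n x _; rewrite mule_ge0// lee_fin.
- move=> x _ a b ab; apply: lee_wpmul2r => //.
  by rewrite lee_fin; exact/lefP/nd_nnsfun_approx.
Unshelve. all: by end_near. Qed.

End density_measure.

Section cdf_density.
Context {R : realType}.
Notation lam := (@lebesgue_measure R).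
Variables (n : {finite_measure set (measurableTypeR R) -> \bar R}).
Variables (a b : R) (Phi phi : R -> R).
Hypothesis ab : a < b.
Hypothesis n_itv : n (~` [set` `]a, b[]) = 0%E.
Hypothesis dPhi : forall t, a < t < b -> is_derive t 1 Phi (- phi t).
Hypothesis cphi : forall t, a < t < b -> {for t, continuous phi}.
Hypothesis nPhi : forall t, a < t < b -> n [set` `]t, b[] = (Phi t)%:E.

(** The tails decrease, hence so does Phi; subtracting a small linear term
    makes the decrease strict. *)
Lemma tail_density_ge0 t : a < t < b -> 0 <= phi t.
Proof.
move=> tab; rewrite -oppr_le0; apply/ler_addgt0Pl => e e0.
pose P x := Phi x - e * x.
have dP x : a < x < b -> is_derive x 1 P (- phi x - e).
  move=> xab; apply: (der_eq (derB (dPhi xab) (derM (der_cst e x) (der_id x)))).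
  by rewrite mul0r add0r mulr1.
suff : derive1 P t <= 0 by rewrite (is_derive_derive1 (dP _ tab)) subr_le0 addr0.
apply: (@decr_derive1_le0_itv R P false true a b t); last first.
- by rewrite in_itv.
- move=> x y; rewrite !in_itv/= => xab yab xy.
  have : Phi x <= Phi y.
    rewrite -lee_fin -!nPhi//; apply: le_measure; rewrite ?inE//.
    by move=> z; rewrite /= !in_itv/= => /andP[? ?]; lra.
  by rewrite /P; have : e * y < e * x; [rewrite ltr_pM2l|lra].
- by move=> x; rewrite inE/= in_itv/= => xab; have [] := dP _ xab.
Qed.

Let m_phi : measurable_fun `]a, b[ phi.
Proof. exact: measurable_fun_oo. Qed.

Let n_oc s t : a < s -> s <= t -> t < b -> n [set` `]s, t]] = (Phi s - Phi t)%:E.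
Proof.
move=> as_ st tb.
have -> : [set` `]s, t]] = [set` `]s, b[] `\` [set` `]t, b[] :> set (measurableTypeR R).
  apply/seteqP; split=> x /=; rewrite !in_itv/=.
    by move=> /andP[sx xt]; split; [lra|move=> /andP[]; lra].
  by move=> [/andP[sx xb] /negP]; rewrite xb andbT -leNgt sx.
have sfin : (n [set` `]s, b[] < +oo)%E by rewrite nPhi ?ltry//; lra.
rewrite measureD//.
rewrite (_ : [set` `]s, b[] `&` [set` `]t, b[] = [set` `]t, b[] :> set (measurableTypeR R)).
  by rewrite EFinB; congr (_ - _)%E; apply: nPhi; lra.
by apply/setIidPr => x /=; rewrite !in_itv/= => /andP[? ?]; lra.
Qed.

Let int_cc s t : a < s -> s <= t -> t < b ->
  (\int[lam]_(x in `[s, t]) (phi x)%:E = (Phi s - Phi t)%:E)%E.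
Proof.
move=> as_; rewrite le_eqVlt => /predU1P[->|st] tb.
  by rewrite subrr set_itv1 integral_set1.
have dP x : a < x < b -> derivable (fun x => - Phi x) x 1.
  by move=> xab; have [] := derN (dPhi xab).
have cP x : a < x < b -> {for x, continuous (fun x => - Phi x)}.
  by move=> xab; exact: der_continuous (derN (dPhi xab)).
rewrite (@continuous_FTC2 _ phi (fun x => - Phi x) s t)//.
- by rewrite -EFinB; congr (_%:E); ring.
- exact: within_cc_oo cphi as_ tb.
- split; first by move=> x; rewrite in_itv/= => ?; apply: dP; lra.
  + by apply: cvg_at_right_filter; apply: cP; lra.
  + by apply: cvg_at_left_filter; apply: cP; lra.
- move=> x; rewrite in_itv/= => sxt; have xab : a < x < b by lra.
  by rewrite (is_derive_derive1 (derN (dPhi xab))) opprK.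
Qed.

Let n_oo s t : a <= s -> s < t -> t <= b ->
  n [set` `]s, t[] = (\int[lam]_(x in `]s, t[) (phi x)%:E)%E.
Proof.
move=> as_ st tb.
have sab x : s < x < t -> a < x < b by lra.
pose u k := [set` `]s + inset s t k, t - inset s t k]] : set (measurableTypeR R).
have hu k : s < s + inset s t k /\ t - inset s t k < t.
  by have := inset_gt0 k st; lra.
have cup : \bigcup_k u k = [set` `]s, t[].
  apply/seteqP; split=> [x [k _]|x].
    by rewrite /u /= !in_itv/=; have [] := hu k; lra.
  rewrite -(bigcup_inset st) => -[k _] /=; rewrite in_itv/= => /andP[h1 h2].
  exists k.+1 => //; rewrite /u /= in_itv/=.
  have h : inset s t k.+1 < inset s t k.
    rewrite /inset ltr_pM2l ?divr_gt0 ?subr_gt0// ltf_pV2 ?posrE ?ltr_nat//.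
  by lra.
have ndu : nondecreasing_seq u.
  move=> i j ij; apply/subsetPset => x; rewrite /u /= !in_itv/=.
  by have := inset_noninc st ij; lra.
have mu k : measurable (u k) by exact: measurable_itv.
have h1 : n (u k) @[k --> \oo] --> n [set` `]s, t[].
  by rewrite -cup; apply: nondecreasing_cvg_mu => //; exact: bigcupT_measurable.
have h2 := @ge0_integral_oo_cvg R s t (EFin \o phi) st _ _.
apply: (cvg_unique _ h1) => //.
rewrite (_ : (fun k => n (u k)) = fun k => (\int[lam]_(x in
    `[(s + inset s t k)%R, (t - inset s t k)%R]) (phi x)%:E)%E).
  apply: h2.
    apply/measurable_EFinP; apply: measurable_fun_oo => x /sab; exact: cphi.
  by move=> x /sab; rewrite /= lee_fin; exact: tail_density_ge0.
apply/funext => k; have [h3 h4] := hu k; have h5 := inset_lt k st.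
by rewrite int_cc ?n_oc//; lra.
Qed.

Let f x := (phi \_ `]a, b[ x)%:E.

Let mf : measurable_fun setT f.
Proof.
apply/measurable_EFinP; exact/(measurable_restrictT _ _).1.
Qed.

Let f0 x : (0 <= f x)%E.
Proof.
rewrite /f lee_fin patchE; case: ifPn => //; rewrite inE/= in_itv/=.
exact: tail_density_ge0.
Qed.

Let dens_f (A : set (measurableTypeR R)) : measurable A ->
  dens lam mf f0 A = (\int[lam]_(x in A `&` `]a, b[) (phi x)%:E)%E.
Proof.
move=> mA; rewrite /dens integral_mkcondr; apply: eq_integral => x _.
by rewrite /f restrict_EFin.
Qed.

Let n_in (A : set (measurableTypeR R)) : measurable A -> n A = n (A `&` [set` `]a, b[]).
Proof.
move=> mA; have mI : measurable ([set` `]a, b[] : set (measurableTypeR R)) by exact: measurable_itv.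
rewrite -[in LHS](setUIDK A [set` `]a, b[]) measureU//=; last 3 first.
- exact: measurableI.
- exact: measurableD.
- by rewrite setDE setIACA setICr setI0.
rewrite (_ : n (A `\` _) = 0%E) ?adde0//.
apply: (subset_measure0 _ _ _ n_itv) => //; first exact: measurableD.
exact: measurableC.
Qed.

Let n_dens (A : set (measurableTypeR R)) : measurable A -> n A = dens lam mf f0 A.
Proof.
pose g k := [set` `](- k%:R)%R, +oo[] : set (measurableTypeR R).
apply: (@measure_unique _ R (measurableTypeR R) (@RGenOInfty.G R) g _ _ _ _ n [the {measure set (measurableTypeR R) -> \bar R} of dens lam mf f0]).
- exact: RGenOInfty.measurableE.
- move=> _ _ [x ->] [y ->]; exists (Num.max x y).
  apply/seteqP; split=> z; rewrite /= !in_itv/= !andbT gt_max => /andP//.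
- by move=> k; exists (- k%:R).
- apply/seteqP; split=> // x _; exists (Num.truncn `|x|).+1 => //.
  rewrite /g /= in_itv/= andbT ltrNl.
  by rewrite (le_lt_trans (ler_norm _))// normrN truncnS_gt.
- move=> _ [x ->]; rewrite [RHS]dens_f; last exact: measurable_itv.
  transitivity (n ([set` `]x, +oo[] `&` [set` `]a, b[])).
    exact: (n_in (measurable_itv _)).
  have [bx|xb] := leP b x.
    have -> : [set` `]x, +oo[] `&` [set` `]a, b[] = set0 :> set R.
      by rewrite -subset0 => z; rewrite /= !in_itv/= andbT => -[]; lra.
    by rewrite measure0 integral_set0.
  have -> : [set` `]x, +oo[] `&` [set` `]a, b[] = [set` `](Num.max a x), b[] :> set R.
    apply/seteqP; split=> z; rewrite /= !in_itv/= gt_max andbT.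
      by move=> [-> /andP[-> ->]].
    by move=> /andP[/andP[-> ->] ->].
  by apply: n_oo; rewrite ?le_max ?lexx// gt_max ab.
- by move=> k; rewrite -ge0_fin_numE// fin_num_measure//; exact: measurable_itv.
Qed.

(** A finite measure whose tails have a C^1 density: it agrees with the
    density measure on half-lines, a pi-system generating the Borel sets. The
    integrability of phi follows from the finiteness of n. *)
Lemma ge0_integral_tail_density (h : R -> \bar R) :
  measurable_fun setT h -> (forall x, 0 <= h x)%E ->
  (\int[n]_x h x = \int[lam]_(x in `]a, b[) (h x * (phi x)%:E))%E.
Proof.
move=> mh h0; transitivity (\int[dens lam mf f0]_x h x)%E.
  by apply: eq_measure_integral => A mA _; exact: n_dens.
rewrite ge0_integral_dens// [RHS]integral_mkcond; apply: eq_integral => x _.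
by rewrite /f /patch; case: ifPn => // _; rewrite mule0.
Qed.

End cdf_density.

(** * Borel sets of R^3 and the Newtonian kernel *)

Section borelR3.
Context {R : realType}.
Local Notation V := 'rV[R]_3.
Local Notation B3 := (borelR3 R).

Lemma open_measurableR3 (U : set V) : open U -> measurable (U : set B3).
Proof. by move=> oU; exact: sub_sigma_algebra. Qed.

Lemma continuous_measurableR3 (f : V -> R) : continuous f ->
  measurable_fun setT (f : B3 -> R).
Proof.
move=> /continuousP cf; apply: (measurability _ (RGenOInfty.measurableE R)).
move=> _ [_ [a ->] <-]; rewrite setTI; apply: open_measurableR3.
by apply: cf; exact: interval_open.
Qed.

Lemma measurable_coord (i : 'I_3) : measurable_fun setT ((fun x : V => x 0 i) : B3 -> R).
Proof. by apply: continuous_measurableR3; exact: coord_continuous. Qed.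

(** A countable base of boxes: an open set is a countable union of them, hence
    belongs to any sigma-algebra that contains the coordinate half-spaces. *)
Lemma open_rat_boxes (U : set V) : open U ->
  U = \bigcup_(p in [set p : {ffun 'I_3 -> rat} * rat |
        [set y : V | forall i, `|y 0 i - ratr (p.1 i)| < ratr p.2] `<=` U])
      [set y : V | forall i, `|y 0 i - ratr (p.1 i)| < ratr p.2].
Proof.
move=> oU; apply/seteqP; split=> x; last by move=> [p /= pU] /pU.
move=> Ux; have /nbhs_ballP[e /= e0 eU] : nbhs x U by exact: open_nbhs_nbhs.
have [s] : exists s : rat, ratr s \in `]e / 4, e / 2[.
  by have [|s] := @rat_in_itvoo R (e / 4) (e / 2); [lra|exists s].
rewrite in_itv/= => /andP[s1 s2].
have hq i : exists q : rat, `|x 0 i - ratr q| < ratr s.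
  have [|q] := @rat_in_itvoo R (x 0 i - ratr s) (x 0 i + ratr s); first lra.
  by rewrite in_itv/= => /andP[q1 q2]; exists q; rewrite ltr_norml; lra.
have [q hq'] := choice hq.
exists ([ffun i => q i], s); last by move=> i /=; rewrite ffunE.
move=> y /= hy; apply: eU; split => // j i; rewrite ord1.
have := hy i; have := hq' i; rewrite /ball/= ffunE !ltr_norml => h1 h2; lra.
Qed.

Lemma measurable_fun_coords d (T : measurableType d) (h : T -> B3) :
  (forall i, measurable_fun setT (fun t => (h t : V) 0 i)) -> measurable_fun setT h.
Proof.
move=> mh; apply: (@measurability _ _ T B3 setT h (@open V)) => //.
move=> _ [U oU <-]; rewrite setTI (open_rat_boxes oU) preimage_bigcup.
rewrite bigcup_mkcond; apply: countable_bigcupT_measurable; first exact: countableP.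
move=> p; case: ifPn => // _.
rewrite [X in measurable X](_ : _ = \bigcap_(i in [set: 'I_3])
  (fun t => `|(h t : V) 0 i - ratr (p.1 i)|) @^-1` `]-oo, ratr p.2[); last first.
  apply/seteqP; split=> t /= ht; last by move=> i; have := ht i I; rewrite /= in_itv.
  by move=> i _; rewrite /= in_itv/=.
apply: fin_bigcap_measurable => // i _.
rewrite -[X in measurable X]setTI.
have : measurable_fun setT (fun t => `|(h t : V) 0 i - ratr (p.1 i)|).
  by apply: measurableT_comp => //; apply: measurable_funB.
by apply => //; exact: measurable_itv.
Qed.

Definition octant (a : 'I_3 -> R) : set V := [set x | forall i, x 0 i <= a i].

Lemma measurable_octant a : measurable (octant a : set B3).
Proof.
rewrite (_ : octant a = \bigcap_(i in [set: 'I_3])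
  (setT `&` (fun x : V => x 0 i) @^-1` `]-oo, a i])); last first.
  apply/seteqP; split=> x /= hx; last by move=> i; have [_] := hx i I; rewrite /= in_itv.
  by move=> i _; split; rewrite //= in_itv/=.
apply: fin_bigcap_measurable => // i _.
by apply: measurable_coord => //; exact: measurable_itv.
Qed.

(** Octants form a pi-system that generates the Borel sets. *)
Lemma octant_unique (m1 m2 : {finite_measure set B3 -> \bar R}) :
  (forall a, m1 (octant a) = m2 (octant a)) ->
  forall A, measurable A -> m1 A = m2 A.
Proof.
move=> m12 A mA.
pose G : set (set V) := range octant.
have sG : <<s @open V >> = <<s G >>.
  apply/seteqP; split; last first.
    apply: smallest_sub; first exact: smallest_sigma_algebra.
    by move=> _ [a _ <-]; exact: measurable_octant.
  apply: smallest_sub; first exact: smallest_sigma_algebra.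
  move=> U oU.
  have mid : measurable_fun setT ((fun x => x) : g_sigma_algebraType G -> B3).
    apply: measurable_fun_coords => i; apply: (measurability _ (RGenOInfty.measurableE R)).
    move=> _ [_ [a ->] <-]; rewrite setTI.
    pose b (k : nat) (j : 'I_3) := if j == i then a else k%:R : R.
    rewrite [X in measurable X](_ : _ = ~` \bigcup_k octant (b k)); last first.
      apply/seteqP; split=> x /=; rewrite in_itv/= andbT.
        by move=> ax [k _ /(_ i)]; rewrite /b eqxx leNgt ax.
      move=> h; rewrite ltNge; apply/negP => xa; apply: h.
      exists (Num.truncn (\sum_(j < 3) `|x 0 j|)).+1 => // j; rewrite /b.
      case: eqVneq => [->//|_]; apply/ltW; apply: le_lt_trans (truncnS_gt _).
      rewrite (le_trans (ler_norm _))// (bigD1 j)//= lerDl.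
      by rewrite sumr_ge0.
    apply: measurableC; apply: bigcupT_measurable => k.
    by apply: sub_sigma_algebra; exists (b k).
  have := mid measurableT U (open_measurableR3 oU).
  by rewrite setTI preimage_id.
apply: (@measure_unique _ R B3 G (fun k => octant (fun=> k%:R)) _ _ _ _ m1 m2) => //.
- by move=> _ _ [a _ <-] [b _ <-]; exists (fun i => Num.min (a i) (b i)) => //;
    apply/seteqP; split=> x /=; [move=> h; split=> i; have := h i; rewrite le_min => /andP[]|
      move=> [h1 h2] i; rewrite le_min h1 h2].
- by move=> k; exists (fun=> k%:R).
- apply/seteqP; split=> // x _.
  exists (Num.truncn (\sum_(j < 3) `|x 0 j|)).+1 => // j.
  apply/ltW; apply: le_lt_trans (truncnS_gt _).
  rewrite (le_trans (ler_norm _))// (bigD1 j)//= lerDl.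
  by rewrite sumr_ge0.
- by move=> _ [a _ <-]; exact: m12.
- by move=> k; rewrite -ge0_fin_numE// fin_num_measure//; exact: measurable_octant.
Qed.

Definition kern (x y : V) : \bar R := (((enorm (x - y))%:E)^-1)%E.

Lemma enormE (x : V) : enorm x = Num.sqrt (x 0 0 ^+ 2 + x 0 1 ^+ 2 + x 0 ord_max ^+ 2).
Proof.
rewrite /enorm !big_ord_recl big_ord0 addr0 addrA; congr (Num.sqrt (_ + x 0 _ ^+ 2 + x 0 _ ^+ 2)).
  by apply: val_inj.
by apply: val_inj.
Qed.

Lemma enorm_continuous : continuous (@enorm R).
Proof.
rewrite (_ : @enorm R = fun x => Num.sqrt (x 0 0 ^+ 2 + x 0 1 ^+ 2 + x 0 ord_max ^+ 2)); last first.
  by apply/funext => x; exact: enormE.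
move=> x; apply: (@continuous_comp _ _ _
  (fun x : V => x 0 0 ^+ 2 + x 0 1 ^+ 2 + x 0 ord_max ^+ 2) (@Num.sqrt R)); last exact: sqrt_continuous.
have cX i : {for x, continuous (fun y : V => y 0 i ^+ 2)}.
  apply: (@continuous_comp _ _ _ (fun x : V => x 0 i) (fun y => y ^+ 2)); first exact: coord_continuous.
  exact: exprn_continuous.
by apply: continuousD; [apply: continuousD|]; exact: cX.
Qed.

Lemma measurable_sphere2 : measurable (@sphere2 R : set B3).
Proof.
rewrite (_ : @sphere2 R = setT `&` (@enorm R) @^-1` [set 1]).
  by apply: (continuous_measurableR3 enorm_continuous) => //; exact: measurable_set1.
by rewrite setTI.
Qed.

Lemma measurable_invr : measurable_fun setT (@GRing.inv R).
Proof.
have -> : [set: R] = [set x | x != 0] `|` [set 0].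
  by apply/seteqP; split=> // x _ /=; have [->|] := eqVneq x 0; [right|left].
have o0 : open [set x : R | x != 0].
  rewrite (_ : [set x | x != 0] = ~` [set 0]); last first.
    by apply/seteqP; split=> x /= /eqP.
  by apply: closed_openC; exact: closed_eq.
apply/measurable_funU.
- exact: open_measurable.
- exact: measurable_set1.
split; last exact: measurable_fun_set1.
by apply: open_continuous_measurable_fun => // x; rewrite inE/=; exact: inv_continuous.
Qed.

Lemma measurable_inve d (T : measurableType d) (f : T -> R) :
  measurable_fun setT f -> measurable_fun setT (fun t => (((f t)%:E)^-1)%E).
Proof.
move=> mf; under eq_fun do rewrite inver.
apply: (@measurable_fun_ifT _ _ _ _ _ _ (fun t => f t == 0)) => //.
- exact: measurable_fun_eqr.
- by apply/measurable_EFinP; exact: measurableT_comp measurable_invr mf.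
Qed.

Lemma measurable_sqrtr d (T : measurableType d) (f : T -> R) :
  measurable_fun setT f -> measurable_fun setT (fun t => Num.sqrt (f t)).
Proof.
move=> mf; apply: (measurableT_comp _ mf).
by apply: continuous_measurable_fun; exact: sqrt_continuous.
Qed.

Lemma measurable_coordT d (T : measurableType d) (f : T -> B3) i :
  measurable_fun setT f -> measurable_fun setT (fun t => (f t : V) 0 i).
Proof. by move=> mf; exact: measurableT_comp (measurable_coord i) mf. Qed.

Lemma measurable_kern d (T : measurableType d) (f g : T -> B3) :
  measurable_fun setT f -> measurable_fun setT g ->
  measurable_fun setT (fun t => kern (f t) (g t)).
Proof.
move=> mf mg; apply: measurable_inve.
under eq_fun do rewrite enormE !mxE.
apply: measurable_sqrtr.
have mX i : measurable_fun setT (fun t => ((f t : V) 0 i - (g t : V) 0 i) ^+ 2).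
  by apply: measurable_funX; apply: measurable_funB; exact: measurable_coordT.
by apply: measurable_funD; [apply: measurable_funD|]; exact: mX.
Qed.

Lemma kern_ge0 x y : (0 <= kern x y)%E.
Proof. by rewrite /kern inve_ge0 lee_fin sqrtr_ge0. Qed.

Lemma kernC x y : kern x y = kern y x.
Proof.
rewrite /kern /enorm; congr ((Num.sqrt _)%:E^-1)%E.
by apply: eq_bigr => i _; rewrite !mxE -sqrrN opprB.
Qed.

Lemma kernxx x : kern x x = +oo%E.
Proof.
rewrite /kern /enorm big1 ?sqrtr0 ?inve0// => i _.
by rewrite subrr mxE expr0n.
Qed.

End borelR3.

(** * The kernel as a limit of polynomials with nonnegative coefficients *)

Section kernel_polynomials.
Context {R : realType}.
Implicit Types (v : R) (n j : nat).

(** The pair (w_n, y_n) with w_(n+1) = (X + w_n^2) / 2 and y_(n+1) = 1 + w_n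
    y_n. At v in [0, 1] the first increases to 1 - sqrt (1 - v), the fixed
    point of the recursion, and the second, which solves y = 1 + w y in the
    limit, to 1 / sqrt (1 - v). All coefficients are nonnegative. *)
Fixpoint kpoly n : {poly R} * {poly R} :=
  if n is m.+1 then let p := kpoly m in
    (2^-1 *: ('X + p.1 ^+ 2), 1 + p.1 * p.2)
  else (0, 0).

Definition wpoly n := (kpoly n).1.
Definition ypoly n := (kpoly n).2.

Lemma wpolyS n : wpoly n.+1 = 2^-1 *: ('X + wpoly n ^+ 2). Proof. by []. Qed.
Lemma ypolyS n : ypoly n.+1 = 1 + wpoly n * ypoly n. Proof. by []. Qed.

Lemma coef_mul_ge0 (p q : {poly R}) : (forall i, 0 <= p`_i) ->
  (forall i, 0 <= q`_i) -> forall i, 0 <= (p * q)`_i.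
Proof. by move=> p0 q0 i; rewrite coefM sumr_ge0// => k _; rewrite mulr_ge0. Qed.

Lemma wpoly_coef_ge0 n i : 0 <= (wpoly n)`_i.
Proof.
elim: n i => [|n ih] i; first by rewrite coef0.
rewrite wpolyS coefZ coefD coefX mulr_ge0// addr_ge0// expr2.
exact: coef_mul_ge0.
Qed.

Lemma wpoly_coef1 n : 2^-1 <= (wpoly n.+1)`_1.
Proof.
rewrite wpolyS coefZ coefD coefX eqxx ler_peMr// lerDl expr2.
by apply: coef_mul_ge0 => i; exact: wpoly_coef_ge0.
Qed.

Lemma ypoly_coef_ge0 n i : 0 <= (ypoly n)`_i.
Proof.
elim: n i => [|n ih] i; first by rewrite coef0.
rewrite ypolyS coefD coef1 addr_ge0//.
by apply: coef_mul_ge0 => // k; exact: wpoly_coef_ge0.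
Qed.

(** Every monomial is charged, uniformly in n: this is what turns positive
    semidefiniteness into strict positive definiteness. *)
Lemma ypoly_coef_ge n j : (j < n)%N -> 2^-1 ^+ j <= (ypoly n)`_j.
Proof.
elim: n j => [//|n ih] [|j] jn.
  rewrite expr0 ypolyS coefD coef1 eqxx lerDl.
  by apply: coef_mul_ge0; [exact: wpoly_coef_ge0|exact: ypoly_coef_ge0].
rewrite ypolyS coefD coef1 add0r coefM.
case: n ih jn => // n ih jn.
rewrite (bigD1 (Ordinal (isT : (1 < j.+2)%N)))//= subSS subn0.
rewrite exprS -[leLHS]addr0 lerD//.
  by apply: ler_pM => //; [exact: wpoly_coef1|exact: ih].
by apply: sumr_ge0 => i _; rewrite mulr_ge0 ?wpoly_coef_ge0 ?ypoly_coef_ge0.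
Qed.

Section evaluation.
Variable v : R.
Hypothesis v01 : 0 <= v <= 1.

Let pv n := (wpoly n).[v].
Let yv n := (ypoly n).[v].
Let s := Num.sqrt (1 - v).

Let pvS n : pv n.+1 = (v + pv n ^+ 2) / 2.
Proof. by rewrite /pv wpolyS hornerZ hornerD hornerX horner_exp mulrC. Qed.

Let yvS n : yv n.+1 = 1 + pv n * yv n.
Proof. by rewrite /yv ypolyS hornerD hornerM hornerC. Qed.

Let s01 : 0 <= s <= 1.
Proof.
rewrite sqrtr_ge0/= -[leRHS]sqrtr1 ler_wsqrtr//.
by have := v01; lra.
Qed.

Let s2 : s ^+ 2 = 1 - v.
Proof. by rewrite sqr_sqrtr//; have := v01; lra. Qed.

Let pv_bnd n : 0 <= pv n <= 1 - s.
Proof.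
elim: n => [|n /andP[ih0 ih1]]; first by rewrite /pv horner0; have := s01; lra.
have := s01; rewrite pvS => ?; apply/andP; split; first by rewrite divr_ge0 ?addr_ge0 ?sqr_ge0//; have := v01; lra.
have h : pv n ^+ 2 <= (1 - s) ^+ 2 by rewrite ler_sqr ?nnegrE//; lra.
by rewrite ler_pdivrMr//; have := s2; nra.
Qed.

Let pv_nd n : pv n <= pv n.+1.
Proof.
elim: n => [|n ih]; first by have /andP[] := pv_bnd 1; rewrite /pv horner0.
rewrite [leLHS]pvS [leRHS]pvS ler_pM2r// lerD2l ler_sqr// nnegrE;
  by have /andP[] := pv_bnd n; have /andP[] := pv_bnd n.+1.
Qed.

Let yv_ge0 n : 0 <= yv n.
Proof.
elim: n => [|n ih]; first by rewrite /yv horner0.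
by rewrite yvS addr_ge0// mulr_ge0//; have /andP[] := pv_bnd n.
Qed.

Let yv_nd n : yv n <= yv n.+1.
Proof.
elim: n => [|n ih]; first by rewrite {1}/yv horner0.
by rewrite [leLHS]yvS [leRHS]yvS lerD2l ler_pM//; have /andP[] := pv_bnd n.
Qed.

Lemma ypoly_ge0 n : 0 <= (ypoly n).[v]. Proof. exact: yv_ge0. Qed.

Lemma ypoly_nd : nondecreasing_seq (fun n => (ypoly n).[v]).
Proof. by apply/nondecreasing_seqP; exact: yv_nd. Qed.

Let pv_cvg : pv n @[n --> \oo] --> 1 - s.
Proof.
have nd : nondecreasing_seq pv by apply/nondecreasing_seqP.
have ub : has_ubound (range pv).
  by exists (1 - s) => _ [n _ <-]; have /andP[] := pv_bnd n.
have := nondecreasing_cvgn nd ub; set l := sup _ => hl.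
have hS : pv n.+1 @[n --> \oo] --> l by rewrite cvg_shiftS.
have hS' : pv n.+1 @[n --> \oo] --> (v + l * l) / 2.
  under eq_fun do rewrite pvS expr2.
  by apply: cvgMl; apply: cvgD; [exact: cvg_cst|exact: cvgM].
have le : l = (v + l * l) / 2 by apply: (cvg_unique _ hS hS').
have l1 : l <= 1 - s.
  by apply: (closed_cvg _ (@closed_le _ (1 - s)) _ _ hl); apply: nearW => n;
    have /andP[] := pv_bnd n.
have : (1 - l) ^+ 2 = s ^+ 2 by rewrite s2; lra.
move/eqP; rewrite eqf_sqr => /orP[|] /eqP h; last first.
  have s0 : s = 0 by have := s01; lra.
  by rewrite (_ : 1 - s = l) //; lra.
by rewrite -h subKr.
Qed.

Lemma ypoly_cvg : (((ypoly n).[v])%:E @[n --> \oo] --> ((s%:E)^-1)%E)%classic.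
Proof.
have nd : nondecreasing_seq (EFin \o yv).
  by apply/nondecreasing_seqP => n; rewrite /= lee_fin.
have := ereal_nondecreasing_cvgn nd; set L := ereal_sup _ => hL.
have L0 : (0 <= L)%E by apply: ereal_sup_ubound; exists 0%N => //=; rewrite /yv horner0.
suff <- : L = ((s%:E)^-1)%E by exact: hL.
have eqn l : L = l%:E -> l * s = 1.
  move=> Ll; have hl : yv n @[n --> \oo] --> l.
    by have := hL; rewrite Ll => /fine_cvgP[].
  have hS : yv n.+1 @[n --> \oo] --> l by rewrite cvg_shiftS.
  have hS' : yv n.+1 @[n --> \oo] --> 1 + (1 - s) * l.
    under eq_fun do rewrite yvS.
    by apply: cvgD; [exact: cvg_cst|exact: cvgM].
  have : l = 1 + (1 - s) * l by apply: (cvg_unique _ hS hS').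
  by lra.
have [s0|s0] := eqVneq s 0.
  rewrite s0 inve0; move: L0 eqn {hL}; case: L => //= l _ /(_ _ erefl).
  by rewrite s0 mulr0 => /esym/eqP; rewrite oner_eq0.
rewrite inver (negPf s0).
have sp : 0 < s by rewrite lt_neqAle eq_sym s0; have /andP[] := s01.
have ub n : yv n <= s^-1.
  elim: n => [|n ih]; first by rewrite /yv horner0 invr_ge0 ltW.
  rewrite yvS; have /andP[p0 p1] := pv_bnd n.
  have -> : s^-1 = 1 + (1 - s) * s^-1 by rewrite mulrBl mul1r divff// addrCA subrr addr0.
  by rewrite lerD2l ler_pM.
have : (L <= (s^-1)%:E)%E.
  by apply: ge_ereal_sup => _ [n _ <-]; rewrite lee_fin.
move: L0 eqn {hL}; case: L => //= l _ /(_ _ erefl) h _.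
by congr (_%:E); rewrite -[RHS]mul1r -h mulfK.
Qed.

End evaluation.
End kernel_polynomials.

(** * Positive definiteness of the kernel *)

Section moments.
Context {R : realType}.
Local Notation V := 'rV[R]_3.
Local Notation B3 := (borelR3 R).
Local Notation S := (@sphere2 R : set B3).
Implicit Types (f g : V -> R) (x y : V).

Lemma sphere2_sum x : sphere2 x -> \sum_(i < 3) x 0 i ^+ 2 = 1.
Proof.
rewrite /sphere2 /= /enorm => h; rewrite -[LHS]sqr_sqrtr ?h ?expr1n//.
by apply: sumr_ge0 => i _; exact: sqr_ge0.
Qed.

Lemma sphere2_coord x i : sphere2 x -> `|x 0 i| <= 1.
Proof.
move=> /sphere2_sum h; rewrite -(@ler_pXn2r _ 2)// ?nnegrE// expr1n real_normK ?num_real//.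
by rewrite -h (bigD1 i)//= lerDl sumr_ge0// => j _; exact: sqr_ge0.
Qed.

Definition bmeas f := measurable_fun setT (f : B3 -> R) /\
  exists M : R, forall x, sphere2 x -> `|f x| <= M.

Lemma bmeas_cst (k : R) : bmeas (fun=> k).
Proof. by split; [exact: measurable_cst|exists `|k|]. Qed.

Lemma bmeas_coord i : bmeas (fun x => x 0 i).
Proof. by split; [exact: measurable_coord|exists 1 => x; exact: sphere2_coord]. Qed.

Lemma bmeasM f g : bmeas f -> bmeas g -> bmeas (fun x => f x * g x).
Proof.
move=> [mf [M hM]] [mg [K hK]]; split; first exact: measurable_funM.
by exists (M * K) => x Sx; rewrite normrM ler_pM// ?hM// hK.
Qed.

Lemma bmeasD f g : bmeas f -> bmeas g -> bmeas (fun x => f x + g x).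
Proof.
move=> [mf [M hM]] [mg [K hK]]; split; first exact: measurable_funD.
by exists (M + K) => x Sx; rewrite (le_trans (ler_normD _ _))// lerD// ?hM// hK.
Qed.

Lemma bmeas_sum I (r : seq I) (F : I -> V -> R) : (forall i, bmeas (F i)) ->
  bmeas (fun x => \sum_(i <- r) F i x).
Proof.
move=> bF; elim: r => [|i r ih].
  by under eq_fun do rewrite big_nil; exact: bmeas_cst.
by under eq_fun do rewrite big_cons; exact: bmeasD.
Qed.

Lemma bmeas_prod I (r : seq I) (F : I -> V -> R) : (forall i, bmeas (F i)) ->
  bmeas (fun x => \prod_(i <- r) F i x).
Proof.
move=> bF; elim: r => [|i r ih].
  by under eq_fun do rewrite big_nil; exact: bmeas_cst.
by under eq_fun do rewrite big_cons; exact: bmeasM.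
Qed.

Section mean.
Variable m : probability B3 R.

Definition mean f := (\int[m]_(x in S) f x)%R.

Lemma bmeas_integrable f : bmeas f -> m.-integrable S (EFin \o f).
Proof.
move=> [mf [M hM]]; apply: measurable_bounded_integrable.
- exact: measurable_sphere2.
- by rewrite (le_lt_trans (probability_le1 _ measurable_sphere2)) ?ltry.
- exact: measurable_funTS.
- exists M; split; first exact: num_real.
  by move=> y My x /= Sx; apply: le_trans (hM _ Sx) (ltW My).
Qed.

Lemma meanE f : bmeas f -> (\int[m]_(x in S) (f x)%:E)%E = (mean f)%:E.
Proof.
move=> bf; rewrite /mean /Rintegral fineK//.
by apply: integrable_fin_num; [exact: measurable_sphere2|exact: bmeas_integrable].
Qed.

Lemma mean_lin (I : finType) (a : I -> R) (F : I -> V -> R) : (forall i, bmeas (F i)) ->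
  mean (fun x => \sum_i a i * F i x) = \sum_i a i * mean (F i).
Proof.
move=> bF; apply: EFin_inj.
rewrite -meanE; last by apply: bmeas_sum => i; apply: bmeasM => //; exact: bmeas_cst.
under eq_integral do rewrite -sumEFin.
rewrite integral_sum; last 2 first.
- exact: measurable_sphere2.
- by move=> i; apply: bmeas_integrable; apply: bmeasM => //; exact: bmeas_cst.
rewrite -sumEFin; apply: eq_bigr => i _.
under eq_integral do rewrite EFinM.
rewrite integralZl; last 2 first.
- exact: measurable_sphere2.
- exact: bmeas_integrable.
by rewrite meanE.
Qed.

Lemma eq_mean f g : (forall x, sphere2 x -> f x = g x) -> mean f = mean g.
Proof. by move=> fg; apply: eq_Rintegral => x; rewrite inE; exact: fg. Qed.

End mean.

(** The vector (1, x) of R^4, so that 1 + x.y = sum_k ext x k * ext y k *)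
Definition ext x (k : 'I_4) : R := oapp (fun i => x 0 i) 1 (unlift ord0 k).

Definition vv x y : R := (\sum_k ext x k * ext y k) / 2.

Lemma vvE x y : vv x y = (1 + \sum_i x 0 i * y 0 i) / 2.
Proof.
rewrite /vv big_ord_recl /ext unlift_none /= mulr1; congr ((_ + _) / _).
by apply: eq_bigr => i _; rewrite liftK.
Qed.

(** On the sphere |x - y|^2 = 2 - 2 x.y = 4 (1 - vv x y), so that the kernel 1
    / |x - y| is half of 1 / sqrt (1 - v) at v = vv x y. *)
Lemma sphere2_dist x y : sphere2 x -> sphere2 y -> enorm (x - y) = 2 * Num.sqrt (1 - vv x y).
Proof.
move=> /sphere2_sum hx /sphere2_sum hy.
have h : \sum_(i < 3) (x - y) 0 i ^+ 2 = 2 ^+ 2 * (1 - vv x y).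
  under eq_bigr do rewrite !mxE sqrrB.
  rewrite big_split sumrB/= hx hy sumrMnl vvE -mulr_natl.
  by field.
rewrite /enorm h sqrtrM ?sqr_ge0// sqrtr_sqr ger0_norm//.
Qed.

Lemma vv01 x y : sphere2 x -> sphere2 y -> 0 <= vv x y <= 1.
Proof.
move=> /sphere2_sum hx /sphere2_sum hy.
have h1 : 0 <= \sum_(i < 3) (x 0 i + y 0 i) ^+ 2 by apply: sumr_ge0 => i _; exact: sqr_ge0.
have h2 : 0 <= \sum_(i < 3) (x 0 i - y 0 i) ^+ 2 by apply: sumr_ge0 => i _; exact: sqr_ge0.
move: h1 h2; under eq_bigr do rewrite sqrrD; under [in X in _ -> X -> _]eq_bigr do rewrite sqrrB.
by rewrite !big_split/= sumrN sumrMnl hx hy vvE -mulr_natl; lra.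
Qed.

(** Products of coordinates of (1, x), indexed by words. Expanding the j-th
    power of the bilinear form vv over words exhibits it as a sum of products
    f(x) f(y). *)
Definition word j (s : {ffun 'I_j -> 'I_4}) x : R := \prod_i ext x (s i).

Lemma bmeas_ext k : bmeas (ext^~ k).
Proof.
by rewrite /ext; case: (unlift ord0 k) => [i|] /=; [exact: bmeas_coord|exact: bmeas_cst].
Qed.

Lemma bmeas_word j (s : {ffun 'I_j -> 'I_4}) : bmeas (word s).
Proof. by apply: bmeas_prod => i; exact: bmeas_ext. Qed.

Lemma vvX x y j : vv x y ^+ j =
  \sum_(s : {ffun 'I_j -> 'I_4}) 2^-1 ^+ j * word s x * word s y.
Proof.
have prodE (z : R) : z ^+ j = \prod_(i < j) z by rewrite prodr_const card_ord.
rewrite /vv exprMn mulrC [X in _ * X]prodE bigA_distr_bigA mulr_sumr.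
by apply: eq_bigr => s _; rewrite big_split/= mulrA.
Qed.

(** The double integral of P (vv x y), expanded in word moments; for m1 = m2
    and nonnegative coefficients it is a sum of squares. *)
Definition pform (P : {poly R}) (m1 m2 : probability B3 R) : R :=
  \sum_(j < size P) P`_j * (\sum_(s : {ffun 'I_j -> 'I_4})
     2^-1 ^+ j * (mean m1 (word s) * mean m2 (word s))).

Lemma bmeas_horner_vv (P : {poly R}) x : bmeas (fun y => P.[vv x y]).
Proof.
under eq_fun do rewrite horner_coef; apply: bmeas_sum => j.
apply: bmeasM; first exact: bmeas_cst.
under eq_fun do rewrite vvX; apply: bmeas_sum => s.
by apply: bmeasM; [exact: bmeas_cst|exact: bmeas_word].
Qed.

Definition pot (P : {poly R}) (m : probability B3 R) x : R :=
  \sum_(j < size P) P`_j * \sum_(s : {ffun 'I_j -> 'I_4})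
       (2^-1 ^+ j * mean m (word s)) * word s x.

Lemma bmeas_pot P (m : probability B3 R) : bmeas (pot P m).
Proof.
apply: bmeas_sum => j; apply: bmeasM; first exact: bmeas_cst.
by apply: bmeas_sum => s; apply: bmeasM; [exact: bmeas_cst|exact: bmeas_word].
Qed.

Lemma integral_vv P (m : probability B3 R) x :
  (\int[m]_(y in S) (P.[vv x y])%:E = (pot P m x)%:E)%E.
Proof.
under eq_integral do rewrite horner_coef.
pose F (j : 'I_(size P)) y := vv x y ^+ j.
have bF j : bmeas (F j).
  rewrite /F; under eq_fun do rewrite vvX; apply: bmeas_sum => s.
  by apply: bmeasM; [exact: bmeas_cst|exact: bmeas_word].
rewrite (meanE _ (f := fun y => \sum_(j < size P) P`_j * F j y)); last first.
  by apply: bmeas_sum => j; apply: bmeasM => //; exact: bmeas_cst.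
rewrite mean_lin//; congr (_%:E); apply: eq_bigr => j _; congr (_ * _).
under eq_mean do rewrite /F vvX.
rewrite (mean_lin m (fun s : {ffun 'I_j -> 'I_4} => 2^-1 ^+ j * word s x)) => [|s]; last exact: bmeas_word.
by apply: eq_bigr => s _; ring.
Qed.

Lemma integral2_vv P (m1 m2 : probability B3 R) :
  (\int[m1]_(x in S) \int[m2]_(y in S) (P.[vv x y])%:E = (pform P m1 m2)%:E)%E.
Proof.
under eq_integral do rewrite integral_vv.
have bG (j : 'I_(size P)) : bmeas (fun x => \sum_(s : {ffun 'I_j -> 'I_4})
       (2^-1 ^+ j * mean m2 (word s)) * word s x).
  by apply: bmeas_sum => s; apply: bmeasM; [exact: bmeas_cst|exact: bmeas_word].
rewrite meanE; last exact: bmeas_pot.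
rewrite (mean_lin m1 (fun j : 'I_(size P) => P`_j) bG); congr (_%:E); apply: eq_bigr => j _; congr (_ * _).
rewrite mean_lin => [|s]; last exact: bmeas_word.
by apply: eq_bigr => s _; ring.
Qed.

Definition energy2 (m1 m2 : probability B3 R) : \bar R :=
  (\int[m1]_(x in S) \int[m2]_(y in S) kern x y)%E.

Lemma kern_cvg x y : sphere2 x -> sphere2 y ->
  ((2^-1 * (ypoly n).[vv x y])%:E @[n --> \oo] --> kern x y)%classic.
Proof.
move=> Sx Sy; rewrite /kern sphere2_dist//.
have -> : (((2 * Num.sqrt (1 - vv x y))%:E)^-1 = (2^-1)%:E * ((Num.sqrt (1 - vv x y))%:E)^-1)%E.
  rewrite !inver mulf_eq0 pnatr_eq0/=; case: eqP => _.
    by rewrite gt0_muley// lte_fin.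
  by rewrite invfM EFinM.
under eq_fun do rewrite EFinM.
by apply: cvgeZl => //; apply: ypoly_cvg; exact: vv01.
Qed.

(** Monotone convergence in both integrals; the energies may be infinite. *)
Lemma ypoly_energy (m1 m2 : probability B3 R) :
  ((2^-1 * pform (ypoly n) m1 m2)%:E @[n --> \oo] --> energy2 m1 m2)%classic.
Proof.
pose k n x y : \bar R := (2^-1 * (ypoly n).[vv x y])%:E.
have k0 n x y : sphere2 x -> sphere2 y -> (0 <= k n x y)%E.
  by move=> Sx Sy; rewrite lee_fin mulr_ge0// ypoly_ge0// vv01.
have knd x y : sphere2 x -> sphere2 y -> nondecreasing_seq (fun n => k n x y).
  move=> Sx Sy m n mn; rewrite lee_fin ler_pM2l//.
  by apply: ypoly_nd mn; exact: vv01.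
have mk n x : measurable_fun S (fun y => k n x y).
  apply: measurable_funTS; apply/measurable_EFinP; apply: measurable_funM.
    exact: measurable_cst.
  by have [] := bmeas_horner_vv (ypoly n) x.
have intk n x : (\int[m2]_(y in S) k n x y = (2^-1 * pot (ypoly n) m2 x)%:E)%E.
  rewrite /k; under eq_integral do rewrite EFinM.
  rewrite integralZl ?integral_vv//; first exact: measurable_sphere2.
  by apply: bmeas_integrable; exact: bmeas_horner_vv.
have mS := @measurable_sphere2 R.
have inner x : sphere2 x ->
    ((\int[m2]_(y in S) k n x y)%E @[n --> \oo] --> (\int[m2]_(y in S) kern x y)%E)%classic.
  move=> Sx; rewrite [X in _ --> X](_ : _ = (\int[m2]_(y in S) limn (fun n => k n x y))%E).
    apply: cvg_monotone_convergence => //; first by move=> n y; exact: k0.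
    by move=> y; exact: knd.
  apply: eq_integral => y; rewrite inE => Sy; apply/esym/cvg_lim => //.
  exact: kern_cvg.
rewrite /energy2 [X in _ --> X](_ : _ =
    (\int[m1]_(x in S) limn (fun n => \int[m2]_(y in S) k n x y))%E).
  rewrite [X in X @ _ --> _](_ : _ = fun n => (\int[m1]_(x in S) \int[m2]_(y in S) k n x y)%E).
    apply: cvg_monotone_convergence => //.
    - move=> n; under eq_fun do rewrite intk; apply: measurable_funTS.
      apply/measurable_EFinP; apply: measurable_funM; first exact: measurable_cst.
      by have [] := bmeas_pot (ypoly n) m2.
    - by move=> n x Sx; apply: integral_ge0 => y Sy; exact: k0.
    - move=> x Sx m n mn; apply: ge0_le_integral => //.
      + by move=> y; exact: k0.
      + by move=> y Sy; exact: knd.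
  apply/funext => n; under [in RHS]eq_integral do rewrite intk EFinM.
  rewrite integralZl//; last by apply: bmeas_integrable; exact: bmeas_pot.
  by rewrite EFinM -integral2_vv; congr (_ * _)%E; apply: eq_integral => x _; rewrite integral_vv.
by apply: eq_integral => x; rewrite inE => Sx; apply/esym/cvg_lim => //; exact: inner.
Qed.

(** The energy of m1 - m2 vanishes, and it is the limit of the forms pform,
    which are sums of squares of differences of moments in which the
    coefficient of each word is eventually bounded below. *)
Lemma energy2_eq_moments (m1 m2 : probability B3 R) (e : R) :
  energy2 m1 m1 = e%:E -> energy2 m2 m2 = e%:E -> energy2 m1 m2 = e%:E ->
  forall j (s : {ffun 'I_j -> 'I_4}), mean m1 (word s) = mean m2 (word s).
Proof.
move=> e11 e22 e12 j s.
pose D n := \sum_(k < size (@ypoly R n)) (ypoly n)`_k * (\sum_(s : {ffun 'I_k -> 'I_4})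
     2^-1 ^+ k * (mean m1 (word s) - mean m2 (word s)) ^+ 2).
have DE n : D n = pform (ypoly n) m1 m1 + pform (ypoly n) m2 m2 - 2 * pform (ypoly n) m1 m2.
  rewrite /D /pform mulr_sumr -big_split -sumrB/=; apply: eq_bigr => k _.
  rewrite [X in _ - X]mulrCA [2 * _]mulr_sumr -mulrDr -mulrBr -big_split -sumrB/=; congr (_ * _).
  by apply: eq_bigr => t _; ring.
have D_cvg : D n @[n --> \oo] --> (0 : R).
  have h1 := @ypoly_energy m1 m1; have h2 := @ypoly_energy m2 m2; have h3 := @ypoly_energy m1 m2.
  move: h1 h2 h3; rewrite e11 e22 e12 => /fine_cvgP[_ h1] /fine_cvgP[_ h2] /fine_cvgP[_ h3].
  rewrite (_ : D = fun n => 2 * (2^-1 * pform (ypoly n) m1 m1 +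
      2^-1 * pform (ypoly n) m2 m2 - 2 * (2^-1 * pform (ypoly n) m1 m2))); last first.
    by apply/funext => n; rewrite DE; field.
  have -> : 0 = 2 * (e + e - 2 * e) by ring.
  by apply: cvgMr; apply: cvgB; [apply: cvgD|apply: cvgMr].
have tk0 (k : nat) (z : R) : 0 <= 2^-1 ^+ k * z ^+ 2.
  by apply: mulr_ge0; [rewrite exprn_ge0|exact: sqr_ge0].
have D_ge n : (j < n)%N -> 2^-1 ^+ j * 2^-1 ^+ j * (mean m1 (word s) - mean m2 (word s)) ^+ 2 <= D n.
  move=> jn; have yj := @ypoly_coef_ge R n j jn.
  have y0 := @ypoly_coef_ge0 R n.
  have js : (j < size (@ypoly R n))%N.
    rewrite ltnNge; apply/negP => /(nth_default 0) h; move: yj; rewrite h leNgt.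
    by rewrite exprn_gt0.
  rewrite /D (bigD1 (Ordinal js))//= -[leLHS]addr0 lerD//; last first.
    apply: sumr_ge0 => k _; by rewrite mulr_ge0// sumr_ge0.
  rewrite -mulrA; apply: ler_pM; rewrite ?exprn_ge0 ?tk0//.
  by rewrite (bigD1 s)//= lerDl sumr_ge0.
have : 2^-1 ^+ j * 2^-1 ^+ j * (mean m1 (word s) - mean m2 (word s)) ^+ 2 <= 0.
  by apply: (cvgr_ge_cst D_cvg); exists j.+1 => // n; exact: D_ge.
have h : (0 : R) < 2^-1 ^+ j * 2^-1 ^+ j by rewrite mulr_gt0// exprn_gt0.
rewrite pmulr_rle0// => h2; apply/eqP; rewrite -subr_eq0 -sqrf_eq0.
by rewrite eq_le h2 sqr_ge0.
Qed.

End moments.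

(** * Moments determine measures on the sphere *)

Section moments_determine.
Context {R : realType}.
Local Notation V := 'rV[R]_3.
Local Notation B3 := (borelR3 R).
Local Notation S := (@sphere2 R : set B3).
Implicit Types (x y : V).

(** Polynomials in t tending to the indicator of t <= a on [-1, 1]: with
   q = 1/2 + (t - a)/(4 + 2|a|), take (1 - q^(2n)/n)^(4^n). *)
Definition step_arg (a : R) : {poly R} :=
  (2^-1)%:P + (2 * (2 + `|a|))^-1 *: ('X - a%:P).
Definition step_poly a n : {poly R} :=
  (1 - n.+1%:R^-1 *: step_arg a ^+ (2 * n.+1)) ^+ (4 ^ n.+1).

Lemma step_argE a t : (step_arg a).[t] = 2^-1 + (2 * (2 + `|a|))^-1 * (t - a).
Proof. by rewrite /step_arg hornerD hornerC hornerZ hornerXsubC. Qed.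

Lemma step_polyE a n t : (step_poly a n).[t] =
  (1 - n.+1%:R^-1 * (step_arg a).[t] ^+ (2 * n.+1)) ^+ (4 ^ n.+1).
Proof. by rewrite /step_poly horner_exp hornerD hornerN hornerZ horner_exp hornerC. Qed.

Section step.
Variables (a t : R).
Hypothesis t1 : `|t| <= 1.
Let q := (step_arg a).[t].

Let c0 : 0 < 2 * (2 + `|a|).
Proof. by rewrite mulr_gt0// ltr_wpDr. Qed.

Let q01 : 0 <= q <= 1.
Proof.
have h : `|(2 * (2 + `|a|))^-1 * (t - a)| <= 2^-1.
  rewrite normrM gtr0_norm ?invr_gt0// mulrC ler_pdivrMr// mulrA mulVf// mul1r.
  by rewrite (le_trans (ler_normB _ _))// lerD2r (le_trans t1)// ler1n.
by rewrite /q step_argE; move: h; rewrite ler_norml; lra.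
Qed.

Let q_le : (q <= 2^-1) = (t <= a).
Proof.
by rewrite /q step_argE gerDl pmulr_rle0 ?invr_gt0// subr_le0.
Qed.

Let u n := n.+1%:R^-1 * q ^+ (2 * n.+1).

Let u01 n : 0 <= u n <= 1.
Proof.
have [q0 q1] := andP q01.
rewrite /u mulr_ge0 ?invr_ge0 ?exprn_ge0//= mulr_ile1 ?invr_ge0 ?exprn_ge0//.
  by rewrite invf_le1// ler1n.
by rewrite exprn_ile1.
Qed.

Lemma step_poly01 n : 0 <= (step_poly a n).[t] <= 1.
Proof.
have [u0 u1] := andP (u01 n).
rewrite step_polyE exprn_ge0 ?subr_ge0//= exprn_ile1 ?subr_ge0//.
by rewrite lerBlDr lerDl.
Qed.

Let m_u n : (4 ^ n.+1)%:R * u n = n.+1%:R^-1 * (2 * q) ^+ (2 * n.+1).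
Proof.
rewrite /u mulrCA exprMn; congr (_ * (_ * _)).
by rewrite exprM natrX; congr (_ ^+ _); rewrite expr2 -natrM.
Qed.

Lemma step_poly_cvg : (step_poly a n).[t] @[n --> \oo] --> ((t <= a)%R%:R : R).
Proof.
have bern (z : R) k : 0 <= z <= 1 -> 1 - k%:R * z <= (1 - z) ^+ k.
  move=> /andP[z0 z1]; elim: k => [|k ih]; first by rewrite mul0r subr0 expr0.
  rewrite exprS; have h : 0 <= 1 - z by rewrite subr_ge0.
  rewrite (le_trans _ (ler_wpM2l h ih))// -natr1.
  have k0 : (0 : R) <= k%:R by [].
  nra.
have bern' (z : R) k : 0 <= z -> 1 + k%:R * z <= (1 + z) ^+ k.
  move=> z0; elim: k => [|k ih]; first by rewrite mul0r addr0 expr0.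
  rewrite exprS; have h : 0 <= 1 + z by rewrite addr_ge0.
  rewrite (le_trans _ (ler_wpM2l h ih))// -natr1.
  have k0 : (0 : R) <= k%:R by [].
  nra.
have [q0 q1] := andP q01.
have hcv : (n.+1%:R^-1 : R) @[n --> \oo] --> (0 : R) by exact: cvg_harmonic.
case: (leP t a) => ta.
  apply: (@squeeze_cvgr _ _ _ _ (fun n => 1 - n.+1%:R^-1) (fun=> 1)).
  - apply: nearW => n; have /andP[_ ->] := step_poly01 n; rewrite andbT.
    rewrite step_polyE; apply: le_trans (bern _ _ (u01 n)).
    rewrite m_u lerD2l lerN2 ger_pMr ?invr_gt0//.
    by rewrite exprn_ile1 ?mulr_ge0//; have := q_le; rewrite ta; lra.
  - rewrite -[X in _ --> X]subr0; apply: cvgB; [exact: cvg_cst|exact: hcv].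
  - exact: cvg_cst.
have q2 : 1 < 2 * q by have := q_le; rewrite [t <= a]leNgt ta /= => /negbT; rewrite -ltNge; lra.
pose de := 2 * q - 1; have de0 : 0 < de by rewrite /de subr_gt0.
apply: (@squeeze_cvgr _ _ _ _ (fun=> 0) (fun n => (de ^+ 2)^-1 * n.+1%:R^-1)).
- apply: nearW => n; have /andP[-> _] /= := step_poly01 n.
  rewrite step_polyE; have [u0 u1] := andP (u01 n).
  have h1 : (1 - u n) ^+ (4 ^ n.+1) * (1 + u n) ^+ (4 ^ n.+1) <= 1.
    rewrite -exprMn exprn_ile1// ?mulr_ge0 ?subr_ge0 ?addr_ge0//.
    by have := sqr_ge0 (u n); nra.
  have h2 := @bern' (u n) (4 ^ n.+1)%N u0.
  have h3 : de ^+ 2 * n.+1%:R <= (1 + u n) ^+ (4 ^ n.+1).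
    apply: le_trans h2; rewrite m_u exprM.
    have h4 : n.+1%:R * de <= (2 * q) ^+ n.+1.
      have := @bern' de n.+1 (ltW de0).
      have -> : 1 + de = 2 * q by rewrite /de; ring.
      by apply: le_trans; rewrite lerDr.
    apply: (@le_trans _ _ (n.+1%:R^-1 * (n.+1%:R * de) ^+ 2)).
      have n0 : n.+1%:R != 0 :> R by rewrite pnatr_eq0.
      by rewrite le_eqVlt; apply/orP; left; apply/eqP; field.
    rewrite -[leLHS]add0r lerD// ler_wpM2l// -exprM mulnC exprM.
    by rewrite ler_pXn2r// nnegrE ?mulr_ge0 ?exprn_ge0 ?mulr_ge0 ?(ltW de0).
  rewrite -invfM -[leRHS]mul1r ler_pdivlMr ?mulr_gt0 ?exprn_gt0//.
  apply: le_trans h1; rewrite ler_wpM2l//.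
  by rewrite exprn_ge0 ?subr_ge0.
- exact: cvg_cst.
- by rewrite -[X in _ --> X](mulr0 (de ^+ 2)^-1); exact: cvgMr hcv.
Qed.

End step.

Definition sword (l : seq 'I_4) x : R := \prod_(k <- l) ext x k.

Lemma bmeas_sword l : bmeas (sword l).
Proof. by apply: bmeas_prod => k; exact: bmeas_ext. Qed.

Lemma word_sword (m1 m2 : probability B3 R) :
  (forall j (s : {ffun 'I_j -> 'I_4}), mean m1 (word s) = mean m2 (word s)) ->
  forall l, mean m1 (sword l) = mean m2 (sword l).
Proof.
move=> h l; have := h _ [ffun i => tnth (in_tuple l) i].
have -> // : word [ffun i => tnth (in_tuple l) i] = sword l.
by apply/funext => x; rewrite /word /sword [RHS]big_tnth; apply: eq_bigr => i _; rewrite ffunE.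
Qed.

Lemma on_sphereC (m : probability B3 R) : on_sphere m -> m (~` S) = 0%E.
Proof.
move=> sm; rewrite probability_setC; last exact: measurable_sphere2.
by rewrite sm subee.
Qed.

Section agree.
Variables m1 m2 : probability B3 R.
Hypothesis m12 : forall l, mean m1 (sword l) = mean m2 (sword l).

Definition agree (f : V -> R) := bmeas f /\
  forall l, mean m1 (fun x => f x * sword l x) = mean m2 (fun x => f x * sword l x).

Lemma agree1 : agree (fun=> 1).
Proof.
split=> [|l]; first exact: bmeas_cst.
by under eq_fun do rewrite mul1r; exact: m12.
Qed.

Lemma agree_coord i f : agree f -> agree (fun x => x 0 i * f x).
Proof.
move=> [bf hf]; split=> [|l]; first by apply: bmeasM => //; exact: bmeas_coord.
rewrite (_ : (fun x => _) = fun x => f x * sword (lift ord0 i :: l) x); first exact: hf.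
by apply/funext => x; rewrite /sword big_cons /ext liftK/=; ring.
Qed.

Lemma agree_lin (I : finType) (a : I -> R) (F : I -> V -> R) :
  (forall i, agree (F i)) -> agree (fun x => \sum_i a i * F i x).
Proof.
move=> aF; split=> [|l].
  by apply: bmeas_sum => i; apply: bmeasM; [exact: bmeas_cst|have [] := aF i].
rewrite (_ : (fun x => _) = fun x => \sum_i a i * (F i x * sword l x)); last first.
  by apply/funext => x; rewrite mulr_suml; apply: eq_bigr => i _; rewrite mulrA.
have bF i : bmeas (fun x => F i x * sword l x).
  by apply: bmeasM; [have [] := aF i|exact: bmeas_sword].
by rewrite !mean_lin//; apply: eq_bigr => i _; have [_ ->] := aF i.
Qed.

Lemma agree_horner (P : {poly R}) i f : agree f -> agree (fun x => P.[x 0 i] * f x).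
Proof.
move=> af.
rewrite (_ : (fun x => _) = fun x => \sum_(j < size P) P`_j * (x 0 i ^+ j * f x)); last first.
  by apply/funext => x; rewrite horner_coef mulr_suml; apply: eq_bigr => j _; rewrite mulrA.
apply: agree_lin => j; elim: (nat_of_ord j) => [|k ih].
  by under eq_fun do rewrite expr0 mul1r.
by under eq_fun do rewrite exprS -mulrA; exact: agree_coord.
Qed.

Lemma agree_prod (P : 'I_3 -> {poly R}) : agree (fun x => \prod_i (P i).[x 0 i]).
Proof.
elim: (index_enum _) => [|i r ih].
  by under eq_fun do rewrite big_nil; exact: agree1.
by under eq_fun do rewrite big_cons; exact: agree_horner.
Qed.

(** Products of polynomials in one coordinate converge boundedly to the
    indicator of an octant on the sphere. *)
Lemma octant_agree a : m1 (octant a `&` S) = m2 (octant a `&` S).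
Proof.
have mS := @measurable_sphere2 R.
pose P n x := \prod_(i < 3) (step_poly (a i) n).[x 0 i].
have bP n : bmeas (P n) by have [] := agree_prod (fun i => step_poly (a i) n).
have P01 n x : sphere2 x -> 0 <= P n x <= 1.
  move=> Sx; apply/andP; split.
    apply: prodr_ge0 => i _.
    by have /andP[] := @step_poly01 (a i) (x 0 i) (sphere2_coord i Sx) n.
  apply: prodr_ile1 => i _.
  exact: (@step_poly01 (a i) (x 0 i) (sphere2_coord i Sx) n).
have Pcvg x : sphere2 x -> P n x @[n --> \oo] --> (\1_(octant a) x : R).
  move=> Sx.
  have -> : \1_(octant a) x = \prod_(i < 3) ((x 0 i <= a i)%R%:R : R).
    rewrite indicE; case: (boolP (x \in octant a)); rewrite ?inE ?notin_setE => /= h.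
      by rewrite big1// => i _; rewrite h.
    have [i /negP hi] : exists i, ~ x 0 i <= a i by apply/existsNP.
    by rewrite (bigD1 i)//= (negbTE hi) mul0r.
  rewrite /P !big_ord_recl !big_ord0; under eq_fun do rewrite !big_ord_recl !big_ord0.
  have st i := @step_poly_cvg (a i) (x 0 i) (sphere2_coord i Sx).
  by apply: cvgM; [exact: st|apply: cvgM; [exact: st|apply: cvgM; [exact: st|exact: cvg_cst]]].
have mcvg (m : probability B3 R) :
    ((mean m (P n))%:E @[n --> \oo] --> m (octant a `&` S))%classic.
  rewrite -integral_indic//; last exact: measurable_octant.
  under eq_fun do rewrite -meanE//.
  apply: (@dominated_cvg _ _ _ m S mS (fun n x => (P n x)%:E) _ (fun=> 1%E)).
  - by move=> n; apply/measurable_EFinP; apply: measurable_funTS; have [] := bP n.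
  - by move=> x Sx; apply: cvg_EFin; [exact: nearW|exact: Pcvg].
  - by [].
  - apply: (@bmeas_integrable R m (fun=> 1)); exact: bmeas_cst.
  - by move=> n x Sx; rewrite lee_fin; have /andP[h0 h1] := P01 n x Sx; rewrite ger0_norm.
have := mcvg m1.
under eq_fun => n.
  have -> : mean m1 (P n) = mean m2 (P n).
    have [_ /(_ [::])] := agree_prod (fun i => step_poly (a i) n).
    rewrite (_ : (fun x => _) = P n)// /P; apply/funext => x.
    by rewrite /sword big_nil mulr1.
  over.
by move=> h; apply: (cvg_unique _ h (mcvg m2)).
Qed.

End agree.

(** Strict positive definiteness of the kernel: the energy of the signed
    measure m1 - m2 is e - 2 e + e = 0, which forces all moments of m1 and m2
    to agree. *)
Lemma energy2_eq (m1 m2 : probability B3 R) (e : R) : on_sphere m1 -> on_sphere m2 ->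
  energy2 m1 m1 = e%:E -> energy2 m2 m2 = e%:E -> energy2 m1 m2 = e%:E ->
  forall A, measurable A -> m1 A = m2 A.
Proof.
move=> s1 s2 e1 e2 e12; apply: octant_unique => a.
have carr (m : probability B3 R) : on_sphere m -> m (octant a) = m (octant a `&` S).
  move=> sm; have mS := @measurable_sphere2 R; have mo := @measurable_octant R a.
  by rewrite [LHS](measureDI m mo mS) setDE (subset_measure0 _ _ (@subIsetr _ _ _) (on_sphereC sm)) ?add0e//; [apply: measurableI => //; exact: measurableC|exact: measurableC].
apply: (etrans (carr _ s1)); apply: etrans (esym (carr _ s2)).
apply: octant_agree; apply: word_sword; exact: energy2_eq_moments e1 e2 e12.
Qed.

End moments_determine.

(** * The mean of the kernel over a circle of latitude *)

Section copson.
Context {R : realType}.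
Notation lam := (@lebesgue_measure R).
Implicit Types (a b c d l r t w x y z : R) (f g : R -> R).

Lemma ge0_integral_oo_split (f : R -> \bar R) a b c : a < c -> c < b ->
  measurable_fun `]a, b[ f -> (forall x, a < x < b -> (0 <= f x)%E) ->
  (\int[lam]_(x in `]a, b[) f x =
   \int[lam]_(x in `]a, c[) f x + \int[lam]_(x in `]c, b[) f x)%E.
Proof.
move=> ac cb mf f0; rewrite [X in integral _ X _](itv_oo_split ac cb) ge0_integral_setU//=.
- congr (_ + _)%E; rewrite integral_itv_bndo_bndc//.
  apply: measurable_funS mf => //.
  by move=> x /=; rewrite !in_itv/= => /andP[-> /lt_trans ->].
- by rewrite -itv_oo_split.
- by move=> x; rewrite /= !in_itv/= => -[] /andP[h1 h2]; apply: f0; lra.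
- apply/disj_set2P; apply/seteqP; split => // x [] /=.
  by rewrite !in_itv/= => /andP[_ xc] /andP[cx _]; lra.
Qed.

Lemma integral_oo_shift g t l r : (forall x, l < x < r -> {for x, continuous g}) ->
  (\int[lam]_(x in `]l, r[) (g x)%:E =
   \int[lam]_(x in `](l + t)%R, (r + t)%R[) (g (x - t))%:E)%E.
Proof.
move=> cg; have [rl|lr] := leP r l.
  by rewrite !set_itv_ge ?bnd_simp -?leNgt ?lerD2r// !integral_set0.
have cF x : {for x, continuous (fun x => x - t)}.
  by apply: cvgB; [exact: cvg_id|exact: cvg_cst].
have dF x : l + t < x < r + t -> is_derive x 1 (fun x => x - t) (cst 1 x).
  by move=> _; apply: (der_eq (derB (der_id x) (der_cst t x))); rewrite subr0.
have lr' : l + t < r + t by rewrite ltrD2r.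
rewrite (substitution_increasing_oo (G := g) lr' dF (l := l) (r := r))//.
- by apply: eq_integral => x _ /=; rewrite mulr1.
- by move=> x _; exact: cvg_cst.
- rewrite -[X in _ --> X](addrK t l); apply: cvg_at_right_filter; exact: cF.
- rewrite -[X in _ --> X](addrK t r); apply: cvg_at_left_filter; exact: cF.
Qed.

Section periodic.
Variable g : R -> R.
Hypothesis cg : continuous g.
Hypothesis g0 : forall x, 0 <= g x.
Hypothesis gP : forall x, g (x - 2 * pi) = g x.
Hypothesis gN : forall x, g (- x) = g x.

Let split_g l c r : l < c -> c < r ->
  (\int[lam]_(x in `]l, r[) (g x)%:E =
   \int[lam]_(x in `]l, c[) (g x)%:E + \int[lam]_(x in `]c, r[) (g x)%:E)%E.
Proof.
move=> lc cr; apply: ge0_integral_oo_split => //.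
- by apply/measurable_EFinP; apply: measurable_fun_oo => x _; exact: cg.
- by move=> x _; rewrite lee_fin.
Qed.

Lemma integral_period_shift w : 0 <= w < 2 * pi ->
  (\int[lam]_(x in `]0%R, (2 * pi)%R[) (g (x - w))%:E =
   \int[lam]_(x in `]0%R, (2 * pi)%R[) (g x)%:E)%E.
Proof.
move=> /andP[]; rewrite le_eqVlt => /predU1P[<- _|w0 wpi].
  by apply: eq_integral => x _; rewrite subr0.
have -> : (\int[lam]_(x in `]0%R, (2 * pi)%R[) (g (x - w))%:E =
    \int[lam]_(x in `](- w)%R, (2 * pi - w)%R[) (g x)%:E)%E.
  by rewrite (@integral_oo_shift g w) ?addNr ?subrK// => x _; exact: cg.
rewrite (@split_g (- w) 0 (2 * pi - w)) ?subr_gt0 ?oppr_lt0//.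
rewrite (@split_g 0 (2 * pi - w) (2 * pi)) ?subr_gt0 ?ltrBlDr ?ltrDl//.
rewrite addeC; congr (_ + _)%E.
rewrite (@integral_oo_shift g (2 * pi) (- w) 0); last by move=> x _; exact: cg.
rewrite add0r [- w + _]addrC.
by apply: eq_integral => x _; rewrite gP.
Qed.

Lemma integral_period_even :
  (\int[lam]_(x in `]0%R, (2 * pi)%R[) (g x)%:E =
   2%:E * \int[lam]_(x in `]0%R, pi[) (g x)%:E)%E.
Proof.
have p0 := pi_gt0 R.
have p2 : 2 * pi = pi + pi :> R by ring.
rewrite (@split_g 0 pi (2 * pi)) ?p2 ?ltrDl// -p2.
rewrite mule_natl mule2n; congr (_ + _)%E.
rewrite integral_oo_opp; last by move=> x _; exact: cg.
rewrite (@integral_oo_shift _ (2 * pi)); last first.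
  by move=> x _; apply: continuous_comp; [exact: opp_continuous|exact: cg].
rewrite addNr p2 addrA addNr add0r -p2.
by apply: eq_integral => x _; rewrite opprB -gN opprB -[in RHS]gP.
Qed.

End periodic.

(** Gauss's transformation t = b - asin (k sin b), with k = B / A: in a
    triangle with sides A and B enclosing the angle t, this b is an exterior
    angle, and the third side is A (sqrt (1 - k^2 sin^2 b) - k cos b). *)
Lemma integral_gauss A B : 0 <= B -> B < A ->
  (\int[lam]_(t in `]0%R, pi[) ((Num.sqrt (A ^+ 2 + B ^+ 2 - 2 * A * B * cos t))^-1)%:E =
   \int[lam]_(t in `]0%R, pi[) ((Num.sqrt (A ^+ 2 - B ^+ 2 * sin t ^+ 2))^-1)%:E)%E.
Proof.
move=> B0 BA; have A0 : 0 < A := le_lt_trans B0 BA.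
pose k := B / A; have k0 : 0 <= k by rewrite divr_ge0// ltW.
have k1 : k < 1 by rewrite ltr_pdivrMr// mul1r.
have ks t : -1 < k * sin t < 1.
  rewrite -ltr_norml normrM (ger0_norm k0).
  by have := sin_max t; have := normr_ge0 (sin t); nra.
pose q t := Num.sqrt (1 - (k * sin t) ^+ 2).
have q0 t : 0 < 1 - (k * sin t) ^+ 2 by have := ks t; nra.
have qs0 t : 0 < q t by rewrite sqrtr_gt0.
have qE t : q t ^+ 2 = 1 - (k * sin t) ^+ 2 by rewrite sqr_sqrtr// ltW.
have qk t : 0 < q t - k * cos t.
  have := qE t; have := qs0 t; have := cos2Dsin2 t; set u := q t; set c := cos t; set s := sin t.
  move=> h1 h2 h3; rewrite subr_gt0 ltNge; apply/negP => h4; nra.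
pose F t := t - asin (k * sin t).
pose f t := 1 - k * cos t / q t.
have dF t : is_derive t 1 F (f t).
  have d := der_comp (derM (der_cst k t) (is_derive_sin t)) (is_derive1_asin (ks t)).
  apply: (der_eq (derB (der_id t) d)).
  by rewrite /f -/(q t) mul0r add0r; congr (_ - _); rewrite mulrC.
have cq t : {for t, continuous q}.
  have d := derB (der_cst 1 t) (derX 1 (derM (der_cst k t) (is_derive_sin t))).
  exact: der_continuous (der_sqrt d (q0 t)).
have cf t : {for t, continuous f}.
  apply: continuousB; first exact: cvg_cst.
  apply: continuousM; first by apply: continuousM; [exact: cvg_cst|exact: continuous_cos].
  by apply: continuousV; [rewrite gt_eqF|exact: cq].
pose D t := A ^+ 2 + B ^+ 2 - 2 * A * B * cos t.
have D0 t : 0 < D t.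
  rewrite /D; have := cos_max t; rewrite ler_norml => /andP[_ h].
  have AB0 : 0 <= A * B by rewrite mulr_ge0// ltW.
  nra.
have cD t : {for t, continuous (fun t => (Num.sqrt (D t))^-1)}.
  apply: continuousV; first by rewrite gt_eqF// sqrtr_gt0.
  have d := derB (der_cst (A ^+ 2 + B ^+ 2) t) (derM (der_cst (2 * A * B) t) (is_derive_cos t)).
  exact: der_continuous (der_sqrt d (D0 t)).
have a0 : asin 0 = 0 :> R.
  by rewrite -[X in asin X]sin0 sinK// in_itv/= oppr_le0 andbb divr_ge0// pi_ge0.
rewrite (@substitution_increasing_oo _ f F _ 0 pi 0 pi (pi_gt0 R)) //; last 3 first.
- move=> t _; rewrite /f -(ltr_pM2r (qs0 t)) mul0r mulrBl mul1r divfK ?gt_eqF//.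
- apply: (cvg_eq (l := F 0)); last by rewrite /F sin0 mulr0 a0 subr0.
  by apply: cvg_at_right_filter; exact: der_continuous (dF 0).
- apply: (cvg_eq (l := F pi)); last by rewrite /F sinpi mulr0 a0 subr0.
  by apply: cvg_at_left_filter; exact: der_continuous (dF pi).
apply: eq_integral => t _; congr (_%:E).
have sE : Num.sqrt (A ^+ 2 - B ^+ 2 * sin t ^+ 2) = A * q t.
  rewrite /q -{2}(ger0_norm (ltW A0)) -sqrtr_sqr -sqrtrM ?sqr_ge0//; congr Num.sqrt.
  by rewrite /k; field; rewrite gt_eqF.
have BE : B = k * A by rewrite /k divfK// gt_eqF.
have DE : Num.sqrt (D (F t)) = A * (q t - k * cos t).
  rewrite -[RHS]ger0_norm; last by rewrite mulr_ge0 ?ltW.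
  rewrite -sqrtr_sqr; congr Num.sqrt.
  have ksw : -1 <= k * sin t <= 1 by have := ks t; lra.
  rewrite /D /F cosB (asinK _); last by rewrite in_itv.
  rewrite cos_asin// -/(q t) BE.
  have h := qE t; have h' := cos2Dsin2 t; move: h h'.
  set u := q t; set c := cos t; set s := sin t => h h'.
  have -> : (A * (u - k * c)) ^+ 2 = A ^+ 2 * (u ^+ 2 - 2 * u * k * c + k ^+ 2 * c ^+ 2) by ring.
  have -> : c ^+ 2 = 1 - s ^+ 2 by lra.
  by rewrite h; ring.
rewrite -/(D (F t)) DE sE /f.
have := qs0 t; have := qk t => /lt0r_neq0 h1 /lt0r_neq0 h2.
by field; rewrite h1 h2 gt_eqF.
Qed.

Lemma integral_sin_fold (h : R -> R) : continuous (fun t => h (sin t)) ->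
  (forall t, 0 <= h (sin t)) ->
  (\int[lam]_(t in `]0%R, pi[) (h (sin t))%:E =
   2%:E * \int[lam]_(t in `]0%R, (pi / 2)%R[) (h (sin t))%:E)%E.
Proof.
move=> ch h0; have p0 := pi_gt0 R.
have p2 : pi = pi / 2 + pi / 2 :> R by field.
rewrite (@ge0_integral_oo_split _ 0 pi (pi / 2)) ?divr_gt0//; last 3 first.
- lra.
- by apply/measurable_EFinP; apply: measurable_fun_oo => x _; exact: ch.
- by move=> x _; rewrite lee_fin.
rewrite mule_natl mule2n; congr (_ + _)%E.
rewrite integral_oo_opp; last by move=> x _; exact: ch.
rewrite (@integral_oo_shift _ pi); last first.
  move=> x _; apply: (@continuous_comp _ _ _ (@GRing.opp R) (fun t => h (sin t))); last exact: ch.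
  exact: opp_continuous.
rewrite addNr (_ : - (pi / 2) + pi = pi / 2); last by lra.
by apply: eq_integral => x _; rewrite opprB sinB sinpi cospi mul0r mulN1r sub0r opprK.
Qed.

Lemma sqrtr_eq x y : 0 <= y -> x = y ^+ 2 -> Num.sqrt x = y.
Proof. by move=> y0 ->; rewrite sqrtr_sqr ger0_norm. Qed.

(** The substitution z = 2 (1 + hi) / (1 + hi + (1 - hi) sin^2 t) - 1 absorbs
    the differential into two of the square roots, and only the square root of
    a quadratic polynomial in sin t is left. *)
Lemma integral_arc (lo hi : R) : -1 <= lo -> lo < hi -> hi < 1 ->
  (\int[lam]_(z in `]hi, 1%R[)
     ((Num.sqrt (1 - z ^+ 2) * Num.sqrt (z - hi) * Num.sqrt (z - lo))^-1)%:E =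
   \int[lam]_(t in `]0%R, (pi / 2)%R[)
     ((Num.sqrt ((1 + hi) * (1 - lo) / 4 - (1 - hi) * (1 + lo) / 4 * sin t ^+ 2))^-1)%:E)%E.
Proof.
move=> lo1 lohi hi1; have pi0 := pi_gt0 R.
pose p := 1 + hi; pose r := 1 - hi.
have p0 : 0 < p by rewrite /p; lra.
have r0 : 0 < r by rewrite /r; lra.
pose d t := p + r * sin t ^+ 2.
have d0 t : 0 < d t by rewrite /d ltr_pwDl// mulr_ge0 ?sqr_ge0// ltW.
pose F t := 2 * p / d t - 1.
pose f t := - (4 * p * r * sin t * cos t / d t ^+ 2).
have dd t : is_derive t 1 d (2 * r * sin t * cos t).
  apply: (der_eq (derD (der_cst p t) (derM (der_cst r t) (derX 1 (is_derive_sin t))))).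
  by ring.
have dF t : is_derive t 1 F (f t).
  apply: (der_eq (derB (derM (der_cst (2 * p) t) (derV (dd t) (lt0r_neq0 (d0 t)))) (der_cst 1 t))).
  by rewrite /f; field; rewrite gt_eqF.
have cd t : {for t, continuous d} := der_continuous (dd t).
have cf t : {for t, continuous f}.
  apply: cvgN; apply: cvgM; last first.
    by apply: cvgV; [rewrite gt_eqF// exprn_gt0|apply: (@continuous_comp _ _ _ d (fun x => x ^+ 2)); [exact: cd|exact: exprn_continuous]].
  apply: cvgM; last exact: continuous_cos.
  by apply: cvgM; [exact: cvg_cst|exact: continuous_sin].
have sc t : 0 < t < pi / 2 -> 0 < sin t /\ 0 < cos t.
  by move=> h; split; [apply: sin_gt0_pihalf|apply: cos_gt0_pihalf; lra].
have pi20 : 0 < pi / 2 :> R by rewrite divr_gt0.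
rewrite (@substitution_decreasing_oo _ f F _ 0 (pi / 2) hi 1 pi20) //; last 4 first.
- move=> t /sc[s0 c0]; rewrite /f oppr_lt0 divr_gt0 ?exprn_gt0//.
  by do !apply: mulr_gt0.
- apply: (cvg_eq (l := F 0)); last by rewrite /F /d sin0 /p /r; field; lra.
  by apply: cvg_at_right_filter; exact: der_continuous (dF 0).
- apply: (cvg_eq (l := F (pi / 2))); last by rewrite /F /d sin_pihalf /p /r; field; lra.
  by apply: cvg_at_left_filter; exact: der_continuous (dF (pi / 2)).
- move=> z /andP[z1 z2]; apply: cvgV; last first.
    apply: cvgM; last exact: continuous_sqrtBl.
    apply: cvgM; last exact: continuous_sqrtBl.
    apply: (@continuous_comp _ _ _ (fun z => 1 - z ^+ 2) (@Num.sqrt R)); last exact: sqrt_continuous.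
    by apply: cvgB; [exact: cvg_cst|exact: exprn_continuous].
  by rewrite gt_eqF// !mulr_gt0// sqrtr_gt0; nra.
apply: eq_integral => t; rewrite inE/= in_itv/= => /sc[s0 c0]; congr (_%:E).
set X := _ / 4 - _.
have X0 : 0 < X.
  have h := cos2Dsin2 t; have -> : X = (1 + hi) * (1 - lo) / 4 * cos t ^+ 2 + (hi - lo) / 2 * sin t ^+ 2.
    by rewrite /X (_ : cos t ^+ 2 = 1 - sin t ^+ 2); [field|lra].
  by rewrite addr_gt0// mulr_gt0 ?exprn_gt0//; nra.
have e0 : 0 < Num.sqrt (d t) by rewrite sqrtr_gt0.
have n0 : 0 < Num.sqrt X by rewrite sqrtr_gt0.
have m0 : 0 < Num.sqrt (p * r) by rewrite sqrtr_gt0 mulr_gt0.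
have eE : Num.sqrt (d t) ^+ 2 = d t by rewrite sqr_sqrtr ?ltW.
have nE : Num.sqrt X ^+ 2 = X by rewrite sqr_sqrtr ?ltW.
have mE : Num.sqrt (p * r) ^+ 2 = p * r by rewrite sqr_sqrtr ?mulr_ge0 ?ltW.
have dn : p + r * sin t ^+ 2 != 0 by rewrite -/(d t) gt_eqF.
have c2 : cos t ^+ 2 = 1 - sin t ^+ 2 by have := cos2Dsin2 t; lra.
rewrite (@sqrtr_eq (1 - F t ^+ 2) (2 * Num.sqrt (p * r) * sin t / d t)); last 2 first.
- by rewrite divr_ge0 ?ltW// !mulr_gt0.
- by rewrite !exprMn exprVn mE /F /d; field.
rewrite (@sqrtr_eq (F t - hi) (Num.sqrt (p * r) * cos t / Num.sqrt (d t))); last 2 first.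
- by rewrite divr_ge0 ?ltW// !mulr_gt0.
- rewrite !exprMn exprVn mE eE c2 /F; rewrite /d /p /r in dn *; field; exact: dn.
rewrite (@sqrtr_eq (F t - lo) (2 * Num.sqrt X / Num.sqrt (d t))); last 2 first.
- by rewrite divr_ge0 ?ltW// !mulr_gt0.
- rewrite !exprMn exprVn nE eE /X /F; rewrite /d /p /r in dn *; field; exact: dn.
rewrite /f opprK.
have -> : 4 * p * r * sin t * cos t = 4 * Num.sqrt (p * r) ^+ 2 * sin t * cos t.
  by rewrite mE !mulrA.
move: (Num.sqrt (d t)) (Num.sqrt X) (Num.sqrt (p * r)) e0 n0 m0 eE => e n m e0 n0 m0 <-.
by field; rewrite !gt_eqF.
Qed.

(** Copson's formula for the kernel averaged over the angle between two
    circles of heights hi > lo. The product of the radii is A B with A^2 = (1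
    + hi) (1 - lo) and B^2 = (1 - hi) (1 + lo), and A^2 + B^2 = 2 - 2 hi lo,
    so Gauss's transformation applies. *)
Lemma circle_mean_kernel (lo hi : R) : -1 <= lo -> lo < hi -> hi < 1 ->
  (\int[lam]_(t in `]0%R, pi[) ((Num.sqrt (2 - 2 * (hi * lo) -
       2 * (Num.sqrt (1 - hi ^+ 2) * Num.sqrt (1 - lo ^+ 2)) * cos t))^-1)%:E =
   \int[lam]_(z in `]hi, 1%R[)
     ((Num.sqrt (1 - z ^+ 2) * Num.sqrt (z - hi) * Num.sqrt (z - lo))^-1)%:E)%E.
Proof.
move=> lo1 lohi hi1.
pose A := Num.sqrt ((1 + hi) * (1 - lo)); pose B := Num.sqrt ((1 - hi) * (1 + lo)).
have A2 : A ^+ 2 = (1 + hi) * (1 - lo) by rewrite sqr_sqrtr// mulr_ge0; lra.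
have B2 : B ^+ 2 = (1 - hi) * (1 + lo) by rewrite sqr_sqrtr// mulr_ge0; lra.
have B0 : 0 <= B := sqrtr_ge0 _.
have BA : B < A by rewrite ltr_sqrt; nra.
have ABE : Num.sqrt (1 - hi ^+ 2) * Num.sqrt (1 - lo ^+ 2) = A * B.
  rewrite -sqrtrM; last nra.
  rewrite /A /B -sqrtrM; last by rewrite mulr_ge0; lra.
  by congr Num.sqrt; ring.
transitivity (\int[lam]_(t in `]0%R, pi[) ((Num.sqrt (A ^+ 2 + B ^+ 2 - 2 * A * B * cos t))^-1)%:E)%E.
  by apply: eq_integral => t _; rewrite ABE A2 B2; congr ((Num.sqrt _)^-1%:E); ring.
rewrite integral_gauss// integral_arc//.
have D0 t : 0 < A ^+ 2 - B ^+ 2 * sin t ^+ 2.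
  have := sqr_ge0 (sin t); have := cos2Dsin2 t; have := sqr_ge0 (cos t); nra.
have cX : continuous (fun t => (Num.sqrt (A ^+ 2 - B ^+ 2 * sin t ^+ 2))^-1).
  move=> t; apply: cvgV; first by rewrite gt_eqF// sqrtr_gt0.
  have d := derB (der_cst (A ^+ 2) t) (derM (der_cst (B ^+ 2) t) (derX 1 (is_derive_sin t))).
  exact: der_continuous (der_sqrt d (D0 t)).
rewrite (@integral_sin_fold (fun s => (Num.sqrt (A ^+ 2 - B ^+ 2 * s ^+ 2))^-1)) //.
rewrite -ge0_integralZl//=; last first.
  by apply/measurable_EFinP; apply: measurable_fun_oo => x _; exact: cX.
apply: eq_integral => t _; rewrite -EFinM; congr (_%:E).
have -> : (1 + hi) * (1 - lo) / 4 - (1 - hi) * (1 + lo) / 4 * sin t ^+ 2 =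
  (2^-1) ^+ 2 * (A ^+ 2 - B ^+ 2 * sin t ^+ 2) by rewrite A2 B2; field.
rewrite sqrtrM ?sqr_ge0// sqrtr_sqr ger0_norm ?invr_ge0// invfM invrK.
by [].
Qed.

End copson.

(** * Zonal measures and averages over latitudes *)

Section measurable_pack.
Context d d' (T : measurableType d) (T' : measurableType d') (f : T -> T').
Hypothesis mf : measurable_fun setT f.
Let mixin := isMeasurableFun.Build _ _ _ _ _ mf.
Definition mfun_of : {mfun T >-> T'} := HB.pack f mixin.
End measurable_pack.

Section product_probability.
Context d d' (T : measurableType d) (T' : measurableType d') (R : realType).
Variables (P : probability T R) (P' : probability T' R).

Definition prodp : set (T * T')%type -> \bar R := (P \x P')%E.

HB.instance Definition _ := Measure.on prodp.

Let prodp_setT : prodp setT = 1%E.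
Proof.
have h : (P setT * P' setT = 1)%E by rewrite !probability_setT mule1.
by rewrite -[RHS]h /prodp -setXTT; exact: product_measure1E.
Qed.

HB.instance Definition _ := Measure_isProbability.Build _ _ _ prodp prodp_setT.
End product_probability.

Section zonal.
Context {R : realType}.
Notation lam := (@lebesgue_measure R).
Local Notation V := 'rV[R]_3.
Local Notation B3 := (borelR3 R).
Local Notation L := (measurableTypeR R).
Implicit Types (x y t w : R) (p : V).

(** The point of the sphere with azimuth t and third coordinate x. The third
    coordinate, rather than the polar angle, is the variable in which the Abel
    kernels appear. *)
Definition sphx t x : V :=
  \row_(i < 3) [:: Num.sqrt (1 - x ^+ 2) * cos t; Num.sqrt (1 - x ^+ 2) * sin t; x]`_i.

Lemma sphx0 t x : sphx t x 0 0 = Num.sqrt (1 - x ^+ 2) * cos t.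
Proof. by rewrite mxE. Qed.

Lemma sphx1 t x : sphx t x 0 1 = Num.sqrt (1 - x ^+ 2) * sin t.
Proof. by rewrite mxE. Qed.

Lemma sphx2 t x : sphx t x 0 ord_max = x.
Proof. by rewrite mxE. Qed.

Lemma ord3P (i : 'I_3) : [\/ i = 0, i = 1 | i = ord_max].
Proof.
by case: i => -[|[|[|//]]] hi; [apply: Or31|apply: Or32|apply: Or33]; apply: val_inj.
Qed.

Lemma eq_row3 p p' : p 0 0 = p' 0 0 -> p 0 1 = p' 0 1 -> p 0 ord_max = p' 0 ord_max ->
  p = p'.
Proof.
move=> h0 h1 h2; by apply/rowP => i; case: (ord3P i) => ->.
Qed.

Lemma sphx_sphere t x : -1 <= x <= 1 -> sphere2 (sphx t x).
Proof.
move=> x1; rewrite /sphere2/= enormE sphx0 sphx1 sphx2 !exprMn sqr_sqrtr; last by nra.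
rewrite -mulrDr cos2Dsin2 mulr1 subrK; exact: sqrtr1.
Qed.

Lemma sphere2_sqr p : sphere2 p -> p 0 0 ^+ 2 + p 0 1 ^+ 2 = 1 - p 0 ord_max ^+ 2.
Proof.
rewrite /sphere2/= enormE => h.
have : p 0 0 ^+ 2 + p 0 1 ^+ 2 + p 0 ord_max ^+ 2 = 1 ^+ 2.
  by rewrite -h sqr_sqrtr// !addr_ge0 ?sqr_ge0.
by rewrite expr1n => <-; rewrite addrK.
Qed.

Lemma sphere2_polar p : sphere2 p -> exists2 w, 0 <= w < 2 * pi & p = sphx w (p 0 ord_max).
Proof.
move=> Sp; have hp := sphere2_sqr Sp; have pi0 := pi_gt0 R.
have p1 := sphere2_coord ord_max Sp.
pose s := Num.sqrt (1 - p 0 ord_max ^+ 2).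
have s2 : s ^+ 2 = 1 - p 0 ord_max ^+ 2.
  by rewrite sqr_sqrtr// -hp addr_ge0 ?sqr_ge0.
have s0 : 0 <= s := sqrtr_ge0 _.
have [z|sn0] := eqVneq s 0.
  exists 0; first by rewrite lexx mulr_gt0.
  have h0 : p 0 0 = 0 /\ p 0 1 = 0.
    move: hp; rewrite -s2 z expr0n/= => /eqP; rewrite paddr_eq0 ?sqr_ge0//.
    by rewrite !sqrf_eq0 => /andP[/eqP-> /eqP->].
  by apply: eq_row3; rewrite ?sphx0 ?sphx1 ?sphx2 -/s ?z ?mul0r; case: h0.
have sp : 0 < s by rewrite lt_neqAle eq_sym sn0.
pose a := p 0 0 / s; pose b := p 0 1 / s.
have ab : a ^+ 2 + b ^+ 2 = 1.
  by rewrite /a /b !exprMn -mulrDl hp -s2 exprVn divff// expf_neq0.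
have a1 : -1 <= a <= 1 by have := sqr_ge0 b; nra.
have ai : a \in `[-1, 1] by rewrite in_itv.
have bE : Num.sqrt (1 - a ^+ 2) = `|b| by rewrite -sqrtr_sqr; congr Num.sqrt; lra.
have := acos_ge0 a1; have := acos_lepi a1 => h1 h2.
have [b0|b0] := leP 0 b.
  exists (acos a); first by rewrite h2/=; nra.
  apply: eq_row3; rewrite ?sphx0 ?sphx1 ?sphx2 -/s//.
    by rewrite (acosK ai) /a mulrC divfK.
  by rewrite sin_acos// bE ger0_norm// /b mulrC divfK.
have ac0 : 0 < acos a.
  rewrite lt_neqAle h2 andbT; apply/eqP => h; have := acosK ai.
  by rewrite -h cos0 => ha; move: ab; rewrite -ha; nra.
exists (2 * pi - acos a); first by nra.
have cs : cos (2 * pi - acos a) = a /\ sin (2 * pi - acos a) = b.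
  rewrite mulr_natl cosB sinB cos2pi sin2pi (acosK ai) sin_acos// bE ltr0_norm//.
  by split; ring.
case: cs => c1 c2.
apply: eq_row3; rewrite ?sphx0 ?sphx1 ?sphx2 -/s ?c1 ?c2//.
  by rewrite /a mulrC divfK.
by rewrite /b mulrC divfK.
Qed.

Lemma enorm_sphx t x w y : -1 <= x <= 1 -> -1 <= y <= 1 ->
  enorm (sphx t x - sphx w y) = Num.sqrt (2 - 2 * (x * y) -
     2 * (Num.sqrt (1 - x ^+ 2) * Num.sqrt (1 - y ^+ 2)) * cos (t - w)).
Proof.
move=> x1 y1; rewrite enormE.
have cE (i : 'I_3) : (sphx t x - sphx w y) 0 i = sphx t x 0 i - sphx w y 0 i by rewrite !mxE.
rewrite !cE !sphx0 !sphx1 !sphx2 cosB; congr Num.sqrt.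
have hx : Num.sqrt (1 - x ^+ 2) ^+ 2 = 1 - x ^+ 2 by rewrite sqr_sqrtr//; nra.
have hy : Num.sqrt (1 - y ^+ 2) ^+ 2 = 1 - y ^+ 2 by rewrite sqr_sqrtr//; nra.
move: (Num.sqrt (1 - x ^+ 2)) (Num.sqrt (1 - y ^+ 2)) hx hy => u v hu hv.
have ht := cos2Dsin2 t; have hw := cos2Dsin2 w.
transitivity (u ^+ 2 * (cos t ^+ 2 + sin t ^+ 2) + v ^+ 2 * (cos w ^+ 2 + sin w ^+ 2)
  + (x - y) ^+ 2 - 2 * (u * v) * (cos t * cos w + sin t * sin w)); first by ring.
by rewrite ht hw hu hv; ring.
Qed.

(** The value of the circle mean, up to the factor 2, as an integral over the
    heights above both circles: as a function of x and y it is a product of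
    Abel kernels integrated over z. *)
Definition copson x y : \bar R :=
  (\int[lam]_(z in `](Num.max x y), 1%R[)
     ((Num.sqrt (1 - z ^+ 2) * Num.sqrt (z - x) * Num.sqrt (z - y))^-1)%:E)%E.

Lemma integral_circle_kern x p : -1 <= x < 1 -> sphere2 p -> p 0 ord_max < 1 ->
  p 0 ord_max != x ->
  (\int[lam]_(t in `[0%R, (2 * pi)%R]) kern (sphx t x) p = 2%:E * copson x (p 0 ord_max)%R)%E.
Proof.
move=> x1 Sp; have [w w2pi pE] := sphere2_polar Sp.
set y := p 0 ord_max => y1 yx; have ym : -1 <= y.
  by have := sphere2_coord ord_max Sp; rewrite ler_norml => /andP[].
pose s := Num.sqrt (1 - x ^+ 2) * Num.sqrt (1 - y ^+ 2).
have s0 : 0 <= s by rewrite mulr_ge0 ?sqrtr_ge0.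
have ss : s < 1 - x * y.
  rewrite -ltr_sqr ?nnegrE//; last nra.
  rewrite exprMn !sqr_sqrtr; [|nra|nra].
  have : 0 < (x - y) ^+ 2 by rewrite exprn_even_gt0//= subr_eq0 eq_sym.
  nra.
pose D t := 2 - 2 * (x * y) - 2 * s * cos t.
have D0 t : 0 < D t.
  rewrite /D; have := cos_max t; rewrite ler_norml => /andP[_ h]; nra.
pose g t := (Num.sqrt (D t))^-1.
have cg : continuous g.
  move=> t; apply: cvgV; first by rewrite gt_eqF// sqrtr_gt0.
  have d := derB (der_cst (2 - 2 * (x * y)) t) (derM (der_cst (2 * s) t) (is_derive_cos t)).
  exact: der_continuous (der_sqrt d (D0 t)).
have kE t : kern (sphx t x) p = (g (t - w))%:E.
  rewrite pE -/y /kern enorm_sphx; [|lra|lra].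
  by rewrite inver gt_eqF// sqrtr_gt0; exact: D0.
under eq_integral do rewrite kE.
have cgw : continuous (fun t => g (t - w)).
  move=> t; apply: (@continuous_comp _ _ _ (fun t => t - w) g); last exact: cg.
  by apply: cvgB; [exact: cvg_id|exact: cvg_cst].
rewrite integral_itv_bndoo; last first.
  by apply/measurable_EFinP; apply: measurable_fun_oo => t _; exact: cgw.
have g0 t : 0 <= g t by rewrite invr_ge0 sqrtr_ge0.
rewrite integral_period_shift//; last first.
  by move=> t; rewrite /g /D cosB [2 * pi]mulr_natl cos2pi sin2pi mulr1 mulr0 addr0.
rewrite integral_period_even//; last 2 first.
- by move=> t; rewrite /g /D cosB [2 * pi]mulr_natl cos2pi sin2pi mulr1 mulr0 addr0.
- by move=> t; rewrite /g /D cosN.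
congr (_ * _)%E; rewrite /copson.
have [yx'|yx'] := ltP y x.
  by rewrite -circle_mean_kernel//; lra.
have xy : x < y by rewrite lt_neqAle eq_sym yx.
transitivity (\int[lam]_(z in `]y, 1%R[)
     ((Num.sqrt (1 - z ^+ 2) * Num.sqrt (z - y) * Num.sqrt (z - x))^-1)%:E)%E; last first.
  by apply: eq_integral => z _; rewrite mulrAC.
rewrite -circle_mean_kernel//; last lra.
by apply: eq_integral => t _; rewrite /g /D /s [x * y]mulrC [Num.sqrt (1 - x ^+ 2) * _]mulrC.
Qed.

Lemma measurable_sphx : measurable_fun setT ((fun q => sphx q.1 q.2) : L * L -> B3).
Proof.
apply: measurable_fun_coords => i.
have m1 : measurable_fun setT (fst : L * L -> R) by exact: measurable_fst.
have m2 : measurable_fun setT (snd : L * L -> R) by exact: measurable_snd.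
have ms : measurable_fun setT (fun q : L * L => Num.sqrt (1 - (q.2 : R) ^+ 2)).
  by apply: measurable_sqrtr; apply: measurable_funB => //; exact: measurable_funX.
have mc (f : R -> R) : continuous f -> measurable_fun setT (fun q : L * L => f q.1).
  by move=> cf; apply: measurableT_comp m1; exact: continuous_measurable_fun.
case: (ord3P i) => ->.
- under eq_fun do rewrite sphx0; apply: measurable_funM => //.
  by apply: mc; exact: continuous_cos.
- under eq_fun do rewrite sphx1; apply: measurable_funM => //.
  by apply: mc; exact: continuous_sin.
- by under eq_fun do rewrite sphx2.
Qed.

Lemma two_pi_gt0 : (0 : R) < 2 * pi.
Proof. by rewrite mulr_gt0// pi_gt0. Qed.

(** The rotation invariant measure on the sphere whose third coordinate has
    law m. *)
Definition zon (m : probability L R) : probability B3 R :=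
  distribution (prodp (uniform_prob two_pi_gt0) m) (mfun_of measurable_sphx).

(** The mean of h over the circle of latitude of height x. *)
Definition avg (h : B3 -> \bar R) x : \bar R :=
  (((2 * pi)^-1)%:E * \int[lam]_(t in `[0%R, (2 * pi)%R]) h (sphx t x))%E.

Lemma measurable_sphxl x : measurable_fun setT ((fun t => sphx t x) : L -> B3).
Proof.
apply: measurable_fun_coords => i.
have mc (f : R -> R) : continuous f -> measurable_fun setT (f : L -> R).
  exact: continuous_measurable_fun.
case: (ord3P i) => ->.
- under eq_fun do rewrite sphx0; apply: measurable_funM => //.
  by apply: mc; exact: continuous_cos.
- under eq_fun do rewrite sphx1; apply: measurable_funM => //.
  by apply: mc; exact: continuous_sin.
- by under eq_fun do rewrite sphx2; exact: measurable_cst.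
Qed.

Lemma integral_zon (m : probability L R) (h : B3 -> \bar R) :
  measurable_fun setT h -> (forall p, (0 <= h p)%E) ->
  (\int[zon m]_p h p = \int[m]_x avg h x)%E.
Proof.
move=> mh h0; rewrite /zon ge0_integral_distribution//= /prodp.
rewrite fubini_tonelli2//=; last exact: measurableT_comp measurable_sphx.
apply: eq_integral => x _; rewrite /fubini_G /avg /=.
rewrite integral_uniform ?subr0//.
by apply: measurableT_comp mh _; exact: measurable_sphxl.
Qed.

Lemma measurable_avg (h : B3 -> \bar R) :
  measurable_fun setT h -> (forall p, (0 <= h p)%E) -> measurable_fun setT (avg h : L -> _).
Proof.
move=> mh h0.
have : measurable_fun setT (fubini_G (uniform_prob two_pi_gt0) (fun q => h (sphx q.1 q.2)) : L -> _).
  apply: measurable_fun_fubini_tonelli_G => //.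
  exact: measurableT_comp measurable_sphx.
rewrite (_ : fubini_G _ _ = avg h)//; apply/funext => x; rewrite /fubini_G /avg /=.
rewrite integral_uniform ?subr0//.
by apply: measurableT_comp mh _; exact: measurable_sphxl.
Qed.

End zonal.

(** * Energies and the first variation *)

Section convex_combination.
Context d (T : measurableType d) (R : realType).
Variables (a b : {nonneg R}) (ab : a%:num + b%:num = 1) (P P' : probability T R).

Definition mixp (ab' : a%:num + b%:num = 1) : set T -> \bar R :=
  measure_add (mscale a P) (mscale b P').

HB.instance Definition _ := Measure.on (mixp ab).

Let mixp_setT : mixp ab setT = 1%E.
Proof.
rewrite /mixp measure_addE.
have h : (a%:num%:E * P setT + b%:num%:E * P' setT = 1)%E.
  by rewrite !probability_setT !mule1 -EFinD ab.
by rewrite -[RHS]h.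
Qed.

HB.instance Definition _ := Measure_isProbability.Build _ _ _ (mixp ab) mixp_setT.

Lemma integral_mixp (f : T -> \bar R) : measurable_fun setT f -> (forall x, (0 <= f x)%E) ->
  (\int[mixp ab]_x f x = a%:num%:E * \int[P]_x f x + b%:num%:E * \int[P']_x f x)%E.
Proof.
move=> mf f0; rewrite /mixp ge0_integral_measure_add//.
by rewrite !ge0_integral_mscale.
Qed.
End convex_combination.

Section conditional.
Context d (T : measurableType d) (R : realType).
Variables (P : probability T R) (D : set T).
Hypotheses (mD : measurable D) (PD : (0 < P D)%E).

Definition cond_pdf (x : T) : \bar R := ((\1_D x / fine (P D))%:E)%E.

Lemma fine_cond : 0 < fine (P D).
Proof. by rewrite fine_gt0// PD ltey_eq fin_num_measure. Qed.

Lemma cond_pdf_ge0 x : (0 <= cond_pdf x)%E.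
Proof. by rewrite lee_fin divr_ge0// ltW// fine_cond. Qed.

Lemma measurable_cond_pdf : measurable_fun setT cond_pdf.
Proof.
apply/measurable_EFinP; apply: measurable_funM; last exact: measurable_cst.
exact: measurable_indic.
Qed.

Definition condp : set T -> \bar R :=
  dens P measurable_cond_pdf cond_pdf_ge0.

HB.instance Definition _ := Measure.on condp.

Lemma integral_condp (f : T -> \bar R) : measurable_fun setT f -> (forall x, (0 <= f x)%E) ->
  (\int[condp]_x f x = (fine (P D))^-1%:E * \int[P]_(x in D) f x)%E.
Proof.
move=> mf f0; rewrite /condp ge0_integral_dens//.
rewrite [X in _ = (_ * X)%E]integral_mkcond -ge0_integralZl//; last 3 first.
- by apply/(measurable_restrictT f mD); exact: measurable_funTS.
- by move=> x _; rewrite patchE; case: ifP.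
- by rewrite lee_fin invr_ge0 ltW// fine_cond.
apply: eq_integral => x _; rewrite /cond_pdf patchE indicE; case: ifP => _.
  by rewrite mul1r muleC.
by rewrite mul0r !mule0.
Qed.

Let condp_setT : condp setT = 1%E.
Proof.
have := @integral_condp (fun=> 1%E) (@measurable_cst _ _ _ _ _ 1%E) (fun=> @lee01 R).
rewrite !integral_cst// !mul1e => ->.
rewrite -[X in (_ * X)%E]fineK ?fin_num_measure// -EFinM mulVf// gt_eqF//.
exact: fine_cond.
Qed.

HB.instance Definition _ := Measure_isProbability.Build _ _ _ condp condp_setT.
End conditional.

Section potential.
Context {R : realType}.
Notation lam := (@lebesgue_measure R).
Local Notation V := 'rV[R]_3.
Local Notation B3 := (borelR3 R).
Local Notation L := (measurableTypeR R).
Local Notation S := (@sphere2 R : set B3).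
Local Open Scope ereal_scope.
Implicit Types (m n : probability B3 R).

Definition potential m (x : B3) : \bar R := \int[m]_y kern x y.

Definition menergy m n : \bar R := \int[m]_x potential n x.

Lemma measurable_kern2 : measurable_fun setT (fun q : B3 * B3 => kern q.1 q.2).
Proof. by apply: measurable_kern; [exact: measurable_fst|exact: measurable_snd]. Qed.

Lemma potential_ge0 m x : 0 <= potential m x.
Proof. by apply: integral_ge0 => y _; exact: kern_ge0. Qed.

Lemma measurable_potential m : measurable_fun setT (potential m).
Proof.
have := @measurable_fun_fubini_tonelli_F _ _ B3 B3 R m _ measurable_kern2.
by apply => q; exact: kern_ge0.
Qed.

Lemma measurable_kernl x : measurable_fun setT (fun y : B3 => kern x y).
Proof. by apply: measurable_kern; [exact: measurable_cst|exact: measurable_id]. Qed.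

Lemma menergyC m n : menergy m n = menergy n m.
Proof.
transitivity (\int[n]_y \int[m]_x kern x y).
  apply: (fubini_tonelli (fun q : B3 * B3 => kern q.1 q.2)).
    exact: measurable_kern2.
  by move=> q; exact: kern_ge0.
by apply: eq_integral => y _; apply: eq_integral => x _; rewrite kernC.
Qed.

Lemma menergy_ge0 m n : 0 <= menergy m n.
Proof. by apply: integral_ge0 => x _; exact: potential_ge0. Qed.

Lemma integral_on_sphere m (h : B3 -> \bar R) : on_sphere m ->
  measurable_fun setT h -> (forall x, 0 <= h x) ->
  \int[m]_(x in S) h x = \int[m]_x h x.
Proof.
move=> sm mh h0; have mS := @measurable_sphere2 R.
rewrite [RHS](@ge0_negligible_integral _ _ _ m setT (~` S))//.
- by rewrite setTD setCK.
- exact: measurableC.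
- exact: on_sphereC.
Qed.

Lemma energy2E m n : on_sphere m -> on_sphere n -> energy2 m n = menergy m n.
Proof.
move=> sm sn; transitivity (\int[m]_(x in S) potential n x).
  apply: eq_integral => x _; apply: (integral_on_sphere sn) => [|y].
    exact: measurable_kernl.
  exact: kern_ge0.
apply: (integral_on_sphere sm) => [|x]; first exact: measurable_potential.
exact: potential_ge0.
Qed.

Lemma on_sphere_mixp (a b : {nonneg R}) (ab : (a%:num + b%:num = 1)%R) m n :
  on_sphere m -> on_sphere n -> on_sphere (mixp m n ab).
Proof.
move=> sm sn; rewrite /on_sphere /mixp [LHS]measure_addE /mscale.
have h : (a%:num%:E * m S + b%:num%:E * n S = 1)%E.
  by rewrite [m S]sm [n S]sn !mule1 -EFinD ab.
exact: h.
Qed.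

Lemma menergy_mixp (a b : {nonneg R}) (ab : (a%:num + b%:num = 1)%R) m n :
  menergy (mixp m n ab) (mixp m n ab) =
  a%:num%:E * (a%:num%:E * menergy m m + b%:num%:E * menergy n m) +
  b%:num%:E * (a%:num%:E * menergy n m + b%:num%:E * menergy n n).
Proof.
have UE x : potential (mixp m n ab) x = a%:num%:E * potential m x + b%:num%:E * potential n x.
  rewrite /potential integral_mixp//; first exact: measurable_kernl.
  by move=> y; exact: kern_ge0.
have mU k : measurable_fun setT (potential k) := @measurable_potential k.
have U0 k x := potential_ge0 k x.
rewrite /menergy; under eq_integral do rewrite UE.
have mZ k (c : {nonneg R}) : measurable_fun setT (fun x => c%:num%:E * potential k x).
  by apply: measurable_funeM.
have Z0 k (c : {nonneg R}) x : 0 <= c%:num%:E * potential k x by rewrite mule_ge0// lee_fin.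
rewrite integral_mixp; last 2 first.
- exact: emeasurable_funD.
- by move=> x; rewrite adde_ge0.
have lin (k : probability B3 R) : \int[k]_x (a%:num%:E * potential m x + b%:num%:E * potential n x) =
    a%:num%:E * menergy k m + b%:num%:E * menergy k n.
  rewrite (@ge0_integralD _ _ _ k setT measurableT) => //.
  by rewrite (ge0_integralZl _ measurableT (mU m))// (ge0_integralZl _ measurableT (mU n)).
by rewrite !lin (menergyC m n).
Qed.

(** First variation: along the segment (1 - t) m + t n the weighted energy is
    a quadratic polynomial in t, minimal at t = 0, so its derivative 2 (I(m,
    n) + int q dn - I(m, m) - int q dm) there is nonnegative. I is the mutual
    energy. When I(m, n) is infinite there is nothing to prove. *)
Lemma euler_lagrange (q : B3 -> \bar R) m n : measurable_fun setT q -> (forall x, 0 <= q x) ->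
  on_sphere m -> on_sphere n ->
  (forall k, on_sphere k ->
    menergy m m + 2%:E * \int[m]_x q x <= menergy k k + 2%:E * \int[k]_x q x) ->
  menergy m m < +oo -> \int[m]_x q x < +oo -> menergy n n < +oo ->
  menergy m m + \int[m]_x q x <= \int[n]_x potential m x + \int[n]_x q x.
Proof.
move=> mq q0 sm sn minm Am am Bn; rewrite -/(menergy n m).
have [h|] := boolP (menergy n m + \int[n]_x q x == +oo); first by rewrite (eqP h) leey.
rewrite -ltey => fRHS.
have [Cn bn] : menergy n m < +oo /\ \int[n]_x q x < +oo.
  have b0 : 0 <= \int[n]_x q x by exact: integral_ge0.
  by split; apply: le_lt_trans fRHS; [rewrite leeDl|rewrite leeDr ?menergy_ge0].
have fin k l : menergy k l < +oo -> exists r, menergy k l = r%:E.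
  move=> h; exists (fine (menergy k l)); rewrite fineK// ge0_fin_numE//; exact: menergy_ge0.
have finq (k : probability B3 R) : \int[k]_x q x < +oo -> exists r, \int[k]_x q x = r%:E.
  by move=> h; exists (fine (\int[k]_x q x)); rewrite fineK// ge0_fin_numE// integral_ge0.
have [A AE] := fin _ _ Am; have [B BE] := fin _ _ Bn; have [C CE] := fin _ _ Cn.
have [a aE] := finq _ am; have [b bE] := finq _ bn.
rewrite AE aE CE bE -!EFinD lee_fin leNgt; apply/negP => lt.
have key (t : R) : (0 < t -> t < 1 -> 2 * (A + a - (C + b)) <= t * (A - 2 * C + B))%R.
  move=> t0 t1; have t0' := ltW t0; have t1' : (0 <= 1 - t)%R by rewrite subr_ge0 ltW.
  have tt : ((NngNum t1')%:num + (NngNum t0')%:num = 1)%R by rewrite /=; lra.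
  have := minm _ (on_sphere_mixp tt sm sn).
  rewrite menergy_mixp integral_mixp//= AE BE CE aE bE -?EFinM -?EFinD -?EFinM -?EFinD -?EFinM -?EFinD lee_fin => h.
  have h2 : (t * (2 * (A + a - (C + b))) <= t * (t * (A - 2 * C + B)))%R by lra.
  by move: h2; rewrite ler_pM2l.
(* For t this small the quadratic term cannot compensate the linear one. *)
pose de := (A + a - (C + b))%R; have de0 : (0 < de)%R by rewrite /de; lra.
pose K := (A - 2 * C + B)%R.
pose t := (Num.min (1 / 2) (de / (`|K| + 1)))%R.
have K1 : (0 < `|K| + 1)%R by rewrite ltr_pwDr.
have t0 : (0 < t)%R by rewrite lt_min divr_gt0// divr_gt0.
have t1 : (t < 1)%R by apply: (@le_lt_trans _ _ (1 / 2)%R); [rewrite ge_min lexx|lra].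
have tK : (t * (`|K| + 1) <= de)%R by rewrite -ler_pdivlMr// ge_min lexx orbT.
have := key t t0 t1; rewrite -/de -/K => h.
have := ler_norm K; nra.
Qed.

Lemma on_sphereP m : m (~` S) = 0 -> on_sphere m.
Proof.
have mS := @measurable_sphere2 R => m0.
rewrite /on_sphere -[X in m X]setCK [LHS]probability_setC; last exact: measurableC.
by rewrite m0 sube0.
Qed.

Lemma on_sphere_condp m (D : set B3) (mD : measurable D) (mD0 : 0 < m D) :
  on_sphere m -> on_sphere (condp mD mD0).
Proof.
move=> sm; have mS := @measurable_sphere2 R; apply: on_sphereP.
have mI : measurable_fun setT (fun x : B3 => (\1_(~` S) x)%:E : \bar R).
  by apply/measurable_EFinP; apply: measurable_indic; exact: measurableC.
transitivity (\int[condp mD mD0]_x (\1_(~` S) x)%:E).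
  by rewrite integral_indic ?setIT//; exact: measurableC.
rewrite integral_condp//.
suff -> : \int[m]_(x in D) (\1_(~` S) x)%:E = 0 by rewrite mule0.
apply/eqP; rewrite eq_le integral_ge0// andbT.
apply: le_trans (_ : m (~` S) <= _); last by rewrite (on_sphereC sm).
rewrite integral_indic//; last exact: measurableC.
by apply: le_measure; rewrite ?inE//; [apply: measurableI => //|]; exact: measurableC.
Qed.

(** Conditioning multiplies the measure by at most 1 / m(D), hence the energy
    by at most its square. *)
Lemma menergy_condp m (D : set B3) (mD : measurable D) (mD0 : 0 < m D) : menergy m m < +oo ->
  menergy (condp mD mD0) (condp mD mD0) < +oo.
Proof.
move=> Jm; have c0 := fine_cond mD mD0.
have k0 : (0 <= (fine (m D))^-1)%R by rewrite invr_ge0 ltW.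
have UE x : potential (condp mD mD0) x <= (fine (m D))^-1%:E * potential m x.
  rewrite /potential integral_condp; [|exact: measurable_kernl|by move=> y; exact: kern_ge0].
  rewrite lee_wpmul2l ?lee_fin//; apply: ge0_subset_integral => //.
  - exact: measurable_kernl.
  - by move=> y _; exact: kern_ge0.
have mU := @measurable_potential.
rewrite /menergy integral_condp; [|exact: mU|by move=> x; exact: potential_ge0].
rewrite lte_mul_pinfty ?lee_fin//.
apply: (@le_lt_trans _ _ ((fine (m D))^-1%:E * menergy m m)).
  apply: (@le_trans _ _ (\int[m]_x ((fine (m D))^-1%:E * potential m x))).
    apply: (@le_trans _ _ (\int[m]_x potential (condp mD mD0) x)).
      apply: ge0_subset_integral => //.
      by move=> x _; exact: potential_ge0.
    apply: ge0_le_integral => //; solve [exact: mU |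
      by apply: measurable_funeM; exact: mU | by move=> x _; exact: potential_ge0].
  rewrite ge0_integralZl ?lee_fin//.
  by move=> x _; exact: potential_ge0.
by rewrite lte_mul_pinfty ?lee_fin.
Qed.

End potential.

(** * Frostman inequalities on the support *)

Section frostman.
Context {R : realType}.
Local Notation V := 'rV[R]_3.
Local Notation B3 := (borelR3 R).
Local Notation S := (@sphere2 R : set B3).
Implicit Types (m : probability B3 R) (x y z p : V).

Lemma enorm_triangle x y z : enorm (x - z) <= enorm (x - y) + enorm (y - z).
Proof.
have mxB (u v : V) i : (u - v) 0 i = u 0 i - v 0 i by rewrite !mxE.
rewrite !enormE !mxB.
set a := x 0 0 - y 0 0; set b := x 0 1 - y 0 1; set c := x 0 ord_max - y 0 ord_max.
set a' := y 0 0 - z 0 0; set b' := y 0 1 - z 0 1; set c' := y 0 ord_max - z 0 ord_max.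
have -> : x 0 0 - z 0 0 = a + a' by rewrite /a /a'; ring.
have -> : x 0 1 - z 0 1 = b + b' by rewrite /b /b'; ring.
have -> : x 0 ord_max - z 0 ord_max = c + c' by rewrite /c /c'; ring.
have P (u v w : R) : 0 <= u ^+ 2 + v ^+ 2 + w ^+ 2 by rewrite !addr_ge0 ?sqr_ge0.
set A := a ^+ 2 + b ^+ 2 + c ^+ 2; set B := a' ^+ 2 + b' ^+ 2 + c' ^+ 2.
have A0 : 0 <= A := P a b c; have B0 : 0 <= B := P a' b' c'.
have cs : a * a' + b * b' + c * c' <= Num.sqrt A * Num.sqrt B.
  rewrite -sqrtrM// (le_trans (ler_norm _))// -sqrtr_sqr ler_sqrt ?mulr_ge0//.
  rewrite -subr_ge0 (_ : _ - _ = (a * b' - b * a') ^+ 2 + (a * c' - c * a') ^+ 2 +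
     (b * c' - c * b') ^+ 2) ?P// /A /B; ring.
rewrite -(ler_pXn2r (_ : 0 < 2)%N)// ?nnegrE ?addr_ge0 ?sqrtr_ge0// sqr_sqrtr ?P//.
rewrite [leRHS]sqrrD !sqr_sqrtr// /A /B; lra.
Qed.

Lemma enorm_ge0 x : 0 <= enorm x.
Proof. exact: sqrtr_ge0. Qed.

(** If |x - x0| <= e then |x - y| <= |x0 - y| + e, so the potential at x is at
    least the potential at x0 of the bounded kernel 1 / (|x0 - y| + e); the
    latter increases to the full potential as e tends to 0. *)
Lemma potential_lsc m x0 (r : R) : (r%:E < potential m x0)%E -> \forall x \near x0, (r%:E < potential m x)%E.
Proof.
pose k (n : nat) (y : B3) : \bar R := ((enorm (x0 - y : V) + n.+1%:R^-1)^-1)%:E.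
have d0 (n : nat) (y : V) : 0 < enorm (x0 - y) + n.+1%:R^-1.
  by rewrite ltr_wpDl ?enorm_ge0// invr_gt0.
have k0 n y : (0 <= k n y)%E by rewrite lee_fin invr_ge0 ltW.
have mk n : measurable_fun setT (k n).
  apply/measurable_EFinP; apply: (measurableT_comp measurable_invr).
  apply: measurable_funD; last exact: measurable_cst.
  apply: continuous_measurableR3 => y.
  apply: (@continuous_comp _ _ _ (fun y : V => x0 - y) (@enorm R)); last exact: enorm_continuous.
  apply: (@continuousB R V V (fun=> x0) id); first exact: cst_continuous.
  by move=> ?.
have knd (y : B3) : nondecreasing_seq (k ^~ y).
  move=> i j ij; rewrite lee_fin lef_pV2 ?posrE//; last by rewrite lerD2l lef_pV2 ?posrE// ler_nat.
have kcv (y : B3) : (k n y @[n --> \oo] --> kern x0 y)%classic.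
  have hc : (n.+1%:R^-1 : R) @[n --> \oo] --> (0 : R) by exact: cvg_harmonic.
  rewrite /kern inver /k; case: eqVneq => [->|e0].
    under eq_fun do rewrite add0r invrK.
    apply/cvgeryP; rewrite (cvg_shiftS (fun n : nat => n%:R : R)).
    exact: cvgr_idn.
  apply: cvg_EFin; first exact: nearW.
  apply: cvgV => //; rewrite -[X in _ --> X]addr0; apply: cvgD => //; exact: cvg_cst.
have : ((\int[m]_y k n y)%E @[n --> \oo] --> potential m x0)%classic.
  rewrite /potential [X in _ --> X](_ : _ = (\int[m]_y limn (fun n => k n y))%E).
    by apply: cvg_monotone_convergence => // y _; exact: knd.
  by apply: eq_integral => y _; apply/esym/cvg_lim.
move=> cv rU; have [n _ /(_ n (leqnn n)) rn] :
    \forall n \near \oo, (r%:E < \int[m]_y k n y)%E.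
  exact: cv (open_nbhs_nbhs (conj (@open_ereal_gt_ereal _ _) rU)).
have : \forall x \near x0, enorm (x - x0) < n.+1%:R^-1.
  have ce : {for x0, continuous (fun x : V => enorm (x - x0))}.
    apply: (@continuous_comp _ _ _ (fun y : V => y - x0) (@enorm R)); last exact: enorm_continuous.
    apply: (@continuousB R V V id (fun=> x0)); first by move=> ?.
    exact: cst_continuous.
  have e00 : enorm (x0 - x0) = 0 by rewrite subrr enormE !mxE expr0n/= !addr0 sqrtr0.
  move: ce; rewrite /prop_for /continuous_at e00 => /cvgr_lt; apply.
  by rewrite invr_gt0.
apply: filterS => x hx; apply: (lt_le_trans rn); apply: ge0_le_integral => //.
  exact: measurable_kernl.
move=> y _; rewrite /k /kern inver; case: eqVneq => [_|e0]; first exact: leey.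
rewrite lee_fin lef_pV2 ?posrE ?d0//; last by rewrite lt_neqAle eq_sym e0 enorm_ge0.
rewrite (le_trans (enorm_triangle _ x0 _))// addrC lerD2l ltW//.
Qed.

(** At an atom the potential is infinite because the kernel is, and the atom
    makes this count in the energy. *)
Lemma finite_energy_atom m p : (menergy m m < +oo)%E -> m [set p] = 0%E.
Proof.
move=> Jm; apply/eqP; rewrite eq_le measure_ge0 andbT leNgt; apply/negP => mp.
have mset1 : measurable ([set p] : set B3).
  rewrite (_ : [set p] = ~` ~` [set p]); last by rewrite setCK.
  apply: measurableC; apply: open_measurableR3; apply: closed_openC.
  exact: (@accessible_closed_set1 V (hausdorff_accessible (@norm_hausdorff _ _)) p).
have on1 (f : B3 -> \bar R) : measurable_fun setT f -> (forall x, 0 <= f x)%E ->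
    (f p * m [set p] <= \int[m]_x f x)%E.
  move=> mf f0; apply: (@le_trans _ _ (\int[m]_(x in [set p]) f x)%E).
    rewrite (eq_integral (fun=> f p)) ?integral_cst// => x.
    by rewrite inE => ->.
  exact: ge0_subset_integral.
have Up : potential m p = +oo%E.
  apply/eqP; rewrite -leye_eq.
  have := on1 _ (measurable_kernl p) (fun y => kern_ge0 p y).
  by rewrite kernxx gt0_mulye.
move: Jm; rewrite ltNge => /negP; apply.
have := on1 _ (@measurable_potential _ m) (@potential_ge0 _ m).
by rewrite Up gt0_mulye.
Qed.

Definition rat_box (p : {ffun 'I_3 -> rat} * rat) : set V :=
  [set y | forall i, `|y 0 i - ratr (p.1 i)| < ratr p.2].

Lemma open_rat_box (p : {ffun 'I_3 -> rat} * rat) : open (rat_box p).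
Proof.
have -> : rat_box p = [set y | `|y 0 0 - ratr (p.1 0)| < ratr p.2] `&`
    ([set y | `|y 0 1 - ratr (p.1 1)| < ratr p.2] `&`
     [set y | `|y 0 ord_max - ratr (p.1 ord_max)| < ratr p.2]).
  by apply/seteqP; split=> y; [move=> h; split; [|split]; exact: h|
    move=> [h0 [h1 h2]] i; case: (ord3P i) => ->].
have oi i : open [set y : V | `|y 0 i - ratr (p.1 i)| < ratr p.2].
  rewrite (_ : mkset _ = (fun y : V => `|y 0 i - ratr (p.1 i)|) @^-1` [set t | t < ratr p.2])//.
  apply: open_comp; last exact: open_lt.
  move=> y _; apply: (@continuous_comp _ _ _ (fun y : V => y 0 i) (fun t : R => `|t - ratr (p.1 i)|)).
    exact: coord_continuous.
  apply: (@continuous_comp _ _ _ (fun t : R => t - ratr (p.1 i)) Num.norm).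
    by apply: cvgB; [exact: cvg_id|exact: cvg_cst].
  exact: norm_continuous.
exact: openI (oi 0) (openI (oi 1) (oi ord_max)).
Qed.
Arguments open_rat_box : clear implicits.

(** An open null set is a countable union of rational boxes, all of them null.
    This makes the support measurable and its complement null. *)
Lemma msupportC m : ~` msupport m =
  \bigcup_(p in [set p | m (rat_box p) = 0%E]) rat_box p.
Proof.
apply/seteqP; split=> x /=; last first.
  move=> [p /= p0 xp] /(_ _ (open_rat_box p) xp); rewrite p0 ltxx//.
move=> /existsNP[W /not_implyP[oW /not_implyP[Wx /negP]]].
rewrite -leNgt => mW0.
move: (Wx); rewrite (open_rat_boxes oW) => -[p pW xp]; exists p => //=.
apply/eqP; rewrite eq_le measure_ge0 andbT (le_trans _ mW0)//.
by apply: le_measure; rewrite ?inE//; apply: open_measurableR3 => //; exact: open_rat_box.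
Qed.

Lemma measurable_msupport m : measurable (msupport m : set B3).
Proof.
rewrite -[msupport m]setCK msupportC; apply: measurableC.
rewrite bigcup_mkcond; apply: countable_bigcupT_measurable; first exact: countableP.
by move=> p; case: ifPn => // _; apply: open_measurableR3; exact: open_rat_box.
Qed.

Lemma msupport_carrier m : m (~` msupport m) = 0%E.
Proof.
pose F n : set B3 := if unpickle n is Some p then
  (if m (rat_box p) == 0%E then rat_box p else set0) else set0.
have : m.-negligible (\bigcup_n F n).
  apply: negligible_bigcup => n; rewrite /F; case: (unpickle n) => [p|]; last exact: negligible_set0.
  case: eqP => [p0|_]; last exact: negligible_set0.
  apply/negligibleP => //; apply: open_measurableR3; exact: open_rat_box.
move=> Fn; apply: measure_negligible.
  by apply: measurableC; exact: measurable_msupport.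
apply: negligibleS Fn; rewrite msupportC => x [p /= p0 xp]; exists (pickle p) => //.
by rewrite /F pickleK p0 eqxx.
Qed.

Section equilibrium.
Local Open Scope ereal_scope.
Variables (q : B3 -> \bar R) (m : probability B3 R) (F : R).
Hypotheses (mq : measurable_fun setT q) (q0 : forall x, 0 <= q x).
Hypotheses (sm : on_sphere m) (Jm : menergy m m < +oo) (qm : \int[m]_x q x < +oo).
Hypothesis minm : forall k, on_sphere k ->
  menergy m m + 2%:E * \int[m]_x q x <= menergy k k + 2%:E * \int[k]_x q x.
Hypothesis FE : menergy m m + \int[m]_x q x = F%:E.

Let Uq (x : B3) : \bar R := potential m x + q x.

Let mUq : measurable_fun setT Uq.
Proof. by apply: emeasurable_funD => //; exact: measurable_potential. Qed.

Let Uq0 x : 0 <= Uq x.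
Proof. by rewrite adde_ge0// potential_ge0. Qed.

Let intUq : \int[m]_x Uq x = F%:E.
Proof.
rewrite -FE /Uq; apply: ge0_integralD => //;
  solve [exact: measurable_potential | by move=> x _; exact: potential_ge0].
Qed.

(** Euler-Lagrange for the competitor obtained by conditioning m on D. *)
Lemma potential_lower_set (D : set B3) : measurable D -> F%:E * m D <= \int[m]_(x in D) Uq x.
Proof.
move=> mD; have [D0|D0] := eqVneq (m D) 0.
  by rewrite D0 mule0; exact: integral_ge0.
have {}D0 : 0 < m D by rewrite lt_neqAle eq_sym D0 measure_ge0.
have c0 := fine_cond mD D0.
have := euler_lagrange mq q0 sm (on_sphere_condp mD D0 sm) minm Jm qm (menergy_condp mD D0 Jm).
rewrite FE.
rewrite -[X in _ <= X -> _](_ : \int[condp mD D0]_x Uq x = _); last first.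
  by apply: ge0_integralD => //; solve [exact: measurable_potential | by move=> x _; exact: potential_ge0].
rewrite (integral_condp mD D0 mUq Uq0) => h.
have mDf : m D = (fine (m D))%:E by rewrite fineK// fin_num_measure.
rewrite mDf muleC; apply: (@le_trans _ _ ((fine (m D))%:E * ((fine (m D))^-1%:E * \int[m]_(x in D) Uq x))).
  by rewrite lee_wpmul2l// lee_fin ltW.
by rewrite muleA -EFinM mulfV ?gt_eqF// mul1e.
Qed.

(** The total integral is F, so the lower bound on the complement of D is an
    upper bound on D. *)
Lemma potential_upper_set (D : set B3) : measurable D -> \int[m]_(x in D) Uq x <= F%:E * m D.
Proof.
move=> mD; have mC : measurable (~` D) by exact: measurableC.
have split : \int[m]_(x in D) Uq x + \int[m]_(x in ~` D) Uq x = F%:E.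
  rewrite -intUq -[in RHS](setUv D) ge0_integral_setU ?setUv//.
  by apply/disj_set2P; rewrite setICr.
have h := potential_lower_set mC.
have fD : m D = (fine (m D))%:E by rewrite fineK// fin_num_measure.
have cD : m (~` D) = (1 - fine (m D))%:E by rewrite probability_setC// fD.
have le1 : \int[m]_(x in D) Uq x + F%:E * m (~` D) <= F%:E by rewrite -[leRHS]split leeD2l.
move: le1; rewrite cD fD -!EFinM -leeBrDr// -EFinB => /le_trans; apply.
by rewrite lee_fin; lra.
Qed.

(** By lower semicontinuity, an excess over F at one point of the support
    spreads to a neighbourhood, which has positive mass; this contradicts the
    upper bound on that neighbourhood. *)
Lemma potential_support x0 : msupport m x0 -> S x0 ->
  (forall s : R, s%:E < q x0 -> \forall x \near x0, S x -> s%:E < q x) ->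
  potential m x0 + q x0 <= F%:E.
Proof.
move=> sx Sx qlsc; rewrite leNgt; apply/negP => lt.
have [r [s [rU sq rs]]] : exists r s : R, [/\ r%:E < potential m x0, s%:E < q x0 & (F < r + s)%R].
  move: lt (potential_ge0 m x0) (q0 x0); case: (potential m x0) => [u| |]//; case: (q x0) => [v| |]//.
  - rewrite -EFinD lte_fin => h _ _.
    exists (u - (u + v - F) / 4)%R, (v - (u + v - F) / 4)%R.
    by split; rewrite ?lte_fin; lra.
  - by move=> _ _ _; exists (u - 1)%R, (F + 2 - u)%R; split; rewrite ?lte_fin ?ltry//; lra.
  - by move=> _ _ _; exists (F + 2 - v)%R, (v - 1)%R; split; rewrite ?lte_fin ?ltry//; lra.
  - by move=> _ _ _; exists (F + 1)%R, 0%R; split; rewrite ?ltry//; lra.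
have : \forall x \near x0, r%:E < potential m x /\ (S x -> s%:E < q x).
  by apply: filterS2 (potential_lsc rU) (qlsc s sq).
rewrite /prop_near1 nbhsE /= => -[W [oW Wx] hW].
have mW := sx W oW Wx; have mS := @measurable_sphere2 R.
have mWm := open_measurableR3 oW.
have mWS : measurable ((W : set B3) `&` S) by exact: measurableI.
have WS : m W = m ((W : set B3) `&` S).
  rewrite [LHS](measureDI m mWm mS) setDE.
  rewrite (subset_measure0 _ _ (@subIsetr _ (W : set B3) (~` S)) (on_sphereC sm)) ?add0e//.
    by apply: measurableI => //; exact: measurableC.
  exact: measurableC.
have := potential_upper_set mWS; rewrite leNgt => /negP; apply.
apply: (@lt_le_trans _ _ ((r + s)%:E * m ((W : set B3) `&` S))).
  by rewrite lte_pmul2r ?lte_fin// -?WS// ge0_fin_numE// (le_lt_trans (probability_le1 _ _)) ?ltry.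
rewrite -integral_cst//; apply: ge0_le_integral => //.
- move=> x _ /=; rewrite lee_fin ltW// (le_lt_trans _ rs)//.
  by rewrite -lee_fin -FE adde_ge0 ?menergy_ge0 ?integral_ge0.
- by apply: measurable_funTS.
- by move=> x [Wx' Sx']; have [h1 h2] := hW _ Wx'; rewrite EFinD leeD// ltW// h2.
Qed.

End equilibrium.

End frostman.

(** * Factorization of the averaged potential *)

Section averaged_potential.
Context {R : realType}.
Notation lam := (@lebesgue_measure R).
Local Notation V := 'rV[R]_3.
Local Notation B3 := (borelR3 R).
Local Notation L := (measurableTypeR R).
Local Notation u2pi := (uniform_prob (two_pi_gt0 : (0 : R) < 2 * pi)).
Implicit Types (x y z t w : R) (p : V) (m : probability B3 R).

(* The square root of a nonpositive number and the inverse of 0 are both 0, so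
   these vanish for z <= x and for |z| >= 1 respectively. *)
Definition kr z x : R := (Num.sqrt (z - x))^-1.
Definition wr z : R := (Num.sqrt (1 - z ^+ 2))^-1.

Lemma kr0 z x : z <= x -> kr z x = 0.
Proof. by move=> zx; rewrite /kr ler0_sqrtr ?subr_le0// invr0. Qed.

Lemma wr0 z : 1 <= z -> wr z = 0.
Proof. by move=> z1; rewrite /wr ler0_sqrtr ?invr0//; nra. Qed.

Lemma wrN z : z <= -1 -> wr z = 0.
Proof. by move=> z1; rewrite /wr ler0_sqrtr ?invr0//; nra. Qed.

Lemma kr_ge0 z x : 0 <= kr z x. Proof. by rewrite invr_ge0 sqrtr_ge0. Qed.
Lemma wr_ge0 z : 0 <= wr z. Proof. by rewrite invr_ge0 sqrtr_ge0. Qed.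

Lemma measurable_kr d (T : measurableType d) (f g : T -> R) :
  measurable_fun setT f -> measurable_fun setT g ->
  measurable_fun setT (fun u => kr (f u) (g u)).
Proof.
move=> mf mg; apply: (measurableT_comp measurable_invr).
by apply: measurable_sqrtr; apply: measurable_funB.
Qed.

Lemma measurable_wr d (T : measurableType d) (f : T -> R) :
  measurable_fun setT f -> measurable_fun setT (fun u => wr (f u)).
Proof.
move=> mf; apply: (measurableT_comp measurable_invr).
by apply: measurable_sqrtr; apply: measurable_funB => //; exact: measurable_funX.
Qed.

(** The integral copson over the whole line: the kernels kr vanish below max x
    y, and wr vanishes above 1. *)
Definition cop x y : \bar R := (\int[lam]_z (kr z x * kr z y * wr z)%:E)%E.

Lemma integral_restrict (f : R -> \bar R) (D : set R) : (forall z, ~ D z -> f z = 0%E) ->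
  (\int[lam]_z f z = \int[lam]_(z in D) f z)%E.
Proof.
move=> f0; rewrite [RHS]integral_mkcond; apply: eq_integral => z _.
by rewrite patchE; case: ifPn => //; rewrite notin_setE; exact: f0.
Qed.

Lemma copE x y : cop x y = copson x y.
Proof.
rewrite /cop (@integral_restrict _ `]Num.max x y, 1[); last first.
  move=> z /=; rewrite in_itv/= => /negP; rewrite negb_and -!leNgt le_max => /orP[/orP[h|h]|h].
  - by rewrite (kr0 h) !mul0r.
  - by rewrite (kr0 h) mulr0 mul0r.
  - by rewrite (wr0 h) mulr0.
apply: eq_integral => z _; congr (_%:E).
by rewrite /kr /wr !invfM mulrC mulrA.
Qed.

Lemma cop_ge0 x y : (0 <= cop x y)%E.
Proof. by apply: integral_ge0 => z _; rewrite lee_fin !mulr_ge0 ?kr_ge0 ?wr_ge0. Qed.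

Lemma avgE (h : B3 -> \bar R) x : measurable_fun setT h -> (forall p, (0 <= h p)%E) ->
  avg h x = (\int[u2pi]_t h (sphx t x))%E.
Proof.
move=> mh h0; rewrite integral_uniform ?subr0//.
by apply: measurableT_comp mh _; exact: measurable_sphxl.
Qed.

(** The kernel with pole p, averaged over the latitude x. *)
Definition avgk x p : \bar R := avg (fun p' => kern p' p) x.

Lemma measurable_kernr p : measurable_fun setT (fun p' : B3 => kern p' p).
Proof. by apply: measurable_kern; [exact: measurable_id|exact: measurable_cst]. Qed.

Lemma avgkE x p : avgk x p = (\int[u2pi]_t kern (sphx t x) p)%E.
Proof. by rewrite /avgk avgE//; [exact: measurable_kernr|move=> p'; exact: kern_ge0]. Qed.

Lemma avgk_ge0 x p : (0 <= avgk x p)%E.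
Proof. by rewrite avgkE; apply: integral_ge0 => t _; exact: kern_ge0. Qed.

(** The pole p lies on some circle of latitude and the average does not depend
    on its azimuth, so that Copson's formula for two circles applies. *)
Lemma avgk_cop x p : -1 <= x < 1 -> sphere2 p -> p 0 ord_max < 1 ->
  p 0 ord_max != x -> avgk x p = ((pi^-1)%:E * cop x (p 0 ord_max)%R)%E.
Proof.
move=> x1 Sp p1 px; rewrite /avgk /avg integral_circle_kern// copE muleA; congr (_ * _)%E.
by rewrite -EFinM invfM mulrAC mulVf ?mul1r.
Qed.

Lemma measurable_avgk : measurable_fun setT (fun q : L * B3 => avgk q.1 q.2).
Proof.
pose f (r : (L * B3) * L) := kern (sphx r.2 r.1.1) r.1.2.
have mf : measurable_fun setT f.
  apply: measurable_kern; last exact: measurableT_comp measurable_snd measurable_fst.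
  apply: (measurableT_comp (g := fun r : (L * B3) * L => (r.2, r.1.1) : L * L) measurable_sphx).
  apply: measurable_fun_pair; first exact: measurable_snd.
  exact: measurableT_comp measurable_fst measurable_fst.
have := @measurable_fun_fubini_tonelli_F _ _ _ _ _ u2pi f mf (fun r => kern_ge0 _ _).
by rewrite (_ : fubini_F _ _ = fun q : L * B3 => avgk q.1 q.2)//; apply/funext => q; rewrite avgkE.
Qed.

Lemma avg_potential m x : avg (potential m) x = (\int[m]_p avgk x p)%E.
Proof.
rewrite avgE; [|exact: measurable_potential|by move=> p; exact: potential_ge0].
under [RHS]eq_integral do rewrite avgkE.
apply: (fubini_tonelli (fun q : L * B3 => kern (sphx q.1 x) q.2)).
  apply: measurable_kern; last exact: measurable_snd.
  exact: measurableT_comp (measurable_sphxl x) measurable_fst.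
by move=> q; exact: kern_ge0.
Qed.

Lemma measurable_cop d (T : measurableType d) (f g : T -> R) :
  measurable_fun setT f -> measurable_fun setT g ->
  measurable_fun setT (fun u => cop (f u) (g u)).
Proof.
move=> mf mg; pose h (r : T * L) := (kr r.2 (f r.1) * kr r.2 (g r.1) * wr r.2)%:E.
have m2 : measurable_fun setT (fun r : T * L => r.2) by exact: measurable_snd.
have m1 : measurable_fun setT (fun r : T * L => r.1) by exact: measurable_fst.
have mh : measurable_fun setT h.
  apply/measurable_EFinP; apply: measurable_funM; last exact: measurable_wr.
  by apply: measurable_funM; apply: measurable_kr => //; [exact: measurableT_comp mf m1|exact: measurableT_comp mg m1].
have := @measurable_fun_fubini_tonelli_F _ _ _ _ _ lam h mh.
by apply => r; rewrite lee_fin !mulr_ge0 ?kr_ge0 ?wr_ge0.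
Qed.

Lemma ge0_integral_eq_off d (T : measurableType d) (n : {measure set T -> \bar R})
    (N : set T) (f g : T -> \bar R) : measurable N -> n N = 0%E ->
  measurable_fun setT f -> measurable_fun setT g ->
  (forall u, (0 <= f u)%E) -> (forall u, (0 <= g u)%E) ->
  (forall u, ~ N u -> f u = g u) -> (\int[n]_u f u = \int[n]_u g u)%E.
Proof.
move=> mN nN mf mg f0 g0 fg.
rewrite (@ge0_negligible_integral _ _ _ n setT N f)//.
rewrite (@ge0_negligible_integral _ _ _ n setT N g)//.
by apply: eq_integral => u; rewrite inE => -[_ /fg].
Qed.

Lemma measurable_level (a : R) : measurable ([set p : V | p 0 ord_max = a] : set B3).
Proof.
rewrite (_ : mkset _ = setT `&` (fun p : V => p 0 ord_max) @^-1` [set a]); last by rewrite setTI.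
by apply: (measurable_coord ord_max) => //; exact: measurable_set1.
Qed.

Section master.
Variables (m : probability B3 R) (W : L -> \bar R).
Hypotheses (sm : on_sphere m) (m1 : m [set p : V | p 0 ord_max = 1] = 0%E).
Hypotheses (mW : measurable_fun setT W) (W0 : forall x, (0 <= W x)%E).
Hypothesis W1 : forall x, ~~ (-1 <= x < 1) -> W x = 0%E.

(** The potential of the latitude law in the Abel kernel kr. *)
Definition Smean z : \bar R := (\int[m]_p (kr z ((p : V) 0 ord_max))%:E)%E.

Let A z : \bar R := (\int[lam]_x (W x * (kr z x)%:E))%E.

Let m3 : measurable_fun setT (fun p : B3 => (p : V) 0 ord_max).
Proof. exact: measurable_coord. Qed.

Local Open Scope ereal_scope.

Let mA : measurable_fun setT (A : L -> _).
Proof.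
pose f (r : L * L) := W r.2 * (kr r.1 r.2)%:E.
have mf : measurable_fun setT f.
  apply: emeasurable_funM; first exact: measurableT_comp mW measurable_snd.
  apply/measurable_EFinP; apply: measurable_kr; [exact: measurable_fst|exact: measurable_snd].
have := @measurable_fun_fubini_tonelli_F _ _ _ _ _ lam f mf.
by apply => r; rewrite mule_ge0// lee_fin kr_ge0.
Qed.

Let A0 z : 0 <= A z.
Proof. by apply: integral_ge0 => x _; rewrite mule_ge0// lee_fin kr_ge0. Qed.

Let integral_W_cop y :
  \int[lam]_x (W x * cop x y) = \int[lam]_z (A z * (kr z y * wr z)%:E).
Proof.
have mkw : measurable_fun setT (fun z : L => (kr z y * wr z)%:E).
  apply/measurable_EFinP; apply: measurable_funM; last exact: measurable_wr.
  by apply: measurable_kr => //; exact: measurable_cst.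
pose f (r : L * L) := W r.1 * (kr r.2 r.1 * kr r.2 y * wr r.2)%:E.
have f0 r : 0 <= f r by rewrite mule_ge0// lee_fin !mulr_ge0 ?kr_ge0 ?wr_ge0.
have mf : measurable_fun setT f.
  apply: emeasurable_funM; first exact: measurableT_comp mW measurable_fst.
  apply/measurable_EFinP; apply: measurable_funM; last by apply: measurable_wr; exact: measurable_snd.
  apply: measurable_funM; apply: measurable_kr; solve [exact: measurable_snd |
    exact: measurable_fst | exact: measurable_cst].
transitivity (\int[lam]_x \int[lam]_z f (x, z)).
  apply: eq_integral => x _; rewrite /f /cop -ge0_integralZl//=.
    apply/measurable_EFinP; apply: measurable_funM; last exact: measurable_wr.
    by apply: measurable_funM; apply: measurable_kr => //; exact: measurable_cst.
  by move=> z _; rewrite lee_fin !mulr_ge0 ?kr_ge0 ?wr_ge0.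
rewrite (fubini_tonelli f mf f0); apply: eq_integral => z _.
rewrite /A -ge0_integralZr//=.
- by apply: eq_integral => x _; rewrite /f/= -mulrA EFinM muleA.
- apply: emeasurable_funM => //; apply/measurable_EFinP; apply: measurable_kr => //.
- by move=> x _; rewrite mule_ge0// lee_fin kr_ge0.
- by rewrite lee_fin mulr_ge0 ?kr_ge0 ?wr_ge0.
Qed.

(** Since the averaged kernel is the integral over z of kr z x * kr z y * wr
    z, Tonelli separates the roles of the weight W (through A) and of the
    measure (through Smean). The heights where avgk_cop fails form a null set
    for each p. *)
Lemma integral_avg_potential : \int[lam]_x (W x * avg (potential m) x) =
  (pi^-1)%:E * \int[lam]_z (A z * Smean z * (wr z)%:E).
Proof.
have ipi0 : (0 <= pi^-1 :> R)%R by rewrite invr_ge0 pi_ge0.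
pose f (r : L * B3) := W r.1 * avgk r.1 r.2.
have f0 r : 0 <= f r by rewrite mule_ge0// avgk_ge0.
have mf : measurable_fun setT f.
  apply: emeasurable_funM; first exact: measurableT_comp mW measurable_fst.
  exact: measurable_avgk.
pose g (r : L * B3) := W r.1 * ((pi^-1)%:E * cop r.1 ((r.2 : V) 0 ord_max)%R).
have g0 r : 0 <= g r by rewrite !mule_ge0// cop_ge0.
have mg : measurable_fun setT g.
  apply: emeasurable_funM; first exact: measurableT_comp mW measurable_fst.
  apply: measurable_funeM.
  apply: measurable_cop; first exact: measurable_fst.
  exact: measurableT_comp m3 measurable_snd.
transitivity (\int[lam]_x \int[m]_p f (x, p)).
  apply: eq_integral => x _; rewrite avg_potential /f -ge0_integralZl//.
  - exact: measurableT_comp measurable_avgk (measurable_pair1 _).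
  - by move=> p _; exact: avgk_ge0.
rewrite (fubini_tonelli f mf f0).
have mS := @measurable_sphere2 R.
have mP1 := measurable_level (1 : R)%R.
transitivity (\int[m]_p \int[lam]_x g (x, p)).
  apply: (@ge0_integral_eq_off _ _ m (~` (@sphere2 R : set B3) `|` [set p : V | p 0 ord_max = 1]%R)).
  - by apply: measurableU => //; exact: measurableC.
  - apply/eqP; rewrite eq_le measure_ge0 andbT.
    apply: le_trans (measureU2 m _ _) _ => //; first exact: measurableC.
    have e : m (~` (@sphere2 R : set B3)) + m [set p : V | p 0 ord_max = 1]%R = 0.
      by rewrite (on_sphereC sm) m1 adde0.
    by move/eqP: e; rewrite eq_le => /andP[h _]; exact: h.
  - exact: measurable_fun_fubini_tonelli_G mf f0.
  - exact: measurable_fun_fubini_tonelli_G mg g0.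
  - by move=> p; apply: integral_ge0.
  - by move=> p; apply: integral_ge0.
  - move=> p /not_orP[/contrapT Sp /eqP p1].
    apply: (@ge0_integral_eq_off _ _ lam [set p 0 ord_max]%R) => //.
    + exact: lebesgue_measure_set1.
    + exact: measurableT_comp mf (measurable_pair2 _).
    + exact: measurableT_comp mg (measurable_pair2 _).
    + move=> x /eqP px; rewrite /f /g/=.
      have [x1|/W1->] := boolP (-1 <= x < 1)%R; last by rewrite !mul0e.
      congr (_ * _); apply: avgk_cop => //; last by rewrite eq_sym.
      rewrite lt_neqAle p1/=.
      by have := sphere2_coord ord_max Sp; rewrite ler_norml => /andP[].
pose h (r : B3 * L) := A r.2 * (kr r.2 ((r.1 : V) 0 ord_max) * wr r.2)%:E.
have h0 r : 0 <= h r by rewrite mule_ge0// lee_fin mulr_ge0 ?kr_ge0 ?wr_ge0.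
have mh : measurable_fun setT h.
  apply: emeasurable_funM; first exact: measurableT_comp mA measurable_snd.
  apply/measurable_EFinP; apply: measurable_funM; last by apply: measurable_wr; exact: measurable_snd.
  apply: measurable_kr; first exact: measurable_snd.
  exact: measurableT_comp m3 measurable_fst.
transitivity (\int[m]_p ((pi^-1)%:E * \int[lam]_z h (p, z))).
  apply: eq_integral => p _; rewrite /h/= -integral_W_cop -ge0_integralZl//.
  - by apply: eq_integral => x _; rewrite /g/= muleCA.
  - apply: emeasurable_funM => //.
    by apply: measurable_cop => //; exact: measurable_cst.
  - by move=> x _; rewrite mule_ge0// cop_ge0.
rewrite ge0_integralZl//; last 2 first.
- exact: measurable_fun_fubini_tonelli_F mh h0.
- by move=> p _; exact: integral_ge0.
congr (_ * _); rewrite (fubini_tonelli h mh h0); apply: eq_integral => z _.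
have mk : measurable_fun setT (fun p : B3 => kr z ((p : V) 0 ord_max)%R).
  by apply: measurable_kr => //; exact: measurable_cst.
rewrite -muleA /h /Smean; move: (A z) (A0 z) => a a0.
transitivity (a * \int[m]_p ((kr z ((p : V) 0 ord_max)%R)%:E * (wr z)%:E)).
  rewrite -ge0_integralZl//.
  - by apply: emeasurable_funM => //; exact/measurable_EFinP.
  - by move=> p _; rewrite mule_ge0// lee_fin ?kr_ge0 ?wr_ge0.
congr (_ * _); rewrite ge0_integralZr ?lee_fin ?wr_ge0//; first exact/measurable_EFinP.
by move=> p _; rewrite lee_fin kr_ge0.
Qed.

End master.

End averaged_potential.

(** * The two Abel transforms of the averaged potential *)

Section abel_steps.
Context {R : realType}.
Notation lam := (@lebesgue_measure R).
Local Notation V := 'rV[R]_3.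
Local Notation B3 := (borelR3 R).
Local Notation L := (measurableTypeR R).
Implicit Types (x y z t w a b : R) (p : V) (m : probability B3 R) (n : probability L R).

Lemma avg_cst (h : B3 -> \bar R) x k : (forall t, h (sphx t x) = k) -> avg h x = k.
Proof.
move=> hk; rewrite /avg; under eq_integral do rewrite hk.
rewrite integral_cst//= lebesgue_measure_itv/= lte_fin two_pi_gt0 oppr0 adde0.
by rewrite muleC -muleA -EFinM mulfV ?mule1// gt_eqF// two_pi_gt0.
Qed.

Lemma avg_ge0 (h : B3 -> \bar R) x : (forall p, (0 <= h p)%E) -> (0 <= avg h x)%E.
Proof.
move=> h0; rewrite /avg mule_ge0 ?lee_fin ?invr_ge0//; first by rewrite mulr_ge0// pi_ge0.
exact: integral_ge0.
Qed.

Lemma integral_setT_patch (f : R -> \bar R) (D : set R) :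
  (\int[lam]_x ((\1_D x)%:E * f x) = \int[lam]_(x in D) f x)%E.
Proof.
rewrite [RHS]integral_mkcond; apply: eq_integral => x _.
by rewrite patchE indicE; case: ifP => _; rewrite ?mul1e ?mul0e.
Qed.

(** The azimuth is integrated out. *)
Lemma zon_latitude n (B : set L) : measurable B ->
  zon n [set p : V | B (p 0 ord_max)] = n B.
Proof.
move=> mB; have mP : measurable ([set p : V | B (p 0 ord_max)] : set B3).
  rewrite (_ : mkset _ = setT `&` (fun p : V => p 0 ord_max) @^-1` B); last by rewrite setTI.
  exact: (measurable_coord ord_max).
transitivity (\int[zon n]_p (\1_[set p : V | B (p 0 ord_max)] (p : V))%:E)%E.
  by rewrite integral_indic ?setIT.
rewrite integral_zon; last 2 first.
- by apply/measurable_EFinP; exact: measurable_indic.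
- by move=> p; rewrite lee_fin.
transitivity (\int[n]_x (\1_B x)%:E)%E; last by rewrite integral_indic ?setIT.
apply: eq_integral => x _; apply: avg_cst => t; rewrite !indicE; congr (_%:R%:E).
by congr nat_of_bool; apply/idP/idP; rewrite !inE/= sphx2.
Qed.

Lemma on_sphere_zon n : n (~` [set` `[(-1), 1]]) = 0%E -> on_sphere (zon n).
Proof.
move=> n0; apply: on_sphereP; have mS := @measurable_sphere2 R.
transitivity (\int[zon n]_p (\1_(~` (@sphere2 R)) (p : V))%:E)%E.
  by rewrite integral_indic ?setIT//; exact: measurableC.
have mi : measurable_fun setT (fun p : B3 => (\1_(~` (@sphere2 R : set B3)) p)%:E : \bar R).
  by apply/measurable_EFinP; apply: measurable_indic; exact: measurableC.
rewrite integral_zon//.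
transitivity (\int[n]_(x in (setT : set L)) (cst 0%E x : \bar R))%E; last by rewrite integral0.
apply: (@ge0_integral_eq_off R _ _ n (~` [set` `[(-1), 1]])) => //.
- exact: measurableC.
- by apply: measurable_avg => // p; rewrite lee_fin.
- by move=> x; apply: avg_ge0 => p; rewrite lee_fin.
- move=> x /contrapT /=; rewrite in_itv/= => x1; apply: avg_cst => t.
  by rewrite indicE memNset//= => /(_ (sphx_sphere t x1)).
Qed.

Lemma integral_wr : (\int[lam]_z (wr z)%:E = (pi%:E : \bar R))%E.
Proof.
rewrite (@integral_restrict _ _ `]-1, 1[); last first.
  move=> z /=; rewrite in_itv/= => /negP; rewrite negb_and -!leNgt => /orP[h|h].
    by rewrite wrN.
  by rewrite wr0.
rewrite -(@integral_beta _ (-1) 1)//; apply: eq_integral => z; rewrite inE/= in_itv/= => /andP[z1 z2].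
rewrite /wr -sqrtrM; last by rewrite opprK; lra.
by congr ((Num.sqrt _)^-1%:E); ring.
Qed.

Lemma integral_kr_itv a b z : -1 <= a -> z <= 1 ->
  (\int[lam]_(x in `[a, b]) (kr z x)%:E <= (4%:E : \bar R))%E.
Proof.
move=> a1 z1; have [z0|z0] := leP z (-1).
  rewrite integral0_eq ?lee_fin// => x; rewrite /= in_itv/= => /andP[ax _].
  by rewrite kr0//; lra.
have mk : measurable_fun setT (fun x : L => (kr z x)%:E : \bar R).
  by apply/measurable_EFinP; apply: measurable_kr => //; exact: measurable_cst.
rewrite -integral_setT_patch.
apply: (@le_trans _ _ (\int[lam]_(x in [set` `[(-1)%R, z[]) (kr z x)%:E)%E).
  rewrite -[leRHS]integral_setT_patch; apply: ge0_le_integral => //.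
  - by move=> x _; rewrite -EFinM lee_fin mulr_ge0 ?kr_ge0.
  - by apply: emeasurable_funM => //; apply/measurable_EFinP; exact: measurable_indic.
  - by apply: emeasurable_funM => //; apply/measurable_EFinP; exact: measurable_indic.
  - move=> x _; rewrite -!EFinM lee_fin !indicE.
    have [zx|xz] := leP z x; first by rewrite kr0// !mulr0.
    rewrite ler_wpM2r ?kr_ge0//.
    case: (boolP (x \in `[a, b]%classic)); rewrite ?ler0n// inE/= in_itv/= => /andP[ax _].
    by rewrite mem_set//= in_itv/= xz andbT; lra.
rewrite integral_itv_bndoo; last exact: measurable_funTS.
rewrite (integral_inv_sqrtr z0) lee_fin.
have : Num.sqrt (z - -1) <= 2.
  by rewrite -[leRHS]ger0_norm// -sqrtr_sqr ler_sqrt; nra.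
lra.
Qed.

Lemma measurable_indic_itv a b :
  measurable_fun setT (fun x : L => (\1_(`[a, b[%classic) x)%:E : \bar R).
Proof. by apply/measurable_EFinP; exact: measurable_indic. Qed.

Lemma Smean_ge0 m z : (0 <= Smean m z)%E.
Proof. by apply: integral_ge0 => p _; rewrite lee_fin kr_ge0. Qed.

Lemma measurable_Smean m : measurable_fun setT (Smean m : L -> \bar R).
Proof.
pose f (r : L * B3) := (kr r.1 ((r.2 : V) 0 ord_max))%:E.
have mf : measurable_fun setT f.
  apply/measurable_EFinP; apply: measurable_kr; first exact: measurable_fst.
  exact: measurableT_comp (measurable_coord ord_max) measurable_snd.
have := @measurable_fun_fubini_tonelli_F _ _ _ _ _ m f mf.
by apply => r; rewrite lee_fin kr_ge0.
Qed.

Lemma measurable_integral_kr (W : L -> \bar R) : measurable_fun setT W ->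
  (forall x, (0 <= W x)%E) ->
  measurable_fun setT ((fun z => \int[lam]_x (W x * (kr z x)%:E))%E : L -> \bar R).
Proof.
move=> mW W0; pose f (r : L * L) := (W r.2 * (kr r.1 r.2)%:E)%E.
have mf : measurable_fun setT f.
  apply: emeasurable_funM; first exact: measurableT_comp mW measurable_snd.
  apply/measurable_EFinP; apply: measurable_kr; [exact: measurable_fst|exact: measurable_snd].
have := @measurable_fun_fubini_tonelli_F _ _ _ _ _ lam f mf.
by apply => r; rewrite mule_ge0// lee_fin kr_ge0.
Qed.

Lemma uniform_probE a b (ab : a < b) (A : set L) :
  uniform_prob ab A = (\int[lam]_(x in A) (uniform_pdf a b x)%:E)%E.
Proof. by []. Qed.

Section competitor.
Variables (a b : R) (ab : a < b).
Hypotheses (a1 : -1 <= a) (b1 : b <= 1).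

(** The uniform distribution on a zone; with a = -1 and b = 1 it is the
    normalized surface measure. *)
Definition zunif : probability B3 R := zon (uniform_prob ab).

Lemma integral_zunif (h : B3 -> \bar R) : measurable_fun setT h -> (forall p, (0 <= h p)%E) ->
  (\int[zunif]_p h p = ((b - a)^-1)%:E * \int[lam]_(x in `[a, b]) avg h x)%E.
Proof.
move=> mh h0; rewrite /zunif integral_zon// integral_uniform//; first exact: measurable_avg.
by move=> x; exact: avg_ge0.
Qed.

Lemma on_sphere_zunif : on_sphere zunif.
Proof.
apply: on_sphere_zon.
apply: (etrans (uniform_probE ab _)).
rewrite integral_uniform_pdf (_ : _ `&` _ = set0) ?integral_set0//.
have := a1; have := b1 => b1' a1'.
by apply/seteqP; split=> // x [/=]; rewrite !in_itv/= => h /andP[h1 h2]; apply: h; lra.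
Qed.

Lemma zunif_pole : zunif [set p : V | p 0 ord_max = 1] = 0%E.
Proof.
rewrite (zon_latitude (uniform_prob ab) (measurable_set1 (1 : R))).
by apply: (etrans (uniform_probE ab _)); exact: integral_set1.
Qed.

(** Both Abel potentials of a uniform law are bounded and the remaining weight
    wr has integral pi. *)
Lemma menergy_zunif : (menergy zunif zunif < +oo)%E.
Proof.
have ba0 : 0 <= (b - a)^-1 by rewrite invr_ge0 subr_ge0 ltW.
have mU := @measurable_potential R; have U0 := @potential_ge0 R.
have mavg : measurable_fun setT (avg (potential zunif) : L -> _) by exact: measurable_avg.
rewrite /menergy integral_zunif//.
rewrite lte_mul_pinfty ?lee_fin// -integral_itv_bndo_bndc; last exact: measurable_funTS.
pose W (x : L) : \bar R := (\1_(`[a, b[%classic) x)%:E.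
rewrite -integral_setT_patch (@integral_avg_potential _ zunif W on_sphere_zunif zunif_pole); last 3 first.
- by apply/measurable_EFinP; exact: measurable_indic.
- by move=> x; rewrite lee_fin.
- move=> x h; rewrite /W indicE memNset//= in_itv/= => /andP[h1 h2].
  have := a1; have := b1; move: h; rewrite negb_and -ltNge -leNgt => /orP[]; lra.
rewrite lte_mul_pinfty ?lee_fin ?invr_ge0 ?pi_ge0//.
set A := fun z => (\int[lam]_x (W x * (kr z x)%:E))%E.
have A4 z : z <= 1 -> (A z <= 4%:E)%E.
  move=> z1; rewrite /A integral_setT_patch integral_itv_bndo_bndc.
    exact: integral_kr_itv.
  by apply: measurable_funTS; apply/measurable_EFinP; apply: measurable_kr => //; exact: measurable_cst.
have S4 z : z <= 1 -> (Smean zunif z <= ((b - a)^-1 * 4)%:E)%E.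
  move=> z1; rewrite /Smean integral_zunif//; last 2 first.
  - apply/measurable_EFinP; apply: measurable_kr; first exact: measurable_cst.
    exact: measurable_coord.
  - by move=> p; rewrite lee_fin kr_ge0.
  rewrite EFinM lee_wpmul2l ?lee_fin//.
  rewrite [leLHS](_ : _ = \int[lam]_(x in `[a, b]) (kr z x)%:E)%E; first exact: integral_kr_itv.
  by apply: eq_integral => x _; apply: avg_cst => t; rewrite sphx2.
apply: (@le_lt_trans _ _ (\int[lam]_z ((4 * ((b - a)^-1 * 4))%:E * (wr z)%:E))%E).
  have mwr : measurable_fun setT (fun z : L => (wr z)%:E : \bar R).
    by apply/measurable_EFinP; exact: measurable_wr.
  have W0 x : (0 <= W x)%E by rewrite lee_fin.
  have A_ge0 z : (0 <= A z)%E by apply: integral_ge0 => x _; rewrite mule_ge0 ?lee_fin ?kr_ge0.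
  have mA : measurable_fun setT (A : L -> \bar R) := measurable_integral_kr (measurable_indic_itv a b) W0.
  have mS := @measurable_Smean zunif.
  apply: ge0_le_integral => //.
  - by move=> z _; rewrite !mule_ge0 ?lee_fin ?wr_ge0 ?Smean_ge0 ?A_ge0.
  - by do !apply: emeasurable_funM.
  - by apply: measurable_funeM.
  - move=> z _; have [z1|z1] := lerP (z : R) 1; last by rewrite (wr0 (ltW z1)) !mule0.
    rewrite lee_wpmul2r ?lee_fin ?wr_ge0// EFinM; apply: lee_pmul => //; solve [exact: A_ge0|exact: Smean_ge0|exact: A4|exact: S4].
rewrite ge0_integralZl//=; last 3 first.
- by apply/measurable_EFinP; exact: measurable_wr.
- by move=> z _; rewrite lee_fin wr_ge0.
- by rewrite lee_fin !mulr_ge0.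
by rewrite integral_wr -EFinM ltry.
Qed.

End competitor.

Section abel.
Variables (m : probability B3 R).
Hypotheses (sm : on_sphere m) (m1 : m [set p : V | p 0 ord_max = 1] = 0%E).

(** The Abel transform over the heights above w turns the inner Abel kernel
    into the constant pi, by Euler's beta integral. *)
Lemma abel_avg_potential w : -1 <= w < 1 ->
  (\int[lam]_(x in `]w, 1%R[) (avg (potential m) x * ((Num.sqrt (x - w))^-1)%:E) =
   \int[lam]_(z in `]w, 1%R[) (Smean m z * (wr z)%:E))%E.
Proof.
move=> /andP[wm w1].
pose W (x : L) : \bar R := ((\1_(`]w, 1[%classic) x) * kr x w)%:E.
have mW : measurable_fun setT W.
  apply/measurable_EFinP; apply: measurable_funM; first exact: measurable_indic.
  by apply: measurable_kr => //; exact: measurable_cst.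
have W0 x : (0 <= W x)%E by rewrite lee_fin mulr_ge0 ?kr_ge0.
have W1 x : ~~ (-1 <= x < 1) -> W x = 0%E.
  move=> h; rewrite /W indicE memNset ?mul0r//= in_itv/= => /andP[h1 h2].
  move: h; rewrite negb_and -ltNge -leNgt => /orP[]; lra.
transitivity (\int[lam]_x (W x * avg (potential m) x))%E.
  rewrite -integral_setT_patch; apply: eq_integral => x _.
  by rewrite /W EFinM muleA [RHS]muleAC.
rewrite (@integral_avg_potential _ m W sm m1 mW W0 W1).
have AE z : z < 1 -> (\int[lam]_x (W x * (kr z x)%:E) =
    pi%:E * (\1_(`]w, 1[%classic) z)%:E)%E.
  move=> z1; transitivity (\int[lam]_(x in `]w, z[) (kr x w * kr z x)%:E)%E.
    rewrite -[RHS]integral_setT_patch; apply: eq_integral => x _.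
    rewrite /W -!EFinM; congr (_%:E); rewrite !indicE -mulrA.
    have [zx|xz] := leP z x; first by rewrite (kr0 zx) !mulr0.
    congr (_%:R * _); congr nat_of_bool; apply/idP/idP; rewrite !inE/= !in_itv/= => /andP[h1 h2]; lra.
  rewrite indicE; case: (boolP (z \in `]w, 1[%classic)) => [|/negP]; rewrite inE/= in_itv/= => h.
    rewrite mule1 -(@integral_beta _ w z); last by case/andP: h.
    by apply: eq_integral => x _; rewrite invfM.
  by rewrite mule0 set_itv_ge ?integral_set0// bnd_simp -leNgt leNgt; apply/negP => h'; apply: h; lra.
have mSw : measurable_fun setT (fun z : L => Smean m z * (wr z)%:E)%E.
  apply: emeasurable_funM; first exact: measurable_Smean.
  by apply/measurable_EFinP; exact: measurable_wr.
have Sw0 z : (0 <= Smean m z * (wr z)%:E)%E by rewrite mule_ge0 ?Smean_ge0 ?lee_fin ?wr_ge0.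
transitivity ((pi^-1)%:E * \int[lam]_z (pi%:E * ((\1_(`]w, 1[%classic) z)%:E * (Smean m z * (wr z)%:E))))%E.
  congr (_ * _)%E; apply: eq_integral => z _.
  have [z1|z1] := ltP z 1; last by rewrite wr0// !mule0.
  by rewrite AE// !muleA.
rewrite ge0_integralZl//; last 3 first.
- by apply: emeasurable_funM => //; apply/measurable_EFinP; exact: measurable_indic.
- by move=> z _; rewrite mule_ge0 ?lee_fin.
- by rewrite lee_fin pi_ge0.
by rewrite muleA -EFinM mulVf ?gt_eqF ?pi_gt0// mul1e integral_setT_patch.
Qed.

(** The second Abel transform, from the other side, again produces the
    constant pi and leaves the distribution function of the height. *)
Lemma abel_Smean c y : m [set p : V | p 0 ord_max < c] = 0%E ->
  (\int[lam]_(z in `]c, y[) (Smean m z * ((Num.sqrt (y - z))^-1)%:E) =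
   pi%:E * m [set p : V | (p 0 ord_max < y)%R])%E.
Proof.
move=> mc.
have mlt a : measurable ([set p : V | p 0 ord_max < a] : set B3).
  rewrite (_ : mkset _ = setT `&` (fun p : V => p 0 ord_max) @^-1` `]-oo, a[).
    by apply: (measurable_coord ord_max) => //; exact: measurable_itv.
  by rewrite setTI; apply/seteqP; split=> p; rewrite /= in_itv.
rewrite -integral_setT_patch.
pose h (r : L * B3) : \bar R := (\1_(`]c, y[%classic) r.1 * (kr r.1 ((r.2 : V) 0 ord_max) * kr y r.1))%:E.
have h0 r : (0 <= h r)%E by rewrite lee_fin !mulr_ge0 ?kr_ge0.
have m1' : measurable_fun setT (fun r : L * B3 => r.1) by exact: measurable_fst.
have m2' : measurable_fun setT (fun r : L * B3 => (r.2 : V) 0 ord_max).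
  exact: measurableT_comp (measurable_coord ord_max) measurable_snd.
have mh : measurable_fun setT h.
  apply/measurable_EFinP; apply: measurable_funM.
    by apply: measurableT_comp m1'; exact: measurable_indic.
  by apply: measurable_funM; apply: measurable_kr => //; exact: measurable_cst.
transitivity (\int[lam]_z \int[m]_p h (z, p))%E.
  apply: eq_integral => z _; rewrite /h/= /Smean.
  have mk : measurable_fun setT (fun p : B3 => (kr z ((p : V) 0 ord_max))%:E : \bar R).
    by apply/measurable_EFinP; apply: measurable_kr; [exact: measurable_cst|exact: measurable_coord].
  transitivity ((\1_(`]c, y[%classic) z * kr y z)%:E * \int[m]_p (kr z ((p : V) 0 ord_max)%R)%:E)%E.
    by rewrite EFinM -muleA; congr (_ * _)%E; exact: muleC.
  rewrite -ge0_integralZl//.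
  - by apply: eq_integral => p _; rewrite -EFinM; congr (_%:E); ring.
  - by move=> p _; rewrite lee_fin kr_ge0.
  - by rewrite lee_fin mulr_ge0 ?kr_ge0.
rewrite (fubini_tonelli h mh h0).
transitivity (\int[m]_p (pi%:E * (\1_[set p : V | p 0 ord_max < y]%R (p : V))%:E))%E; last first.
  rewrite ge0_integralZl ?lee_fin ?pi_ge0//.
    by rewrite integral_indic ?setIT.
  by apply/measurable_EFinP; exact: measurable_indic.
apply: (@ge0_integral_eq_off R _ _ m [set p : V | p 0 ord_max < c]) => //.
- exact: measurable_fun_fubini_tonelli_G mh h0.
- by apply: measurable_funeM; apply/measurable_EFinP; exact: measurable_indic.
- by move=> p; apply: integral_ge0.
- by move=> p; rewrite mule_ge0 ?lee_fin ?pi_ge0.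
move=> p /= /negP; rewrite -leNgt => cp; rewrite indicE.
transitivity (\int[lam]_(z in `]((p : V) 0 ord_max)%R, y[) (kr z ((p : V) 0 ord_max)%R * kr y z)%:E)%E.
  rewrite -[RHS]integral_setT_patch; apply: eq_integral => z _.
  rewrite /h/= -EFinM; congr (_%:E); rewrite !indicE.
  have [zx|xz] := leP z ((p : V) 0 ord_max); first by rewrite (kr0 zx) !(mul0r, mulr0).
  congr (_%:R * _); congr nat_of_bool; apply/idP/idP; rewrite !inE/= !in_itv/= => /andP[h1 h2]; lra.
case: (boolP (p \in _)) => [|/negP]; rewrite inE/= => py.
  by rewrite mule1 -(integral_beta py); apply: eq_integral => z _; rewrite invfM.
by rewrite mule0 set_itv_ge ?integral_set0// bnd_simp; apply/negP.
Qed.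

End abel.

End abel_steps.

(** * Inversion of the two Abel transforms *)

Section finite_pack.
Context d (T : measurableType d) (R : realType) (m : {measure set T -> \bar R}).
Hypothesis mT : (m setT < +oo)%E.

Let fin_m : fin_num_fun m.
Proof.
move=> A mA; rewrite ge0_fin_numE//; apply: le_lt_trans mT.
by apply: le_measure; rewrite ?inE.
Qed.

Definition fmeas (mT' : (m setT < +oo)%E) : set T -> \bar R := m.

HB.instance Definition _ := Measure.on (fmeas mT).
HB.instance Definition _ := @Measure_isFinite.Build d T R (fmeas mT) fin_m.
End finite_pack.

Lemma ge0_integrable_oo {R : realType} (a b : R) (f : R -> R) :
  (forall x, a < x < b -> {for x, continuous f}) ->
  (forall x, a < x < b -> 0 <= f x) ->
  (\int[@lebesgue_measure R]_(x in `]a, b[) (f x)%:E < +oo)%E ->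
  (@lebesgue_measure R).-integrable `]a, b[ (EFin \o f).
Proof.
move=> cf f0 foo; apply/integrableP; split.
  by apply/measurable_EFinP; exact: measurable_fun_oo.
apply: le_lt_trans foo; rewrite le_eqVlt; apply/orP; left; apply/eqP.
apply: eq_integral => x; rewrite inE/= in_itv/= => xab.
by rewrite ger0_norm ?f0.
Qed.

Section abel_inversion.
Context {R : realType}.
Notation lam := (@lebesgue_measure R).
Local Notation L := (measurableTypeR R).
Implicit Types (x y z t w a b : R).
Variables (c F : R) (qh : R -> R) (Sz : L -> \bar R) (M : R -> R).
Hypotheses (c1 : -1 <= c) (c2 : c < 1) (F0 : 0 <= F).
Hypotheses (hq : C1 c 1 qh) (hq' : C1 c 1 (derive1 qh)).
Hypothesis qb : forall x, c < x < 1 -> 0 <= qh x <= F.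
Hypotheses (mS : measurable_fun setT Sz) (S0 : forall z, (0 <= Sz z)%E).
Hypothesis T1 : forall w, c < w < 1 ->
  (\int[lam]_(z in `]w, 1%R[) (Sz z * (wr z)%:E) =
   \int[lam]_(x in `]w, 1%R[) ((F - qh x) / Num.sqrt (x - w))%:E)%E.
Hypothesis T2 : forall y, c < y <= 1 ->
  (\int[lam]_(z in `]c, y[) (Sz z * ((Num.sqrt (y - z))^-1)%:E) = (pi * M y)%:E)%E.

Let cq x : c < x < 1 -> {for x, continuous qh}.
Proof. exact: C1_continuous hq. Qed.

Let iq d : c < d < 1 -> lam.-integrable `]d, 1[ (EFin \o qh).
Proof.
move=> /andP[cd d1]; apply: measurable_bounded_integrable => //=.
- by rewrite lebesgue_measure_itv/= lte_fin d1 -EFinD ltry.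
- by apply: measurable_fun_oo => x xd; apply: cq; lra.
- exists F; split; first exact: num_real.
  move=> y Fy x /=; rewrite in_itv/= => xd; rewrite ger0_norm.
    by apply: le_trans (ltW Fy); have /andP[] : 0 <= qh x <= F by apply: qb; lra.
  by have /andP[] : 0 <= qh x <= F by apply: qb; lra.
Qed.

Let G := Abel qh 1.

Lemma C1_G : C1 c 1 G.
Proof. by apply: Abel_C1. Qed.

Lemma C1_derive1_G : C1 c 1 (derive1 G).
Proof. by apply: Abel_C2. Qed.

Lemma integrable_Abel_qh w : c < w < 1 ->
  lam.-integrable `]w, 1[ (EFin \o (fun x => qh x / Num.sqrt (x - w))).
Proof.
move=> /andP[cw w1]; pose d := (w + 1) / 2.
have wd : w < d by rewrite /d; lra.
have d1 : d < 1 by rewrite /d; lra.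
apply: (integrable_oo_split wd d1).
  exact: (integrable_Abel_near cq).
by apply: integrable_Abel_far => //; apply: iq; lra.
Qed.

Let Phi w := 2 * F * Num.sqrt (1 - w) - G w.
Let psi w := F / Num.sqrt (1 - w) + derive1 G w.

(** This gives the tails of the measure Sz z * wr z dz explicitly, as a
    primitive of the continuous function - psi. *)
Lemma tail_S w : c < w < 1 -> (\int[lam]_(z in `]w, 1%R[) (Sz z * (wr z)%:E) = (Phi w)%:E)%E.
Proof.
move=> cw; rewrite T1//; have /andP[cw' w1] := cw.
under eq_integral do rewrite mulrBl.
have iF : (\int[lam]_(x in `]w, 1%R[) (F / Num.sqrt (x - w))%:E = (2 * F * Num.sqrt (1 - w))%:E)%E.
  under eq_integral do rewrite EFinM.
  rewrite ge0_integralZl//; last first.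
    apply/measurable_EFinP; apply: measurable_fun_oo => x xw; apply: cvgV.
      by rewrite gt_eqF// sqrtr_gt0; lra.
    exact: continuous_sqrtBl.
  by rewrite integral_inv_sqrtl// -EFinM; congr (_%:E); ring.
have i1 : lam.-integrable `]w, 1[ (EFin \o (fun x => F / Num.sqrt (x - w))).
  apply: ge0_integrable_oo => [x xw|x xw|].
  - apply: cvgM; first exact: cvg_cst.
    apply: cvgV; last exact: continuous_sqrtBl.
    by rewrite gt_eqF// sqrtr_gt0; lra.
  - by have := F0 => F0'; rewrite divr_ge0 ?sqrtr_ge0.
  by rewrite iF ltry.
rewrite integralB_EFin//; last exact: integrable_Abel_qh.
rewrite /Phi EFinB; congr (_ - _)%E.
  exact: iF.
rewrite /G /Abel /Rintegral fineK//.
exact: integrable_fin_num (integrable_Abel_qh cw).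
Qed.

Let sig (z : L) : \bar R := ((\1_(`]c, 1[%classic) z)%:E * (Sz z * (wr z)%:E))%E.

Let msig : measurable_fun setT sig.
Proof.
apply: emeasurable_funM; first by apply/measurable_EFinP; exact: measurable_indic.
by apply: emeasurable_funM => //; apply/measurable_EFinP; exact: measurable_wr.
Qed.

Let sig0 z : (0 <= sig z)%E.
Proof. by rewrite !mule_ge0 ?lee_fin ?wr_ge0. Qed.

Let n : {measure set L -> \bar R} := dens lam msig sig0.

Let nE (A : set L) : measurable A -> A `<=` `]c, 1[ ->
  n A = (\int[lam]_(z in A) (Sz z * (wr z)%:E))%E.
Proof.
move=> mA Ac; apply: eq_integral => z; rewrite inE => /Ac zc.
by rewrite /sig indicE mem_set// mul1e.
Qed.

Let nT : (n setT < +oo)%E.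
Proof.
have -> : n setT = (\int[lam]_(z in `]c, 1%R[) (Sz z * (wr z)%:E))%E.
  exact: integral_setT_patch.
have h0 z : (0 <= Sz z * (wr z)%:E)%E by rewrite mule_ge0 ?lee_fin ?wr_ge0.
have mh : measurable_fun setT (fun z : L => Sz z * (wr z)%:E)%E.
  by apply: emeasurable_funM => //; apply/measurable_EFinP; exact: measurable_wr.
apply: (@le_lt_trans _ _ (2 * F * 2)%:E); last exact: ltry.
have cvg := ge0_integral_oo_cvg c2 (measurable_funTS mh) (fun x _ => h0 x).
apply: (closed_cvg _ (@closed_ereal_ge_ereal _ _) _ _ cvg).
apply: nearW => k /=; set e := inset c 1 k.
have e0 : 0 < e by exact: inset_gt0.
have e1 := inset_lt k c2.
have cw : c < c + e / 2 < 1 by rewrite /e in e0 e1 *; lra.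
apply: (@le_trans _ _ (\int[lam]_(z in `](c + e / 2)%R, 1%R[) (Sz z * (wr z)%:E))%E).
  apply: ge0_subset_integral => //; first exact: measurable_funTS.
  by move=> x /=; rewrite !in_itv/= => /andP[h1 h2]; rewrite /e in e0 e1 h1 h2 *; lra.
rewrite tail_S// lee_fin /Phi.
have G0 : 0 <= G (c + e / 2).
  rewrite /G /Abel; apply: Rintegral_ge0 => x /=; rewrite in_itv/= => xc.
  rewrite divr_ge0 ?sqrtr_ge0//.
  by have /andP[] : 0 <= qh x <= F by apply: qb; lra.
have : Num.sqrt (1 - (c + e / 2)) <= 2.
  rewrite -[leRHS]ger0_norm// -sqrtr_sqr ler_sqrt; last by rewrite exprn_ge0.
  by have := c1; lra.
by have := F0; nra.
Qed.

Let nf : {finite_measure set L -> \bar R} := fmeas nT.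

Let nf_itv : nf (~` [set` `]c, 1[]) = 0%E.
Proof.
rewrite -[RHS](@integral0 _ _ _ lam (~` [set` `]c, 1[])).
by apply: eq_integral => z; rewrite inE => zc; rewrite /sig indicE memNset// mul0e.
Qed.

Let nf_tail t : c < t < 1 -> nf [set` `]t, 1[] = (Phi t)%:E.
Proof.
move=> tc; rewrite -tail_S//; apply: nE; first exact: measurable_itv.
by move=> x /=; rewrite !in_itv/=; lra.
Qed.

Let dPhi t : c < t < 1 -> is_derive t 1 Phi (- psi t).
Proof.
move=> tc; have /andP[ct t1] := tc.
apply: (der_eq (derB (derM (der_cst (2 * F) t) (is_derive_sqrtBr t1)) (C1_der C1_G tc))).
by rewrite /psi; field; rewrite gt_eqF// sqrtr_gt0 subr_gt0.
Qed.

Let cpsi t : c < t < 1 -> {for t, continuous psi}.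
Proof.
move=> tc; have /andP[ct t1] := tc.
apply: cvgD; last exact: C1_continuous C1_derive1_G tc.
apply: cvgM; first exact: cvg_cst.
apply: cvgV; last exact: continuous_sqrtBr.
by rewrite gt_eqF// sqrtr_gt0 subr_gt0.
Qed.

Lemma psi_ge0 t : c < t < 1 -> 0 <= psi t.
Proof. exact: (tail_density_ge0 (n := nf) dPhi nf_tail). Qed.

Lemma integral_nf (h : R -> \bar R) : measurable_fun setT h -> (forall x, (0 <= h x)%E) ->
  (\int[lam]_z (h z * sig z) = \int[lam]_(x in `]c, 1%R[) (h x * (psi x)%:E))%E.
Proof.
move=> mh h0; rewrite -(ge0_integral_tail_density (n := nf) c2 nf_itv dPhi cpsi nf_tail mh h0).
by rewrite -(ge0_integral_dens lam msig sig0).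
Qed.

(** The function g of the statement, as a function of z = cos t. *)
Definition ghat z := - ((4 * pi)^-1 * Num.sqrt (1 - z ^+ 2) * derive1 G z).

(** The integral whose derivative defines F in the statement, as a function of
    y = cos phi. *)
Definition Hfun y := \int[lam]_(z in `]c, y[) (ghat z / Num.sqrt (y - z)).

Let ghatE z : c < z < 1 ->
  Num.sqrt (1 - z ^+ 2) * psi z = F * Num.sqrt (1 + z) - 4 * pi * ghat z.
Proof.
move=> /andP[cz z1]; have pi0 : pi != 0 :> R by rewrite gt_eqF// pi_gt0.
have s0 : Num.sqrt (1 - z) != 0 by rewrite gt_eqF// sqrtr_gt0; lra.
have -> : 1 - z ^+ 2 = (1 - z) * (1 + z) by ring.
rewrite /ghat /psi; have -> : 1 - z ^+ 2 = (1 - z) * (1 + z) by ring.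
rewrite sqrtrM; last lra.
have : 4 * pi != 0 :> R by rewrite mulf_neq0.
by move: (4 * pi) (Num.sqrt (1 - z)) s0 => p r r0 p0; field; rewrite p0 r0.
Qed.

Let c_sqrt1 z : {for z, continuous (fun z : R => Num.sqrt (1 - z ^+ 2))}.
Proof.
apply: (@continuous_comp _ _ _ (fun z : R => 1 - z ^+ 2) (@Num.sqrt R)); last exact: sqrt_continuous.
by apply: cvgB; [exact: cvg_cst|exact: exprn_continuous].
Qed.

Let c_sqrt1D z : {for z, continuous (fun z : R => Num.sqrt (1 + z))}.
Proof.
apply: (@continuous_comp _ _ _ (fun z : R => 1 + z) (@Num.sqrt R)); last exact: sqrt_continuous.
by apply: cvgD; [exact: cvg_cst|exact: cvg_id].
Qed.

Let c_kr y z : z < y -> {for z, continuous (fun z => (Num.sqrt (y - z))^-1)}.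
Proof.
move=> zy; apply: cvgV; last exact: continuous_sqrtBr.
by rewrite gt_eqF// sqrtr_gt0; lra.
Qed.

Lemma C1_ghat : C1 c 1 ghat.
Proof.
have h : C1 c 1 (fun z => - (4 * pi)^-1 * Num.sqrt (1 - z ^+ 2) * derive1 G z).
  apply: C1M; last exact: C1_derive1_G.
  apply: C1M; first exact: C1_cst.
  apply: C1_sqrt; last by move=> z zc; have := c1; nra.
  apply: (C1I (g := fun z => 0 - 2%:R * z ^+ 1 * 1)) => z _.
    exact: derB (der_cst 1 z) (derX 1 (der_id z)).
  apply: cvgB; first exact: cvg_cst.
  apply: cvgM; last exact: cvg_cst.
  by apply: cvgM; [exact: cvg_cst|exact: exprn_continuous].
by apply: eq_C1 h => z _; rewrite /ghat !mulNr.
Qed.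

Lemma integrable_psi : lam.-integrable `]c, 1[ (EFin \o psi).
Proof.
apply: ge0_integrable_oo; [exact: cpsi|exact: psi_ge0|].
have := @integral_nf (cst 1%E) (@measurable_cst _ _ _ _ _ _) (fun=> @lee01 R).
under eq_integral do rewrite /= mul1e.
under [in X in _ = X -> _]eq_integral do rewrite /= mul1e.
by move=> <-; exact: nT.
Qed.

(** ghat is a combination of a bounded function and of sqrt (1 - z^2) psi z,
    and psi is nonnegative with finite integral because it is the density of a
    finite measure. This is how integrability up to c, where nothing is known
    about the derivatives of qh, is obtained. *)
Lemma integrable_ghat d : c < d < 1 -> lam.-integrable `]c, d[ (EFin \o ghat).
Proof.
move=> /andP[cd d1]; have pi0 := pi_gt0 R.
have mghat : measurable_fun `]c, d[ ghat.
  by apply: measurable_fun_oo => z zcd; apply: (C1_continuous C1_ghat); lra.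
apply: (@le_integrable _ _ _ lam _ (measurable_itv _) _ (EFin \o (fun z => F + psi z))).
- exact/measurable_EFinP.
- move=> z /=; rewrite in_itv/= => zcd; rewrite lee_fin.
  have zc : c < z < 1 by lra.
  have p0 := psi_ge0 zc; have := c1; have := F0 => F0' c1'.
  have E : ghat z = (4 * pi)^-1 * (F * Num.sqrt (1 + z) - Num.sqrt (1 - z ^+ 2) * psi z).
    have pine : pi != 0 :> R by rewrite gt_eqF.
    have : 4 * pi != 0 :> R by rewrite mulf_neq0.
    by rewrite (ghatE zc); move: (4 * pi) => p p0'; field.
  have s1 : Num.sqrt (1 - z ^+ 2) <= 1.
    by rewrite -[leRHS]sqrtr1 ler_sqrt; nra.
  have s2 : Num.sqrt (1 + z) <= 2.
    by rewrite -[leRHS]ger0_norm// -sqrtr_sqr ler_sqrt; nra.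
  have s10 := sqrtr_ge0 (1 - z ^+ 2); have s20 := sqrtr_ge0 (1 + z).
  rewrite [leRHS]ger0_norm; last by rewrite addr_ge0.
  have pi2 : 2 <= pi :> R by exact: pi_ge2.
  rewrite E normrM gtr0_norm ?invr_gt0 ?mulr_gt0//.
  rewrite mulrC ler_pdivrMr ?mulr_gt0//.
  apply: (@le_trans _ _ (2 * F + psi z)); last nra.
  rewrite (le_trans (ler_normB _ _))// lerD// ger0_norm ?mulr_ge0//.
    by rewrite mulrC ler_wpM2r.
  by rewrite ler_piMl.
- apply: (@integrableS _ _ _ lam `]c, 1[) => //.
    by move=> z /=; rewrite !in_itv/=; lra.
  apply: (@integrableD _ _ _ lam `]c, 1[ _ (EFin \o cst F) (EFin \o psi)) => //; last exact: integrable_psi.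
  apply: measurable_bounded_integrable => //=.
    by rewrite lebesgue_measure_itv/= lte_fin c2 -EFinD ltry.
  by exists `|F|; split; [exact: num_real|move=> y Fy x _ /=; exact: ltW].
Qed.

Section inversion_at.
Variable y : R.
Hypothesis cy : c < y <= 1.

Let k z := (F * Num.sqrt (1 + z) - 4 * pi * ghat z) / Num.sqrt (y - z).
Let k1 z := F * (Num.sqrt (1 + z) / Num.sqrt (y - z)).

Let zy z : c < z < y -> c < z < 1.
Proof. by move=> h; have := cy; lra. Qed.

Let int_k : (\int[lam]_(z in `]c, y[) (k z)%:E = (pi * M y)%:E)%E.
Proof.
rewrite -T2//.
pose h z : R := Num.sqrt (1 - z ^+ 2) * kr y z.
have mh : measurable_fun setT (fun z : L => (h z)%:E : \bar R).
  apply/measurable_EFinP; apply: measurable_funM.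
    by apply: measurable_sqrtr; apply: measurable_funB => //; exact: measurable_funX.
  by apply: measurable_kr => //; exact: measurable_cst.
have h0 z : (0 <= (h z)%:E)%E by rewrite lee_fin mulr_ge0 ?sqrtr_ge0 ?kr_ge0.
transitivity (\int[lam]_z ((h z)%:E * sig z))%E; last first.
  rewrite -[RHS]integral_setT_patch; apply: eq_integral => z _.
  rewrite /sig /h !indicE.
  have [zy'|yz] := ltP z y; last by rewrite (@kr0 _ y z)// mulr0 mul0e /kr ler0_sqrtr ?subr_le0// invr0 !mule0.
  case: (boolP (z \in `]c, 1[%classic)) => [|/negP]; rewrite inE/= in_itv/= => hz.
    rewrite mem_set/= ?in_itv/= ?zy' ?andbT; last by case/andP: hz.
    rewrite !mul1e muleCA; congr (_ * _)%E; rewrite -EFinM; congr (_%:E).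
    rewrite /wr /kr mulrAC mulfV ?mul1r// gt_eqF// sqrtr_gt0.
    by have := c1; move: hz; nra.
  rewrite memNset ?mul0e ?mule0//= in_itv/= => hz'.
  by apply: hz; exact: zy.
rewrite integral_nf// -[RHS]integral_setT_patch -[LHS]integral_setT_patch; apply: eq_integral => z _.
rewrite !indicE -EFinM.
have [zy'|yz] := ltP z y; last first.
  rewrite memNset; first by rewrite mul0r /h (@kr0 _ y z)// mulr0 mul0e mule0.
  by rewrite /= in_itv/= => /andP[_]; rewrite ltNge yz.
case: (boolP (z \in `]c, 1[%classic)) => [|/negP]; rewrite inE/= in_itv/= => hz.
  rewrite mem_set/= ?in_itv/= ?zy' ?andbT; last by case/andP: hz.
  by rewrite /k -ghatE// /h /kr mulrAC.
rewrite memNset; first by rewrite mul0r mul0e.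
by rewrite /= in_itv/= => hz'; apply: hz; exact: zy.
Qed.

Let k_ge0 z : c < z < y -> 0 <= k z.
Proof.
move=> hz; rewrite /k -ghatE ?zy// divr_ge0 ?sqrtr_ge0// mulr_ge0 ?sqrtr_ge0//.
by apply: psi_ge0; exact: zy.
Qed.

Let ck z : c < z < y -> {for z, continuous k}.
Proof.
move=> hz; apply: cvgM; last by apply: c_kr; case/andP: hz.
apply: cvgB; first by apply: cvgM; [exact: cvg_cst|exact: c_sqrt1D].
by apply: cvgM; [exact: cvg_cst|apply: (C1_continuous C1_ghat); exact: zy].
Qed.

Let ik : lam.-integrable `]c, y[ (EFin \o k).
Proof. by apply: ge0_integrable_oo => //; rewrite int_k ltry. Qed.

Let int_k1 : (\int[lam]_(z in `]c, y[) (k1 z)%:E = (F * capE c y)%:E)%E.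
Proof.
rewrite /k1; under eq_integral do rewrite EFinM.
rewrite ge0_integralZl//.
- by rewrite integral_capE//; case/andP: cy.
- apply/measurable_EFinP; apply: measurable_fun_oo => z hz.
  by apply: cvgM; [exact: c_sqrt1D|apply: c_kr; case/andP: hz].
Qed.

Let ik1 : lam.-integrable `]c, y[ (EFin \o k1).
Proof.
apply: ge0_integrable_oo => [z hz|z hz|]; last by rewrite int_k1 ltry.
  apply: cvgM; first exact: cvg_cst.
  by apply: cvgM; [exact: c_sqrt1D|apply: c_kr; case/andP: hz].
by rewrite /k1 mulr_ge0// divr_ge0 ?sqrtr_ge0.
Qed.

Let HE z : ghat z / Num.sqrt (y - z) = (4 * pi)^-1 * (k1 z - k z).
Proof.
have : 4 * pi != 0 :> R by rewrite mulf_neq0// gt_eqF// pi_gt0.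
rewrite /k /k1; move: (4 * pi) => p p0.
by move: (Num.sqrt (y - z))^-1 => s; field.
Qed.

Lemma integrable_Hfun :
  lam.-integrable `]c, y[ (EFin \o (fun z => ghat z / Num.sqrt (y - z))).
Proof.
have -> : EFin \o (fun z => ghat z / Num.sqrt (y - z)) =
    (fun z => ((4 * pi)^-1)%:E * ((EFin \o k1) z - (EFin \o k) z))%E.
  by apply/funext => z; rewrite /= HE EFinM EFinB.
by apply: integrableZl => //; exact: integrableB.
Qed.

(** Differentiating the first Abel identity shows that Sz z * wr z and psi z
    are densities of the same measure; inserting this in the second one and
    using sqrt (1 - z^2) psi z = F sqrt (1 + z) - 4 pi ghat z yields the
    distribution function. *)
Lemma cdf_formula : M y = (F * capE c y - 4 * pi * Hfun y) / pi.
Proof.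
have pine : pi != 0 :> R by rewrite gt_eqF// pi_gt0.
have p4 : 4 * pi != 0 :> R by rewrite mulf_neq0.
have -> : Hfun y = (4 * pi)^-1 * (F * capE c y - pi * M y).
  rewrite /Hfun; under eq_Rintegral do rewrite HE.
  rewrite RintegralZl//; last by apply: (integrableB _ ik1 ik).
  rewrite RintegralB//; congr (_ * (_ - _)).
    by rewrite /Rintegral int_k1.
  by rewrite /Rintegral int_k.
by rewrite mulrA mulfV// mul1r opprB addrC subrK mulrC mulKf.
Qed.

End inversion_at.

(** The reflection z -> - z turns Hfun into an Abel transform. *)
Lemma C1_Hfun : C1 c 1 Hfun.
Proof.
pose r z := ghat (- z).
have C1opp a b : C1 a b (fun z : R => - z).
  apply: (C1I (g := fun=> -1)) => z _; exact: cvg_cst.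
have hr : C1 (-1) (- c) r.
  by apply: (C1_comp (C1opp _ _) C1_ghat) => z; lra.
have HE y : c < y < 1 -> Abel r (- c) (- y) = Hfun y.
  move=> hy; rewrite /Abel /Hfun /Rintegral; congr fine.
  rewrite [RHS]integral_oo_opp.
    by apply: eq_integral => z _; rewrite /r !opprK addrC.
  move=> z hz; apply: cvgM; last by apply: c_kr; case/andP: hz.
  by apply: (C1_continuous C1_ghat); lra.
apply: (eq_C1 HE); apply: (C1_comp (C1opp _ _) (a := -1) (b := - c)); last by move=> z; lra.
apply: Abel_C1 => // d hd.
apply/integrableP; split.
  by apply/measurable_EFinP; apply: measurable_fun_oo => z hz; apply: (C1_continuous hr); lra.
have hd' : c < - d < 1 by lra.
have /integrableP[_] := integrable_ghat hd'; apply: le_lt_trans.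
rewrite le_eqVlt; apply/orP; left; apply/eqP; apply/esym.
rewrite /comp/=.
have := @integral_oo_opp _ (fun z => `|ghat z|) c (- d).
rewrite opprK => ->//.
move=> z hz; apply: continuous_comp; last exact: norm_continuous.
by apply: (C1_continuous C1_ghat); lra.
Qed.

End abel_inversion.

(** * Regularity of the field along a meridian *)

Section meridian.
Context {R : realType}.
Local Notation V := 'rV[R]_3.
Implicit Types (x s t h : R) (p : V).

Definition plane s t : V := \row_(i < 3) [:: s; 0; t]`_i.
Local Notation e0 := (delta_mx 0 (0 : 'I_3) : V).
Local Notation e2 := (delta_mx 0 (ord_max : 'I_3) : V).

Lemma plane0 h s t : h *: e0 + plane s t = plane (h + s) t.
Proof. by apply: eq_row3; rewrite !mxE/=; ring. Qed.

Lemma plane2 h s t : h *: e2 + plane s t = plane s (h + t).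
Proof. by apply: eq_row3; rewrite !mxE/=; ring. Qed.

Lemma is_derive_cvg (f : R -> R) x (l : R) :
  h^-1 * (f (h + x) - f x) @[h --> 0^'] --> l -> is_derive x 1 f l.
Proof.
move=> cv.
have E : (fun h => h^-1 *: (f (h *: (1 : R) + x) - f x)) = (fun h => h^-1 * (f (h + x) - f x)).
  by apply/funext => h; rewrite /GRing.scale/= mulr1.
apply: DeriveDef; first by rewrite /derivable E; exact: cvgP cv.
by rewrite /derive E; exact: cvg_lim cv.
Qed.

Lemma derivable_cvg (H : V -> R) p v : derivable H p v ->
  h^-1 * (H (h *: v + p) - H p) @[h --> 0^'] --> 'D_v H p.
Proof. by []. Qed.

Lemma is_derive_line (H : V -> R) p v (f : R -> R) s :
  (forall h, f (h + s) = H (h *: v + p)) -> derivable H p v -> is_derive s 1 f ('D_v H p).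
Proof.
move=> fH dH; apply: is_derive_cvg.
have fs : f s = H p by rewrite -[s in LHS]add0r fH scale0r add0r.
under eq_fun do rewrite fH fs.
exact: derivable_cvg dH.
Qed.

Lemma mean_value (f df : R -> R) s s' :
  (forall t, `|t - s| <= `|s' - s| -> is_derive t 1 f (df t)) ->
  exists2 t, `|t - s| <= `|s' - s| & f s' - f s = df t * (s' - s).
Proof.
move=> dfs; have [ss'|ss'|->] := ltgtP s s'; last 1 first.
- by exists s'; rewrite ?subrr ?normr0 ?mulr0.
- have h0 t : s <= t <= s' -> `|t - s| <= `|s' - s|.
    by move=> /andP[h1 h2]; rewrite !ger0_norm ?subr_ge0 ?lerD2r// ltW.
  have [||t] := @MVT_segment _ f df s s' (ltW ss').
  + by move=> t; rewrite in_itv/= => /andP[h1 h2]; apply: dfs; apply: h0; rewrite !ltW.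
  + apply: continuous_in_subspaceT => t; rewrite inE/= in_itv/= => ht.
    exact: der_continuous (dfs _ (h0 _ ht)).
  by rewrite in_itv/= => ht E; exists t => //; exact: h0.
- have h0 t : s' <= t <= s -> `|t - s| <= `|s' - s|.
    by move=> /andP[h1 h2]; rewrite !ler0_norm ?subr_le0 ?lerN2 ?lerD2r// ltW.
  have [||t] := @MVT_segment _ f df s' s (ltW ss').
  + by move=> t; rewrite in_itv/= => /andP[h1 h2]; apply: dfs; apply: h0; rewrite !ltW.
  + apply: continuous_in_subspaceT => t; rewrite inE/= in_itv/= => ht.
    exact: der_continuous (dfs _ (h0 _ ht)).
  by rewrite in_itv/= => ht E; exists t; [exact: h0|rewrite -opprB E -mulrN opprB].
Qed.

Lemma cvg_plane T (X : set_system T) {XF : Filter X} (a b : T -> R) s t :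
  a u @[u --> X] --> s -> b u @[u --> X] --> t ->
  plane (a u) (b u) @[u --> X] --> plane s t.
Proof.
move=> /cvgrPdist_lt ca /cvgrPdist_lt cb; apply/cvg_ballP => e e0.
apply: filterS2 (ca _ e0) (cb _ e0) => u hu hv; split => // i j; rewrite ord1.
by case: (ord3P j) => ->; rewrite !mxE/= /ball/= ?subrr ?normr0.
Qed.

(** Chain rule along the curve (a(x), 0, x) from continuous partial
    derivatives: the increment is split in two steps parallel to the axes and
    the mean value theorem is applied to each. *)
Lemma is_derive_plane (W : set V) (H : V -> R) (a : R -> R) x a' :
  open W -> W (plane (a x) x) ->
  (forall p, W p -> derivable H p e0 /\ derivable H p e2) ->
  {for plane (a x) x, continuous (fun p => 'D_e0 H p)} ->
  {for plane (a x) x, continuous (fun p => 'D_e2 H p)} ->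
  is_derive x 1 a a' ->
  is_derive x 1 (fun y => H (plane (a y) y))
    ('D_e0 H (plane (a x) x) * a' + 'D_e2 H (plane (a x) x)).
Proof.
move=> oW Wx dH c0 c2 da; apply: is_derive_cvg.
have /nbhs_ballP[e /= e_gt0 eW] : nbhs (plane (a x) x) W by exact: open_nbhs_nbhs.
have inW s t : `|s - a x| < e -> `|t - x| < e -> W (plane s t).
  move=> hs ht; apply: eW; split => // i j; rewrite ord1.
  by case: (ord3P j) => ->; rewrite !mxE/= /ball/= ?subrr ?normr0// distrC.
have ca : {for x, continuous a} := der_continuous da.
have cshift : h + x @[h --> (0 : R)] --> x.
  by rewrite -[X in _ --> X](add0r x); apply: cvgD; [exact: cvg_id|exact: cvg_cst].
have cah : a (h + x) @[h --> (0 : R)] --> a x by apply: cvg_comp cshift _; exact: ca.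
have : forall h, exists st : R * R, [/\ `|st.1 - a x| <= `|a (h + x) - a x|,
    `|st.2 - x| <= `|h| & `|a (h + x) - a x| < e -> `|h| < e ->
    H (plane (a (h + x)) (h + x)) - H (plane (a x) x) =
    'D_e0 H (plane st.1 (h + x)) * (a (h + x) - a x) + 'D_e2 H (plane (a x) st.2) * h].
  move=> h; have [h1|h1] := ltP `|a (h + x) - a x| e; last first.
    by exists (a x, x); split; rewrite /= ?subrr ?normr0// => h2; move: h1; rewrite leNgt h2.
  have [h2|h2] := ltP `|h| e; last first.
    by exists (a x, x); split; rewrite /= ?subrr ?normr0// => _ h3; move: h2; rewrite leNgt h3.
  have [|s hs Es] := @mean_value (fun s => H (plane s (h + x)))
    (fun s => 'D_e0 H (plane s (h + x))) (a x) (a (h + x)).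
    move=> t ht; apply: (@is_derive_line _ _ e0); first by move=> k; rewrite plane0.
    by have [] := dH (plane t (h + x)) (inW _ _ (le_lt_trans ht h1) _); rewrite ?addrK.
  have [|t ht Et] := @mean_value (fun t => H (plane (a x) t))
    (fun t => 'D_e2 H (plane (a x) t)) x (h + x).
    move=> t; rewrite addrK => ht; apply: (@is_derive_line _ _ e2); first by move=> k; rewrite plane2.
    have [] // := dH (plane (a x) t) (inW _ _ _ (le_lt_trans ht h2)).
    by rewrite subrr normr0.
  exists (s, t); split=> //; first by move: ht; rewrite addrK.
  move=> _ _ /=; rewrite -Es.
  by move: Et; rewrite addrK => <-; rewrite addrA subrK.
move=> /choice[st hst].
have cs : (st h).1 @[h --> (0 : R)] --> a x.
  apply/cvgrPdist_lt => d d0; move/cvgrPdist_lt : cah => /(_ _ d0).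
  by apply: filterS => h hd; have [h1 _ _] := hst h; rewrite distrC (le_lt_trans h1)// distrC.
have ct : (st h).2 @[h --> (0 : R)] --> x.
  apply/cvgrPdist_lt => d d0; have : \forall h \near (0 : R), `|0 - h| < d.
    by move: (@cvg_id _ (nbhs (0 : R))) => /cvgrPdist_lt; apply.
  by apply: filterS => h hd; have [_ h1 _] := hst h; rewrite distrC (le_lt_trans h1)// -normrN -[- h]add0r.
have to0 (T : topologicalType) (f : R -> T) (l : T) : f h @[h --> (0 : R)] --> l -> f h @[h --> 0^'] --> l.
  by move=> fl; apply: cvg_trans fl; apply: cvg_app; exact: cvg_within.
pose Qh h := 'D_e0 H (plane (st h).1 (h + x)) * (h^-1 * (a (h + x) - a x)) + 'D_e2 H (plane (a x) (st h).2).
apply: (@cvg_trans _ (Qh h @[h --> 0^'])).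
  apply: near_eq_cvg.
  have n1 : \forall h \near (0 : R)^', `|a (h + x) - a x| < e.
    move/cvgrPdist_lt : (to0 _ _ _ cah) => /(_ _ e_gt0).
    by apply: filterS => h; rewrite distrC.
  have n2 : \forall h \near (0 : R)^', `|h| < e.
    have /cvgrPdist_lt/(_ _ e_gt0) := @to0 R id 0 (@cvg_id _ (nbhs (0 : R))).
    by apply: filterS => h; rewrite sub0r normrN.
  have n3 : \forall h \near (0 : R)^', h != 0 by exact: nbhs_dnbhs_neq.
  near=> h; have [_ _ ->] := hst h; [|by near: h|by near: h].
  have hn : h != 0 by near: h.
  by rewrite /Qh; field.
apply: cvgD.
  apply: cvgM.
    apply: (cvg_comp (fun h => plane (st h).1 (h + x)) (fun p => 'D_e0 H p)) c0.
    by apply: to0; exact: cvg_plane.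
  have [d1 <-] := da.
  have := d1; rewrite /derivable => /cvgP.
  have E : (fun h => h^-1 *: (a (h *: (1 : R) + x) - a x)) = (fun h => h^-1 * (a (h + x) - a x)).
    by apply/funext => h; rewrite /GRing.scale/= mulr1.
  by rewrite /derive E.
apply: (cvg_comp (fun h => plane (a x) (st h).2) (fun p => 'D_e2 H p)) c2.
by apply: to0; apply: cvg_plane => //; exact: cvg_cst.
Unshelve. all: by end_near. Qed.

Lemma sphx_plane x : sphx 0 x = plane (Num.sqrt (1 - x ^+ 2)) x.
Proof. by apply: eq_row3; rewrite !mxE/= ?cos0 ?sin0 ?mulr1 ?mulr0. Qed.

Lemma sqrt_circle_C1 : C1 (-1) 1 (fun x : R => Num.sqrt (1 - x ^+ 2)).
Proof.
apply: C1_sqrt; last by move=> z zc; nra.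
apply: (C1I (g := fun z => 0 - 2%:R * z ^+ 1 * 1)) => z _.
  exact: derB (der_cst 1 z) (derX 1 (der_id z)).
apply: cvgB; first exact: cvg_cst.
apply: cvgM; last exact: cvg_cst.
by apply: cvgM; [exact: cvg_cst|exact: exprn_continuous].
Qed.

Lemma sphx_continuous x : -1 < x < 1 -> {for x, continuous (sphx 0)}.
Proof.
move=> x1; have E : sphx 0 = fun x => plane (Num.sqrt (1 - x ^+ 2)) x.
  by apply/funext => y; exact: sphx_plane.
rewrite /prop_for /continuous_at E; apply: cvg_plane; last exact: cvg_id.
exact: C1_continuous sqrt_circle_C1 x1.
Qed.

Section profile.
Variables (N : set V) (Q : V -> \bar R) (c : R).
Hypotheses (c1 : -1 <= c) (Q2 : sphere_C2_on N Q).
Hypothesis Nc : forall x, c < x < 1 -> N (sphx 0 x).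

(** The field as a function of the height, read off along the meridian of
    azimuth 0. *)
Definition qhat x := fine (Q (sphx 0 x)).

Let x11 x : c < x < 1 -> -1 < x < 1. Proof. by have := c1; lra. Qed.

Lemma Q_fin x : c < x < 1 -> Q (sphx 0 x) = (qhat x)%:E.
Proof.
move=> hx; have [U [G [_ Ux _ QG]]] := Q2 (Nc hx).
by rewrite /qhat QG//; exact: Nc.
Qed.

(** Near each point of the meridian the field is the restriction of a C^2
    function of three variables, to which the chain rule applies twice. *)
Lemma qhat_C2 : C1 c 1 qhat /\ C1 c 1 (derive1 qhat).
Proof.
pose a x : R := Num.sqrt (1 - x ^+ 2).
have da x : c < x < 1 -> is_derive x 1 a (derive1 a x).
  by move=> /x11; exact: C1_der sqrt_circle_C1.
pose D0 (H : V -> R) x := 'D_e0 H (plane (a x) x).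
pose D2 (H : V -> R) x := 'D_e2 H (plane (a x) x).
pose D (H : V -> R) x := D0 H x * derive1 a x + D2 H x.
(* Local chain rule near x, for G and for its first partial derivatives *)
have loc x : c < x < 1 -> exists (U : set V) (G : V -> R),
    [/\ open U, C2_on U G, \forall y \near x, c < y < 1 /\ U (plane (a y) y) &
    \forall y \near x, qhat y = G (plane (a y) y)].
  move=> hx; have [U [G [oU Ux CG QG]]] := Q2 (Nc hx).
  have nU : \forall y \near x, c < y < 1 /\ U (plane (a y) y).
    have h1 := near_oo hx.
    have h2 : \forall y \near x, U (sphx 0 y).
      exact: (sphx_continuous (x11 hx)) (open_nbhs_nbhs (conj oU Ux)).
    by apply: filterS2 h1 h2 => y h1 h2; rewrite -sphx_plane.
  exists U, G; split=> //.
  apply: filterS nU => y [hy Uy]; rewrite /qhat -sphx_plane QG//; first exact: Nc.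
  by rewrite sphx_plane.
have d1 (U : set V) G y : open U -> C2_on U G -> c < y < 1 -> U (plane (a y) y) ->
    is_derive y 1 (fun y => G (plane (a y) y)) (D G y).
  move=> oU CG hy Uy; have [_ Cy] := CG _ Uy.
  apply: (is_derive_plane oU Uy) => //.
  - move=> p Up; have [_ Cp] := CG _ Up.
    by split; [have [] := Cp 0|have [] := Cp ord_max].
  - by have [] := Cy 0.
  - by have [] := Cy ord_max.
  - exact: da.
have d2 (U : set V) G y (i : 'I_3) : open U -> C2_on U G -> c < y < 1 -> U (plane (a y) y) ->
    is_derive y 1 (fun y => 'D_(delta_mx 0 i : V) G (plane (a y) y))
     (D (fun p => 'D_(delta_mx 0 i : V) G p) y).
  move=> oU CG hy Uy; have [_ /(_ i)[_ _ Cy]] := CG _ Uy.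
  apply: (is_derive_plane oU Uy) => //.
  - move=> p Up; have [_ /(_ i)[_ _ Cp]] := CG _ Up.
    by split; [have [] := Cp 0|have [] := Cp ord_max].
  - by have [] := Cy 0.
  - by have [] := Cy ord_max.
  - exact: da.
have der_q (x y : R) (U : set V) (G : V -> R) : open U -> C2_on U G -> c < y < 1 -> U (plane (a y) y) ->
    (\forall z \near y, qhat z = G (plane (a z) z)) -> is_derive y 1 qhat (D G y).
  move=> oU CG hy Uy near_q; apply: (near_eq_is_derive _ (d1 _ _ _ oU CG hy Uy)).
  by apply: filterS near_q => z ->.
have near_q x : c < x < 1 -> exists (U : set V) (G : V -> R),
    [/\ open U, C2_on U G, U (plane (a x) x) & \forall y \near x, is_derive (y : R) 1 qhat (D G y) /\
      U (plane (a y) y) /\ c < y < 1].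
  move=> hx; have [U [G [oU CG nU nq]]] := loc x hx; exists U, G; split=> //.
    by have [] := nbhs_singleton nU.
  have nnq : \forall y \near x, \forall z \near y, qhat z = G (plane (a z) z) by exact: near_join.
  apply: filterS2 nU nnq => y [hy Uy] nq'; split=> //.
  exact: (@der_q x y U G).
have C1a : C1 c 1 (derive1 a).
  apply: (@eq_C1 _ _ _ (fun x => - x * (a x)^-1)).
    move=> x hx; apply/esym/is_derive_derive1.
    have x11' := x11 hx; have h0 : 0 < 1 - x ^+ 2 by nra.
    have d := derB (der_cst 1 x) (derX 1 (der_id x)).
    apply: (der_eq (der_sqrt d h0)).
    by rewrite /a; field; rewrite gt_eqF// sqrtr_gt0.
  apply: C1M; first by apply: (C1I (g := fun=> -1)) => z _; exact: cvg_cst.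
  apply: C1V; first by move=> x /x11; exact: sqrt_circle_C1.
  by move=> x /x11 hx; rewrite gt_eqF// sqrtr_gt0; nra.
have ca x : c < x < 1 -> {for x, continuous a} by move=> /da; exact: der_continuous.
have ca' x : c < x < 1 -> {for x, continuous (derive1 a)} by exact: C1_continuous.
have gam x : c < x < 1 -> plane (a y) y @[y --> x] --> plane (a x) x.
  by move=> hx; apply: cvg_plane; [exact: ca|exact: cvg_id].
have cD (H : V -> R) x : c < x < 1 ->
    {for plane (a x) x, continuous (fun p => 'D_e0 H p)} ->
    {for plane (a x) x, continuous (fun p => 'D_e2 H p)} -> {for x, continuous (D H)}.
  move=> hx h0 h2; apply: cvgD; last exact: (cvg_comp _ _ (gam _ hx) h2).
  by apply: cvgM; [exact: (cvg_comp _ _ (gam _ hx) h0)|exact: ca'].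
split=> x hx; have [U [G [oU CG Ux nq]]] := near_q x hx.
  have [dx _] := nbhs_singleton nq; split; first by have [] := dx.
  apply: (@near_eq_continuous _ (D G)).
    by apply: filterS nq => y [dy _]; rewrite (is_derive_derive1 dy).
  have [_ Cx] := CG _ Ux.
  by apply: cD => //; [have [] := Cx 0|have [] := Cx ord_max].
pose E y := (D (fun p => 'D_e0 G p) y * derive1 a y + D0 G y * derive1 (derive1 a) y) +
  D (fun p => 'D_e2 G p) y.
have dE y : U (plane (a y) y) -> c < y < 1 -> is_derive y 1 (D G) (E y).
  move=> Uy hy; have h0 := d2 U G y 0 oU CG hy Uy.
  have h2 := d2 U G y ord_max oU CG hy Uy.
  exact: derD (derM h0 (C1_der C1a hy)) h2.
have dq' : \forall y \near x, is_derive (y : R) 1 (derive1 qhat) (E y).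
  have nnq := near_join nq; apply: filterS2 nq nnq => y [_ [Uy hy]] nq'.
  apply: (near_eq_is_derive _ (dE y Uy hy)).
  by apply: filterS nq' => z [dz _]; rewrite (is_derive_derive1 dz).
split; first by have [] := nbhs_singleton dq'.
apply: (@near_eq_continuous _ E).
  by apply: filterS dq' => y dy; rewrite (is_derive_derive1 dy).
have [_ Cx] := CG _ Ux; have [_ C0 /(_ _)C00] := Cx 0; have [_ C2 /(_ _)C22] := Cx ord_max.
apply: cvgD.
  apply: cvgD.
    apply: cvgM; last exact: ca'.
    by apply: cD => //; [have [] := C00 0|have [] := C00 ord_max].
  apply: cvgM; first exact: (cvg_comp _ _ (gam _ hx) C0).
  by have [] := C1a _ hx.
by apply: cD => //; [have [] := C22 0|have [] := C22 ord_max].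
Qed.

End profile.

End meridian.

(** * Passage from latitudes to polar angles *)

Section angles.
Context {R : realType}.
Notation lam := (@lebesgue_measure R).
Implicit Types (a b t x y z : R) (f g : R -> R).

Lemma integrable_oo_cc f a b : lam.-integrable `]a, b[ (EFin \o f) ->
  lam.-integrable `[a, b] (EFin \o f).
Proof.
move=> /integrableP[mf ioo]; have mfo : measurable_fun `]a, b[ f by apply/measurable_EFinP.
apply/integrableP; split; last first.
  by rewrite integral_itv_bndoo//; exact: measurableT_comp.
apply/measurable_EFinP.
by apply/measurable_fun_itv_obnd_cbndP/measurable_fun_itv_bndo_bndcP.
Qed.

Lemma Rintegral_cc_oo f a b : measurable_fun `]a, b[ f ->
  \int[lam]_(x in `[a, b]) f x = \int[lam]_(x in `]a, b[) f x.
Proof.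
by move=> mf; rewrite /Rintegral integral_itv_bndoo//; exact/measurable_EFinP.
Qed.

Lemma eq_integrable_oo f g a b : (forall x, a < x < b -> g x = f x) ->
  lam.-integrable `]a, b[ (EFin \o f) -> lam.-integrable `]a, b[ (EFin \o g).
Proof.
move=> fg /integrableP[mf ioo]; apply/integrableP; split.
  apply: (eq_measurable_fun (EFin \o f)) => // x; rewrite inE/= in_itv/= => hx.
  by rewrite fg.
apply: le_lt_trans ioo; rewrite le_eqVlt; apply/orP; left; apply/eqP.
by apply: eq_integral => x; rewrite inE/= in_itv/= => hx; rewrite fg.
Qed.

Lemma cos_anti a b : 0 <= a -> a < b -> b <= pi -> cos b < cos a.
Proof. by move=> a0 ab bpi; rewrite ltr_cos// in_itv/=; lra. Qed.

Section cosine_substitution.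
Variables (a b : R).
Hypotheses (a0 : 0 <= a) (ab : a < b) (bpi : b <= pi).

Lemma cos_oo t : a < t < b -> cos b < cos t < cos a.
Proof.
by move=> /andP[h1 h2]; rewrite !cos_anti//; have := a0; have := bpi; lra.
Qed.

Lemma sin_oo t : a < t < b -> 0 < sin t.
Proof. by move=> h; apply: sin_gt0_pi; have := a0; have := bpi; lra. Qed.

Lemma cos_subst f : (forall x, cos b < x < cos a -> {for x, continuous f}) ->
  (\int[lam]_(x in `](cos b), (cos a)[) (f x)%:E =
   \int[lam]_(t in `]a, b[) (f (cos t) * sin t)%:E)%E.
Proof.
move=> cf; rewrite (@substitution_decreasing_oo _ (fun t => - sin t) cos f a b)//.
- by apply: eq_integral => t _; rewrite opprK.
- by move=> t _; apply: cvgN; exact: continuous_sin.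
- by move=> t ht; rewrite oppr_lt0; exact: sin_oo.
- by apply: cvg_at_right_filter; exact: continuous_cos.
- by apply: cvg_at_left_filter; exact: continuous_cos.
Qed.

Lemma cos_subst_continuous f t : (forall x, cos b < x < cos a -> {for x, continuous f}) ->
  a < t < b -> {for t, continuous (fun t => f (cos t) * sin t)}.
Proof.
move=> cf ht; apply: cvgM; last exact: continuous_sin.
by apply: continuous_comp; [exact: continuous_cos|apply: cf; exact: cos_oo].
Qed.

Lemma cos_integrable f : (forall x, cos b < x < cos a -> {for x, continuous f}) ->
  lam.-integrable `](cos b), (cos a)[ (EFin \o f) ->
  lam.-integrable `]a, b[ (EFin \o (fun t => f (cos t) * sin t)).
Proof.
move=> cf /integrableP[_ fi]; apply/integrableP; split.
  by apply/measurable_EFinP; apply: measurable_fun_oo => t; exact: cos_subst_continuous.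
apply: le_lt_trans fi; rewrite le_eqVlt; apply/orP; left; apply/eqP.
have cnf x : cos b < x < cos a -> {for x, continuous (fun x => `|f x|)}.
  by move=> hx; apply: continuous_comp; [exact: cf|exact: norm_continuous].
rewrite [RHS](cos_subst cnf); apply: eq_integral => t; rewrite inE/= in_itv/= => ht.
by rewrite normrM [`|sin t|]gtr0_norm// (sin_oo ht).
Qed.

End cosine_substitution.

Section profile_integrals.
Variables (alpha : R) (qh q : R -> R).
Hypothesis alpha_range : 0 < alpha <= pi.
Let c := cos alpha.
Hypothesis qE : forall t, 0 < t < alpha -> q t = qh (cos t).
Hypothesis cq : forall x, c < x < 1 -> {for x, continuous qh}.
Hypothesis iA : forall w, c < w < 1 ->
  lam.-integrable `]w, 1[ (EFin \o (fun x => qh x / Num.sqrt (x - w))).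
Hypothesis C1A : C1 c 1 (Abel qh 1).

Lemma cos_cap t : 0 < t < alpha -> c < cos t < 1.
Proof.
by move=> ht; rewrite -[X in _ < _ < X]cos0; apply: cos_oo ht; case/andP: alpha_range.
Qed.

Let c_sq y z : y < z -> {for z, continuous (fun z => (Num.sqrt (z - y))^-1)}.
Proof.
move=> zy; apply: cvgV; last exact: continuous_sqrtBl.
by rewrite gt_eqF// sqrtr_gt0; lra.
Qed.

Let c_sqr y z : z < y -> {for z, continuous (fun z => (Num.sqrt (y - z))^-1)}.
Proof.
move=> zy; apply: cvgV; last exact: continuous_sqrtBr.
by rewrite gt_eqF// sqrtr_gt0; lra.
Qed.

Lemma g_integral_cos t : 0 < t < alpha ->
  lam.-integrable `[0, t] (EFin \o g_integrand q t) /\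
  g_integral q t = Abel qh 1 (cos t).
Proof.
move=> ht; have /andP[t0 ta] := ht; have /andP[al0 alpi] := alpha_range.
have ct := cos_cap ht.
pose f x := qh x / Num.sqrt (x - cos t).
have tpi : t <= pi by lra.
have cf x : cos t < x < cos 0 -> {for x, continuous f}.
  rewrite cos0 => hx; apply: cvgM; first by apply: cq; lra.
  by apply: c_sq; case/andP: hx.
have E z : 0 < z < t -> g_integrand q t z = f (cos z) * sin z.
  by move=> hz; rewrite /g_integrand /f qE; [ring|lra].
have io : lam.-integrable `]0, t[ (EFin \o g_integrand q t).
  apply: (@eq_integrable_oo (fun z => f (cos z) * sin z)) => //.
  by apply: cos_integrable => //; rewrite cos0; exact: iA.
split; first exact: integrable_oo_cc.
rewrite /g_integral Rintegral_cc_oo; last by apply/measurable_EFinP; case/integrableP : io.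
rewrite /Abel /Rintegral; congr fine.
rewrite -[X in (_ = \int[lam]_(x in `]_, X[) _)%E]cos0 (cos_subst _ t0 tpi cf)//.
by apply: eq_integral => z; rewrite inE/= in_itv/= => hz; rewrite E.
Qed.

Lemma is_derive_g_integral t : 0 < t < alpha ->
  is_derive t 1 (g_integral q) (derive1 (Abel qh 1) (cos t) * - sin t).
Proof.
move=> ht; apply: (@eq_is_derive _ 0 alpha (fun t => Abel qh 1 (cos t))) => //.
  by move=> z /g_integral_cos[_ ->].
exact: der_comp (is_derive_cos t) (C1_der C1A (cos_cap ht)).
Qed.

Lemma g_funE t : 0 < t < alpha -> g_fun q t = ghat qh (cos t).
Proof.
move=> ht; rewrite /g_fun (is_derive_derive1 (is_derive_g_integral ht)) /ghat.
have -> : Num.sqrt (1 - cos t ^+ 2) = sin t.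
  rewrite -sin2cos2 sqrtr_sqr ger0_norm//; apply: ltW; apply: (@sin_oo 0 alpha) => //.
  by case/andP: alpha_range.
by rewrite div1r; ring.
Qed.

Hypothesis C1g : C1 c 1 (ghat qh).
Hypothesis iH : forall y, c < y <= 1 ->
  lam.-integrable `]c, y[ (EFin \o (fun z => ghat qh z / Num.sqrt (y - z))).
Hypothesis C1H : C1 c 1 (Hfun c qh).

Lemma F_integral_cos phi : 0 < phi < alpha ->
  lam.-integrable `[phi, alpha] (EFin \o F_integrand q phi) /\
  F_integral q alpha phi = Hfun c qh (cos phi).
Proof.
move=> hp; have /andP[p0 pa] := hp; have /andP[al0 alpi] := alpha_range.
have cp := cos_cap hp.
pose f x := ghat qh x / Num.sqrt (cos phi - x).
have p0' := ltW p0.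
have cf x : cos alpha < x < cos phi -> {for x, continuous f}.
  rewrite -/c => hx; apply: cvgM; first by apply: (C1_continuous C1g); lra.
  by apply: c_sqr; case/andP: hx.
have E z : phi < z < alpha -> F_integrand q phi z = f (cos z) * sin z.
  by move=> hz; rewrite /F_integrand /f g_funE; [ring|lra].
have io : lam.-integrable `]phi, alpha[ (EFin \o F_integrand q phi).
  apply: (@eq_integrable_oo (fun z => f (cos z) * sin z)) => //.
  by apply: cos_integrable => //; apply: iH; lra.
split; first exact: integrable_oo_cc.
rewrite /F_integral Rintegral_cc_oo; last by apply/measurable_EFinP; case/integrableP : io.
rewrite /Hfun /Rintegral; congr fine.
rewrite (cos_subst p0' pa alpi cf)//.
by apply: eq_integral => z; rewrite inE/= in_itv/= => hz; rewrite E.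
Qed.

Lemma is_derive_F_integral phi : 0 < phi < alpha ->
  is_derive phi 1 (F_integral q alpha) (derive1 (Hfun c qh) (cos phi) * - sin phi).
Proof.
move=> hp; apply: (@eq_is_derive _ 0 alpha (fun t => Hfun c qh (cos t))) => //.
  by move=> z /F_integral_cos[_ ->].
exact: der_comp (is_derive_cos phi) (C1_der C1H (cos_cap hp)).
Qed.

Lemma F_funE phi : 0 < phi < alpha ->
  F_fun q alpha phi = - (2 / pi) * derive1 (Hfun c qh) (cos phi).
Proof.
move=> hp; rewrite /F_fun (is_derive_derive1 (is_derive_F_integral hp)).
have s0 : sin phi != 0.
  by rewrite gt_eqF//; apply: (@sin_oo 0 alpha) => //; case/andP: alpha_range.
move: (derive1 _ _) => h.
rewrite div1r -mulrA [X in _ * X](_ : _ = - h) ?mulrN ?mulNr//.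
by rewrite mulrCA mulVf// mulr1.
Qed.

End profile_integrals.
End angles.

(** * The equilibrium measure of a rotation invariant field *)

Section field.
Context {R : realType}.
Notation lam := (@lebesgue_measure R).
Local Notation V := 'rV[R]_3.
Local Notation B3 := (borelR3 R).
Local Notation L := (measurableTypeR R).
Local Notation S := (@sphere2 R : set B3).
Local Open Scope ereal_scope.
Variables (Q : V -> \bar R).
Hypotheses (Qext : external_field Q) (Qrot : rotation_invariant Q).

(** The field extended by 0 off the sphere, so that its integrals run over the
    whole space. *)
Definition field0 : B3 -> \bar R := Q \_ S.

Lemma field0E p : sphere2 p -> field0 p = Q p.
Proof. by move=> Sp; rewrite /field0 patchT// inE. Qed.

Lemma field0_ge0 p : 0 <= field0 p.
Proof.
have [Q0 _ _] := Qext; rewrite /field0 patchE; case: ifP => //.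
by rewrite inE; exact: Q0.
Qed.

(** Lower semicontinuity for the topology of the sphere, in terms of open sets
    of the space. *)
Lemma field_gt_open (s : R) : exists2 W : set V, open W &
  forall p, sphere2 p -> W p <-> s%:E < Q p.
Proof.
have [_ /lower_semicontinuousP /(_ s) /open_subspaceP[W oW WE] _] := Qext.
exists W => // p Sp; have := congr1 (fun X : set V => X p) WE.
rewrite /setI/= => h; split=> [Wp|sp].
  by have : (W p /\ sphere2 p) by []; rewrite h => -[].
by have : (s%:E < Q p /\ sphere2 p) by []; rewrite -h => -[].
Qed.

Lemma measurable_field0 : measurable_fun setT field0.
Proof.
have mS := @measurable_sphere2 R.
apply: (measurability _ (ErealGenOInfty.measurableE R)) => _ [_ [s ->] <-]; rewrite setTI.
have [W oW WE] := field_gt_open s.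
have mW := open_measurableR3 oW.
have [s0|s0] := leP 0%R s.
  rewrite [X in measurable X](_ : _ = W `&` S); first exact: measurableI.
  apply/seteqP; split=> p /=; rewrite in_itv/= andbT /field0 patchE; case: ifPn.
  - by rewrite inE => Sp sp; split => //; apply/WE.
  - by move=> _; rewrite lte_fin ltNge s0.
  - by rewrite inE => Sp [/WE]; exact.
  - by rewrite notin_setE => nS [].
rewrite [X in measurable X](_ : _ = (W `&` S) `|` ~` S).
  by apply: measurableU; [exact: measurableI|exact: measurableC].
apply/seteqP; split=> p /=; rewrite in_itv/= andbT /field0 patchE; case: ifPn.
- by rewrite inE => Sp sp; left; split => //; apply/WE.
- by rewrite notin_setE => nS _; right.
- by rewrite inE => Sp [[/WE]|//]; exact.
- by move=> _ _; rewrite lte_fin.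
Qed.

Lemma field0_lsc p (s : R) : sphere2 p -> s%:E < field0 p ->
  \forall x \near (p : V), sphere2 x -> s%:E < field0 x.
Proof.
move=> Sp; rewrite field0E// => sp; have [W oW WE] := field_gt_open s.
have Wp : W p by apply/WE.
by apply: filterS (open_nbhs_nbhs (conj oW Wp)) => x Wx Sx; rewrite field0E//; apply/WE.
Qed.

Lemma weighted_energyE m : on_sphere m ->
  weighted_energy Q m = menergy m m + 2%:E * \int[m]_x field0 x.
Proof.
move=> sm; rewrite /weighted_energy -(energy2E sm sm); congr (_ + _ * _).
by rewrite integral_mkcond.
Qed.

Lemma avg_field0 x : (-1 <= x <= 1)%R -> avg field0 x = Q (sphx 0 x).
Proof.
move=> x1; apply: avg_cst => t; rewrite field0E; last exact: sphx_sphere.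
by apply: Qrot; [exact: sphx_sphere|exact: sphx_sphere|rewrite !sphx2].
Qed.

Lemma measurable_avgk1 x : measurable_fun setT (avgk x : B3 -> \bar R).
Proof.
have mp : measurable_fun setT ((fun p => (x, p)) : B3 -> L * B3).
  by apply: measurable_fun_pair; [exact: measurable_cst|exact: measurable_id].
exact: (measurableT_comp (@measurable_avgk R) mp).
Qed.

Section cap.
Variables (mu : probability B3 R) (c : R).
Hypotheses (mu_eq : equilibrium_measure Q mu) (c1 : (-1 <= c)%R) (c2 : (c < 1)%R).
Hypothesis suppE : forall p : V, msupport mu p <-> sphere2 p /\ (c <= p 0 ord_max)%R.
Hypothesis Qfin : forall x : R, (c < x < 1)%R -> Q (sphx 0 x) = (qhat Q x)%:E.
Hypothesis hq : C1 c 1 (qhat Q).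

Let smu : on_sphere mu. Proof. by case: mu_eq. Qed.

Let x11 x : (c < x < 1)%R -> (-1 <= x <= 1)%R. Proof. by have := c1; lra. Qed.

Lemma weighted_energy_min k : on_sphere k ->
  menergy mu mu + 2%:E * \int[mu]_x field0 x <= menergy k k + 2%:E * \int[k]_x field0 x.
Proof.
move=> sk; rewrite -!weighted_energyE//; case: mu_eq => _ ->.
by apply: ereal_inf_lbound; exists k.
Qed.

(** A competitor of finite energy: the uniform law on a zone inside the cap,
    where the field is bounded. *)
Lemma weighted_energy_fin : menergy mu mu + 2%:E * \int[mu]_x field0 x < +oo.
Proof.
(* Any zone with c < a < b < 1 has this property. *)
pose a := ((3 * c + 1) / 4)%R; pose b := ((c + 1) / 2)%R.
have ca : (c < a)%R by rewrite /a; have := c2; lra.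
have ab : (a < b)%R by rewrite /a /b; have := c2; lra.
have b1 : (b < 1)%R by rewrite /b; have := c2; lra.
have a1 : (-1 <= a)%R by have := c1; lra.
have b1' := ltW b1.
have sk := on_sphere_zunif ab a1 b1'.
apply: le_lt_trans (weighted_energy_min sk) _.
apply: lte_add_pinfty; first exact: menergy_zunif.
apply: lte_mul_pinfty => //.
rewrite (integral_zunif ab measurable_field0 field0_ge0).
have [M M0 hM] := continuous_bounded (fun x => C1_continuous hq) ca b1.
apply: lte_mul_pinfty; [by rewrite lee_fin invr_ge0 subr_ge0 ltW|by []|].
apply: (@le_lt_trans _ _ (\int[lam]_(x in `[a, b]) (cst M%:E x))).
  apply: ge0_le_integral => //.
  - by move=> x _; apply: avg_ge0; exact: field0_ge0.
  - apply: measurable_funTS; apply: measurable_avg; [exact: measurable_field0|].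
    exact: field0_ge0.
  - by move=> x; rewrite /= in_itv/= => hx; rewrite avg_field0 ?Qfin ?lee_fin;
      [rewrite (le_trans (ler_norm _))// hM|lra|lra].
by rewrite integral_cst//= lebesgue_measure_itv/= lte_fin ab -EFinB -EFinM ltry.
Qed.

Lemma menergy_mu_fin : menergy mu mu < +oo.
Proof.
apply: le_lt_trans weighted_energy_fin; apply: leeDl.
by apply: mule_ge0 => //; apply: integral_ge0 => p _; exact: field0_ge0.
Qed.

Lemma field_mu_fin : \int[mu]_x field0 x < +oo.
Proof.
have i0 : 0 <= \int[mu]_x field0 x by apply: integral_ge0 => p _; exact: field0_ge0.
apply: le_lt_trans weighted_energy_fin.
apply: (@le_trans _ _ (2%:E * \int[mu]_x field0 x)); last by apply: leeDr; exact: menergy_ge0.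
by rewrite -[leLHS]mul1e lee_wpmul2r// lee_fin ler1n.
Qed.

Lemma FQ_JE : FQ Q mu = menergy mu mu + \int[mu]_x field0 x.
Proof.
have i0 : 0 <= \int[mu]_x field0 x by apply: integral_ge0 => p _; exact: field0_ge0.
have j0 := menergy_ge0 mu mu.
rewrite /FQ; case: mu_eq => _ <-; rewrite weighted_energyE//.
have -> : \int[mu]_(x in S) Q x = \int[mu]_x field0 x by rewrite integral_mkcond.
move: menergy_mu_fin field_mu_fin i0 j0; case: (menergy mu mu) => [r| |]//; case: (integral _ _ _) => [s| |]// _ _ _ _.
by rewrite -EFinM -!EFinD; congr EFin; ring.
Qed.

(** The modified Robin constant F_Q of the statement. *)
Definition robin : R := fine (FQ Q mu).

Lemma FQE : FQ Q mu = robin%:E.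
Proof.
rewrite /robin fineK// FQ_JE fin_numD !ge0_fin_numE ?menergy_ge0 ?menergy_mu_fin ?field_mu_fin//.
by apply: integral_ge0 => p _; exact: field0_ge0.
Qed.

Lemma robinE : menergy mu mu + \int[mu]_x field0 x = robin%:E.
Proof. by rewrite -FQ_JE FQE. Qed.

(** The points of the latitude x belong to the support, where the weighted
    potential is at most F_Q; then average. *)
Lemma potential_le x : (c < x < 1)%R -> avg (potential mu) x + (qhat Q x)%:E <= robin%:E.
Proof.
move=> hx; have x1 := x11 hx.
have ub t : potential mu (sphx t x) + (qhat Q x)%:E <= robin%:E.
  have := potential_support measurable_field0 field0_ge0 smu menergy_mu_fin field_mu_fin
    weighted_energy_min robinE (x0 := sphx t x).
  rewrite field0E; last exact: sphx_sphere.
  have -> : Q (sphx t x) = (qhat Q x)%:E.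
    by rewrite -Qfin//; apply: Qrot; [exact: sphx_sphere|exact: sphx_sphere|rewrite !sphx2].
  apply; [|exact: sphx_sphere|].
  - by apply/suppE; split; [exact: sphx_sphere|rewrite sphx2; lra].
  - move=> s sQ; apply: field0_lsc; first exact: sphx_sphere.
    rewrite field0E; last exact: sphx_sphere.
    apply: lt_le_trans sQ _; rewrite -Qfin// le_eqVlt; apply/orP; left; apply/eqP.
    by apply: Qrot; [exact: sphx_sphere|exact: sphx_sphere|rewrite !sphx2].
have h : avg (potential mu) x <= (robin - qhat Q x)%:E.
  rewrite -[leRHS](@avg_cst _ (fun=> (robin - qhat Q x)%:E) x)//.
  rewrite /avg lee_wpmul2l//; first by rewrite lee_fin invr_ge0 ltW// two_pi_gt0.
  apply: ge0_le_integral => //.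
  - by move=> t _; exact: potential_ge0.
  - apply: measurable_funTS; apply: measurableT_comp (@measurable_potential R mu) _.
    exact: measurable_sphxl.
  - by move=> t _; rewrite EFinB leeBrDr// ub.
by rewrite -leeBrDr// -EFinB.
Qed.

Lemma qhat_bounds x : (c < x < 1)%R -> (0 <= qhat Q x <= robin)%R.
Proof.
move=> hx; have x1 := x11 hx.
have [Q0 _ _] := Qext.
have q0 : (0 <= qhat Q x)%R by rewrite -lee_fin -Qfin//; apply: Q0; exact: sphx_sphere.
rewrite q0 -lee_fin; apply: le_trans (potential_le hx).
by rewrite leeDr//; apply: avg_ge0; exact: potential_ge0.
Qed.

Lemma robin_ge0 : (0 <= robin)%R.
Proof.
by rewrite -lee_fin -robinE adde_ge0 ?menergy_ge0//; apply: integral_ge0 => p _; exact: field0_ge0.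
Qed.

(** A latitude reduced to one point, which is not an atom because the energy
    is finite. *)
Lemma mu_pole : mu [set p : V | (p 0 ord_max)%R = 1%R] = 0.
Proof.
have mS := @measurable_sphere2 R; have m1 := @measurable_level R 1.
apply/eqP; rewrite eq_le measure_ge0 andbT.
have mp : measurable ([set sphx 0 1] : set B3).
  rewrite (_ : [set sphx 0 1] = S `&` [set p : V | (p 0 ord_max)%R = 1%R]); first exact: measurableI.
  apply/seteqP; split=> p /=.
    by move=> ->; rewrite sphx2; split=> //; apply: sphx_sphere; lra.
  move=> [Sp p1]; have [w _ ->] := sphere2_polar Sp; rewrite p1.
  by apply: eq_row3; rewrite ?sphx0 ?sphx1 ?sphx2// expr1n subrr sqrtr0 !mul0r.
have sub : [set p : V | (p 0 ord_max)%R = 1%R] `<=` ([set sphx 0 1] : set B3) `|` ~` S.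
  move=> p /= p1; have [Sp|] := pselect (sphere2 p); [left|by right].
  have [w _ ->] := sphere2_polar Sp; rewrite p1.
  by apply: eq_row3; rewrite ?sphx0 ?sphx1 ?sphx2// expr1n subrr sqrtr0 !mul0r.
have h : mu ([set sphx 0 1] `|` ~` S) = 0.
  rewrite (measureU0 mp (measurableC mS) (on_sphereC smu)).
  exact: finite_energy_atom menergy_mu_fin.
rewrite -h; apply: le_measure => //; rewrite inE//.
by apply: measurableU => //; exact: measurableC.
Qed.

Lemma mu_below : mu [set p : V | (p 0 ord_max < c)%R] = 0.
Proof.
have ms := @measurable_msupport R mu.
apply/eqP; rewrite eq_le measure_ge0 andbT.
have h := msupport_carrier mu.
rewrite -h; apply: le_measure; rewrite ?inE.
- rewrite (_ : mkset _ = setT `&` (fun p : V => (p 0 ord_max)%R) @^-1` `]-oo, c[).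
    by apply: (measurable_coord ord_max) => //; exact: measurable_itv.
  by rewrite setTI; apply/seteqP; split=> p /=; rewrite in_itv.
- exact: measurableC.
- by move=> p /= pc /suppE[_]; rewrite leNgt pc.
Qed.

(** On ]x, 1[ the integrand of cop x c is at least 1 / (z - c). *)
Lemma cop_log x : (c < x < 1)%R -> (ln ((1 - c) / (x - c)))%:E <= cop x c.
Proof.
move=> hx.
have -> : (ln ((1 - c) / (x - c)))%:E = \int[lam]_(z in `]x, 1%R[) ((z - c)^-1)%:E.
  rewrite ln_div ?posrE; [|lra|lra].
  apply/esym; apply: (@ge0_FTC_oo R (fun z => (z - c)^-1)%R (fun z => ln (z - c))%R).
  - by case/andP: hx.
  - move=> z hz; have z0 : (0 < z - c)%R by lra.
    apply: (der_eq (der_comp (derB (der_id z) (der_cst c z)) (is_derive1_ln z0))).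
    by rewrite subr0 mulr1.
  - move=> z hz; apply: cvgV; first by rewrite gt_eqF//; lra.
    by apply: cvgB; [exact: cvg_id|exact: cvg_cst].
  - by move=> z hz; rewrite invr_ge0; lra.
  - apply: cvg_at_right_filter; apply: (der_continuous (der_comp (derB (der_id x) (der_cst c x)) (is_derive1_ln _))).
    lra.
  - apply: cvg_at_left_filter; apply: (der_continuous (der_comp (derB (der_id _) (der_cst c _)) (is_derive1_ln _))).
    lra.
rewrite copE /copson max_l; last by lra.
apply: ge0_le_integral => //.
- by move=> z; rewrite /= in_itv/= => hz; rewrite lee_fin invr_ge0; lra.
- apply/measurable_EFinP; apply: measurable_fun_oo => z hz.
  apply: cvgV; first by rewrite gt_eqF//; lra.
  by apply: cvgB; [exact: cvg_id|exact: cvg_cst].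
- apply/measurable_EFinP; apply: measurable_fun_oo => z hz; apply: cvgV.
    by rewrite gt_eqF// !mulr_gt0// sqrtr_gt0; have := c1; nra.
  apply: cvgM; last exact: continuous_sqrtBl.
  apply: cvgM; last exact: continuous_sqrtBl.
  apply: C1_continuous (sqrt_circle_C1) _; have := c1; lra.
- move=> z; rewrite /= in_itv/= => hz; rewrite lee_fin lef_pV2 ?posrE; last 2 first.
  + by lra.
  + by rewrite !mulr_gt0// sqrtr_gt0; have := c1; nra.
  have zc : (0 <= z - c)%R by lra.
  rewrite -[leRHS](sqr_sqrtr zc) expr2 ler_wpM2r ?sqrtr_ge0//.
  rewrite -[leRHS]mul1r ler_pM ?sqrtr_ge0//.
    by rewrite -[leRHS]sqrtr1 ler_wsqrtr// lerBlDr lerDl sqr_ge0.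
  by rewrite ler_wsqrtr//; lra.
Qed.

(** If the rim had mass e, the averaged potential at height x > c would be at
    least e / pi times cop x c, which tends to infinity as x tends to c,
    whereas it is at most F_Q. *)
Lemma mu_rim : mu [set p : V | (p 0 ord_max)%R = c] = 0.
Proof.
have mc := @measurable_level R c.
apply/eqP; rewrite eq_le measure_ge0 andbT leNgt; apply/negP => e0.
have efin : mu [set p : V | (p 0 ord_max)%R = c] \is a fin_num by exact: fin_num_measure.
set e := fine (mu [set p : V | (p 0 ord_max)%R = c]).
have eE : mu [set p : V | (p 0 ord_max)%R = c] = e%:E by rewrite /e fineK.
have {}e0 : (0 < e)%R by rewrite -lte_fin -eE.
have pip : (0 < pi :> R)%R := pi_gt0 R.
have key x : (c < x < 1)%R -> (ln ((1 - c) / (x - c)) * e <= pi * robin)%R.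
  move=> hx; have hx1 : (-1 <= x < 1)%R by have := c1; lra.
  have qb := qhat_bounds hx.
  have UF : avg (potential mu) x <= robin%:E.
    apply: le_trans (potential_le hx); rewrite leeDl// lee_fin; lra.
  rewrite mulrC -ler_pdivrMl//  -lee_fin.
  have ln0 : (0 <= ln ((1 - c) / (x - c)))%R.
    by rewrite ln_ge0// ler_pdivlMr; lra.
  have if0 (p : B3) : 0 <= ((pi^-1 * ln ((1 - c) / (x - c))) *
      \1_[set p : V | (p 0 ord_max)%R = c] p)%:E.
    by rewrite lee_fin mulr_ge0// mulr_ge0// invr_ge0 ltW.
  apply: le_trans UF; rewrite avg_potential.
  apply: (@le_trans _ _ (\int[mu]_p ((pi^-1 * ln ((1 - c) / (x - c))) *
      \1_[set p : V | (p 0 ord_max)%R = c] p)%:E)).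
    under eq_integral do rewrite EFinM.
    rewrite ge0_integralZl//; last 2 first.
    - by apply/measurable_EFinP; exact: measurable_indic.
    - by rewrite lee_fin mulr_ge0// invr_ge0 ltW.
    rewrite integral_indic// setIT.
    rewrite [X in _ * X](_ : _ = e%:E); last exact: eE.
    by rewrite -EFinM lee_fin [(e * _)%R]mulrC mulrA.
  rewrite [leRHS](@ge0_negligible_integral _ _ _ mu setT (~` S))//; last 4 first.
  - by apply: measurableC; exact: measurable_sphere2.
  - exact: measurable_avgk1.
  - by move=> p _; exact: avgk_ge0.
  - exact: on_sphereC.
  rewrite [leLHS](@ge0_negligible_integral _ _ _ mu setT (~` S))//; last 3 first.
  - by apply: measurableC; exact: measurable_sphere2.
  - apply/measurable_EFinP; apply: measurable_funM; first exact: measurable_cst.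
    exact: measurable_indic.
  - exact: on_sphereC.
  rewrite setTD setCK; apply: ge0_le_integral => //.
  - exact: measurable_sphere2.
  - apply/measurable_EFinP; apply: measurable_funM; first exact: measurable_cst.
    by apply: measurable_funTS; exact: measurable_indic.
  - by apply: measurable_funTS; exact: measurable_avgk1.
  - move=> p Sp; rewrite indicE; case: (boolP (_ \in _)) => [|_].
      rewrite inE => /= pc.
      have px : (p : V) 0%R ord_max != x by rewrite pc lt_eqF//; case/andP: hx.
      have p1 : ((p : V) 0 ord_max < 1)%R by rewrite pc.
      rewrite mulr1 (avgk_cop hx1 Sp p1 px) pc.
      by rewrite EFinM lee_wpmul2l ?cop_log// lee_fin invr_ge0 ltW.
    by rewrite mulr0 avgk_ge0.
(* At height c + (1 - c) exp (- K) the logarithm in cop_log equals K. *)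
pose K := ((pi * robin + 1) / e)%R.
have K0 : (0 < K)%R by rewrite divr_gt0//; have := robin_ge0; nra.
have eK : (expR (- K) < 1)%R by rewrite expR_lt1 oppr_lt0.
have eK0 := expR_gt0 (- K).
have := key (c + (1 - c) * expR (- K))%R.
rewrite [(c + _ - c)%R]addrC addKr invfM mulVKf; last by rewrite gt_eqF//; have := c2; lra.
rewrite -expRN opprK expRK /K divfK ?gt_eqF// => /(_ _).
by have := c2; nra.
Qed.

(** On ]c, 1[ the averaged weighted potential is at most F_Q; by Euler-
    Lagrange for the competitor uniform on this interval its mean is at least
    F_Q. *)
Lemma avg_potential_ae :
  ae_eq lam [set` `]c, 1%R[] (avg (potential mu) : L -> \bar R) (fun x => (robin - qhat Q x)%:E).
Proof.
have cq x : (c < x < 1)%R -> {for x, continuous (qhat Q)} := C1_continuous hq.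
have mU : measurable_fun setT (avg (potential mu) : L -> _).
  by apply: measurable_avg; [exact: measurable_potential|exact: potential_ge0].
have mq : measurable_fun `]c, 1%R[ (fun x => (robin - qhat Q x)%:E).
  apply/measurable_EFinP; apply: measurable_fun_oo => x hx.
  by apply: cvgB; [exact: cvg_cst|exact: cq].
have mq' : measurable_fun `]c, 1%R[ (fun x => (qhat Q x)%:E).
  by apply/measurable_EFinP; apply: measurable_fun_oo => x hx; exact: cq.
have bnd (f : L -> \bar R) : (forall x, (c < x < 1)%R -> 0 <= f x <= robin%:E) ->
    measurable_fun `]c, 1%R[ f -> \int[lam]_(x in `]c, 1%R[) f x < +oo.
  move=> hf mf; apply: (@le_lt_trans _ _ (\int[lam]_(x in `]c, 1%R[) (cst robin%:E x))).
    apply: ge0_le_integral => //.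
    - by move=> x; rewrite /= in_itv/= => /hf/andP[].
    - by move=> x; rewrite /= in_itv/= => /hf/andP[].
  by rewrite integral_cst//= lebesgue_measure_itv/= lte_fin c2 -EFinB -EFinM ltry.
have c1x x : (c < x < 1)%R -> 0 <= avg (potential mu) x <= robin%:E.
  move=> hx; rewrite avg_ge0; last by move=> p; exact: potential_ge0.
  by apply: le_trans (potential_le hx); rewrite leeDl// lee_fin; case/andP: (qhat_bounds hx).
have c2x x : (c < x < 1)%R -> 0 <= (robin - qhat Q x)%:E <= robin%:E.
  by move=> hx; have := qhat_bounds hx; rewrite !lee_fin; lra.
have c3x x : (c < x < 1)%R -> 0 <= (qhat Q x)%:E <= robin%:E.
  by move=> hx; have := qhat_bounds hx; rewrite !lee_fin; lra.
have i1 : lam.-integrable `]c, 1%R[ (avg (potential mu) : L -> _).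
  apply/integrableP; split; first exact: measurable_funTS.
  under eq_integral => x xc.
    rewrite gee0_abs; last by apply: avg_ge0 => p; exact: potential_ge0.
    over.
  by apply: bnd => //; exact: measurable_funTS.
have i2 : lam.-integrable `]c, 1%R[ (fun x => (robin - qhat Q x)%:E).
  apply/integrableP; split => //.
  under eq_integral => x xc.
    rewrite gee0_abs; last by move: xc; rewrite inE/= in_itv/= => /c2x/andP[].
    over.
  exact: bnd.
have E : \int[lam]_(x in `]c, 1%R[) ((robin - qhat Q x)%:E - avg (potential mu) x) = 0.
  have le0 x : (c < x < 1)%R -> 0 <= (robin - qhat Q x)%:E - avg (potential mu) x.
    move=> hx; rewrite sube_ge0 ?orbT//.
    by rewrite EFinB leeBrDr// potential_le.
  apply/eqP; rewrite eq_le; apply/andP; split; last first.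
    by apply: integral_ge0 => x; rewrite /= in_itv/=; exact: le0.
  rewrite integralB//.
  have := euler_lagrange measurable_field0 field0_ge0 smu (on_sphere_zunif c2 c1 (lexx 1%R))
    weighted_energy_min menergy_mu_fin field_mu_fin (menergy_zunif c2 c1 (lexx 1%R)).
  rewrite robinE (integral_zunif c2 (@measurable_potential R mu) (@potential_ge0 R mu)).
  rewrite (integral_zunif c2 measurable_field0 field0_ge0).
  have oo (h : R -> \bar R) : measurable_fun setT h ->
      \int[lam]_(x in `[c, 1%R]) h x = \int[lam]_(x in `]c, 1%R[) h x.
    by move=> mh; rewrite integral_itv_bndoo//; exact: measurable_funTS.
  have mf : measurable_fun setT (avg field0 : L -> _).
    by apply: measurable_avg; [exact: measurable_field0|exact: field0_ge0].
  rewrite (oo _ mU) (oo _ mf).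
  rewrite [X in _ + _ * X](_ : _ = \int[lam]_(x in `]c, 1%R[) (qhat Q x)%:E); last first.
    by apply: eq_integral => x; rewrite inE/= in_itv/= => hx; rewrite avg_field0 ?Qfin//; exact: x11.
  have -> : \int[lam]_(x in `]c, 1%R[) (robin - qhat Q x)%:E =
      robin%:E * (1 - c)%:E - \int[lam]_(x in `]c, 1%R[) (qhat Q x)%:E.
    under eq_integral do rewrite EFinB.
    rewrite integralB//.
    - by rewrite integral_cst//= lebesgue_measure_itv/= lte_fin c2.
    - apply/integrableP; split => //.
      by apply: bnd => // x hx; rewrite gee0_abs lee_fin ?robin_ge0 ?lexx.
    - apply/integrableP; split => //.
      under eq_integral => x xc.
        rewrite gee0_abs; last by move: xc; rewrite inE/= in_itv/= => /c3x/andP[].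
        over.
      exact: bnd.
  have := bnd _ c1x (measurable_funTS mU); have := bnd _ c3x mq'.
  have : 0 <= \int[lam]_(x in `]c, 1%R[) (qhat Q x)%:E.
    by apply: integral_ge0 => x; rewrite /= in_itv/= => /c3x/andP[].
  have : 0 <= \int[lam]_(x in `]c, 1%R[) avg (potential mu) x.
    by apply: integral_ge0 => x; rewrite /= in_itv/= => /c1x/andP[].
  case: (integral _ _ _) => [r| |]//; case: (integral _ _ _) => [s| |]// _ _ _ _.
  rewrite -!EFinM -!EFinD !lee_fin -mulrDr ler_pdivlMl ?subr_gt0// => h.
  lra.
have := (ae_eq_integral_abs lam (measurable_itv `]c, 1%R[) (f := fun x => (robin - qhat Q x)%:E - avg (potential mu) x)).
move=> /(_ (emeasurable_funB mq (measurable_funTS mU)))[h _].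
have /h : \int[lam]_(x in `]c, 1%R[) `|(robin - qhat Q x)%:E - avg (potential mu) x| = 0.
  rewrite -[RHS]E; apply: eq_integral => x; rewrite inE/= in_itv/= => hx.
  rewrite gee0_abs// sube_ge0 ?orbT//.
  by rewrite EFinB leeBrDr// potential_le.
apply: filterS => x hx xc; have := hx xc; move: xc; rewrite /= in_itv/= => /c1x/andP[].
case: (avg _ _) => [r| |]// _ _; rewrite -EFinB => -[] /eqP; rewrite subr_eq0 => /eqP ->//.
Qed.

Lemma mu_Smean w : (c < w < 1)%R ->
  \int[lam]_(z in `]w, 1%R[) (Smean mu z * (wr z)%:E) =
  \int[lam]_(x in `]w, 1%R[) ((robin - qhat Q x) / Num.sqrt (x - w))%:E.
Proof.
move=> hw; have w1 : (-1 <= w < 1)%R by have := c1; lra.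
rewrite -(abel_avg_potential smu mu_pole w1).
have mU : measurable_fun setT (avg (potential mu) : L -> _).
  by apply: measurable_avg; [exact: measurable_potential|exact: potential_ge0].
have mk : measurable_fun `]w, 1%R[ (fun x => ((Num.sqrt (x - w))^-1)%:E).
  apply/measurable_EFinP; apply: measurable_fun_oo => x hx.
  by apply: cvgV; [rewrite gt_eqF// sqrtr_gt0; lra|exact: continuous_sqrtBl].
apply: ae_eq_integral => //.
- by apply: emeasurable_funM => //; exact: measurable_funTS.
- apply/measurable_EFinP; apply: measurable_fun_oo => x hx.
  apply: cvgM; first by apply: cvgB; [exact: cvg_cst|apply: (C1_continuous hq); lra].
  by apply: cvgV; [rewrite gt_eqF// sqrtr_gt0; lra|exact: continuous_sqrtBl].
have wc : `]w, 1%R[%classic `<=` `]c, 1%R[%classic.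
  by move=> x; rewrite /= !in_itv/=; lra.
apply: filterS avg_potential_ae => x hx /wc xc; rewrite hx// -EFinM//.
Qed.

Definition cap_cdf (y : R) : R := fine (mu [set p : V | (p 0 ord_max < y)%R]).

Lemma mu_Smean_cdf y : (c < y <= 1)%R ->
  \int[lam]_(z in `]c, y[) (Smean mu z * ((Num.sqrt (y - z))^-1)%:E) = (pi * cap_cdf y)%:E.
Proof.
move=> hy; rewrite (abel_Smean y mu_below) EFinM /cap_cdf fineK// fin_num_measure//.
rewrite (_ : mkset _ = setT `&` (fun p : V => (p 0 ord_max)%R) @^-1` `]-oo, y[).
  by apply: (measurable_coord ord_max) => //; exact: measurable_itv.
by rewrite setTI; apply/seteqP; split=> p /=; rewrite in_itv.
Qed.

End cap.
End field.

(** * The law of the polar angle *)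

Section angle_law.
Context {R : realType}.
Notation lam := (@lebesgue_measure R).
Local Notation V := 'rV[R]_3.
Local Notation B3 := (borelR3 R).
Local Notation L := (measurableTypeR R).
Implicit Types (t : R) (p : V).

Lemma measure_eq_off d (T : measurableType d) (m : {measure set T -> \bar R})
    (N A B : set T) : measurable N -> measurable A -> measurable B -> m N = 0%E ->
  (forall x, ~ N x -> A x <-> B x) -> m A = m B.
Proof.
move=> mN + + N0; have le C D : measurable C -> measurable D ->
    (forall x, ~ N x -> C x -> D x) -> (m C <= m D)%E.
  move=> mC mD CD; rewrite -(measureU0 mD mN N0); apply: le_measure; rewrite ?inE//.
    exact: measurableU.
  by move=> x Cx; have [|nN] := pselect (N x); [right|left; exact: CD].
by move=> mA mB AB; apply/eqP; rewrite eq_le !le// => x /AB[].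
Qed.

(** The polar angle as a function of the height, set to 0 at the poles and
    outside [-1, 1]; mu does not charge these heights. *)
Definition angle : L -> L := acos \_ [set` `](-1), 1[].

Lemma angleE (x : R) : -1 < x < 1 -> angle x = acos x.
Proof. by move=> hx; rewrite /angle patchT// inE/= in_itv. Qed.

Lemma measurable_angle : measurable_fun setT angle.
Proof.
apply/(measurable_restrictT _ (measurable_itv _)).
by apply: measurable_fun_oo => x; exact: continuous_acos.
Qed.

Lemma measurable_latitude (k : R -> \bar R) : measurable_fun setT k ->
  measurable_fun setT (fun p : B3 => k ((p : V) 0 ord_max)%R).
Proof. by move=> mk; exact: (measurableT_comp mk (measurable_coord ord_max)). Qed.

Variables (mu : probability B3 R) (alpha : R) (psi : R -> R).
Hypothesis alpha_range : 0 < alpha <= pi.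
Let c := cos alpha.
Hypothesis mu_out : mu (~` [set p : V | c < p 0 ord_max < 1]) = 0%E.
Hypothesis dM : forall y, c < y < 1 -> is_derive y 1 (cap_cdf mu) (psi y).
Hypothesis cpsi : forall y, c < y < 1 -> {for y, continuous psi}.

Let n := distribution mu (mfun_of (measurableT_comp measurable_angle (measurable_coord ord_max))).

Let c1 : -1 <= c. Proof. exact: cos_geN1. Qed.

Lemma angle_cap (x : R) : c < x < 1 -> 0 < angle x < alpha /\ cos (angle x) = x.
Proof.
move=> hx; have x1 : -1 < x < 1 by have := c1; lra.
rewrite angleE// acosK; last by rewrite in_itv/=; lra.
split=> //; rewrite acos_gt0/=; last by lra.
rewrite -ltr_cos ?in_itv/=; last 2 first.
- by rewrite acos_ge0 ?acos_lepi//; lra.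
- by have := alpha_range; lra.
by rewrite acosK ?in_itv/=; [case/andP: hx|lra].
Qed.

Lemma cap_angle t : 0 < t < alpha -> angle (cos t) = t.
Proof.
move=> ht; rewrite angleE; last by have := cos_cap alpha_range ht; have := c1; rewrite /c; lra.
by rewrite cosK// in_itv/=; have := alpha_range; lra.
Qed.

Let m_in : measurable ([set p : V | c < p 0 ord_max < 1] : set B3).
Proof.
rewrite (_ : mkset _ = setT `&` (fun p : V => p 0 ord_max) @^-1` [set` `]c, 1[]).
  by apply: (measurable_coord ord_max) => //; exact: measurable_itv.
by rewrite setTI; apply/seteqP; split=> p /=; rewrite in_itv.
Qed.

Let nE (B : set R) : measurable B -> n B = mu [set p : V | B (angle (p 0 ord_max))].
Proof. by []. Qed.

Let m_angle (B : set R) : measurable B ->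
  measurable ([set p : V | B (angle (p 0 ord_max))] : set B3).
Proof.
move=> mB; rewrite (_ : mkset _ = setT `&` (angle \o (fun p : V => p 0 ord_max)) @^-1` B).
  by apply: (measurableT_comp measurable_angle (measurable_coord ord_max)).
by rewrite setTI.
Qed.

Let n_out : n (~` [set` `]0, alpha[]) = 0%E.
Proof.
rewrite nE; last by apply: measurableC; exact: measurable_itv.
rewrite -(measure0 mu); apply: (measure_eq_off (measurableC m_in)) => //.
  by apply: m_angle; apply: measurableC; exact: measurable_itv.
move=> p /= /contrapT /angle_cap[h _]; split=> // h'; exact: h'.
Qed.

Let n_tail t : 0 < t < alpha -> n [set` `]t, alpha[] = (cap_cdf mu (cos t))%:E.
Proof.
move=> ht; have cdfE : (cap_cdf mu (cos t))%:E = mu [set p : V | p 0 ord_max < cos t].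
  rewrite /cap_cdf fineK// fin_num_measure//.
  rewrite (_ : mkset _ = setT `&` (fun p : V => p 0 ord_max) @^-1` `]-oo, (cos t)[).
    by apply: (measurable_coord ord_max) => //; exact: measurable_itv.
  by rewrite setTI; apply/seteqP; split=> p /=; rewrite in_itv.
rewrite cdfE nE; last exact: measurable_itv.
apply: (measure_eq_off (measurableC m_in)) => //.
- by apply: m_angle; exact: measurable_itv.
- rewrite (_ : mkset _ = setT `&` (fun p : V => p 0 ord_max) @^-1` `]-oo, (cos t)[).
    by apply: (measurable_coord ord_max) => //; exact: measurable_itv.
  by rewrite setTI; apply/seteqP; split=> p /=; rewrite in_itv.
move=> p /= /contrapT /angle_cap[/andP[h1 h2] h3]; rewrite in_itv/= h2 andbT.
rewrite -[in X in _ <-> is_true X]h3 ltr_cos ?in_itv//=; have := alpha_range; lra.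
Qed.

Let phi t := psi (cos t) * sin t.

Let dPhi t : 0 < t < alpha -> is_derive t 1 (fun t => cap_cdf mu (cos t)) (- phi t).
Proof.
move=> ht; apply: (der_eq (der_comp (is_derive_cos t) (dM (cos_cap alpha_range ht)))).
by rewrite mulrN.
Qed.

Let cphi t : 0 < t < alpha -> {for t, continuous phi}.
Proof.
move=> ht; have /andP[al0 alpi] := alpha_range.
by apply: (cos_subst_continuous (lexx 0) alpi) ht => x; rewrite cos0; exact: cpsi.
Qed.

Lemma angle_density_ge0 t : 0 < t < alpha -> 0 <= psi (cos t) * sin t.
Proof. exact: (tail_density_ge0 (n := n) dPhi n_tail). Qed.

(** The law of the polar angle has tails cap_cdf mu (cos t), hence the density
    - d/dt cap_cdf mu (cos t) = psi (cos t) sin t. *)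
Lemma integral_latitude (k : R -> \bar R) : measurable_fun setT k -> (forall x, (0 <= k x)%E) ->
  (\int[mu]_p k ((p : V) 0 ord_max)%R =
   \int[lam]_(t in `]0%R, alpha[) (k (cos t) * (psi (cos t) * sin t)%:E))%E.
Proof.
move=> mk k0; have al0 : 0 < alpha by case/andP: alpha_range.
have mkc : measurable_fun setT (k \o @cos R).
  by apply: measurableT_comp mk _; apply: continuous_measurable_fun; exact: continuous_cos.
rewrite -[RHS](ge0_integral_tail_density al0 n_out dPhi cphi n_tail mkc)//; last by move=> x; exact: k0.
rewrite /n ge0_integral_distribution//; last by move=> x; exact: k0.
apply: (ge0_integral_eq_off (R := R) (measurableC m_in)) => //.
- exact: measurable_latitude.
- apply: measurableT_comp mkc _.
  exact: measurableT_comp measurable_angle (measurable_coord ord_max).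
- by move=> p; exact: k0.
- by move=> p /= /contrapT /angle_cap[_ ->].
Qed.

Lemma integral_angle_density :
  (\int[lam]_(t in `]0%R, alpha[) (psi (cos t) * sin t)%:E = 1)%E.
Proof.
have := integral_latitude (@measurable_cst _ _ _ _ setT (1%E : \bar R)) (fun=> lee01).
have -> : (\int[mu]_p cst 1 ((p : V) 0%R ord_max) = 1 :> \bar R)%E.
  by apply: (etrans (integral_cst mu measurableT 1%E)); rewrite mul1e; exact: probability_setT.
by move=> ->; apply: eq_integral => t _; rewrite mul1e.
Qed.

Lemma latitude_atom (x : R) : c < x < 1 -> mu [set p : V | p 0 ord_max = x] = 0%E.
Proof.
move=> hx; have mx := @measurable_level R x.
pose k (y : R) : \bar R := (\1_[set x] y)%:E.
have mk : measurable_fun setT k by apply/measurable_EFinP; exact: measurable_indic.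
transitivity (\int[mu]_p k ((p : V) 0 ord_max)%R)%E.
  transitivity (\int[mu]_p (\1_[set p : V | (p 0 ord_max)%R = x] (p : V))%:E)%E.
    by rewrite integral_indic ?setIT.
  apply: eq_integral => p _.
  by rewrite /k !indicE; congr (_%:R%:E); congr nat_of_bool; apply/idP/idP; rewrite !inE.
rewrite (integral_latitude mk)//; last by move=> y; rewrite lee_fin.
have [ax cx] := angle_cap hx.
rewrite (@ge0_negligible_integral _ _ _ lam [set` `]0, alpha[] [set angle x])//.
- rewrite integral0_eq// => t [/=]; rewrite in_itv/= => ht nt.
  rewrite /k indicE memNset ?mul0e//= => ctx; apply: nt.
  by rewrite -ctx cap_angle.
- apply: emeasurable_funM.
    apply: measurable_funTS; apply: measurableT_comp mk _.
    by apply: continuous_measurable_fun; exact: continuous_cos.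
  by apply/measurable_EFinP; exact: measurable_fun_oo.
- move=> t; rewrite /= in_itv/= => ht; rewrite mule_ge0 ?lee_fin//.
  exact: angle_density_ge0.
- exact: lebesgue_measure_set1.
Qed.

End angle_law.

(** * Rotation invariance of the equilibrium measure *)

Section rotation_average.
Context {R : realType}.
Local Notation V := 'rV[R]_3.
Local Notation B3 := (borelR3 R).
Local Notation L := (measurableTypeR R).
Local Notation S := (@sphere2 R : set B3).
Local Open Scope ereal_scope.
Variable mu : probability B3 R.
Hypothesis smu : on_sphere mu.

Lemma measurable_height : measurable_fun setT ((fun p : V => (p 0 ord_max)%R) : B3 -> L).
Proof. exact: measurable_coord. Qed.

Definition latitude_law : probability L R :=
  distribution mu (mfun_of measurable_height).

(** The mean of mu over all rotations about the polar axis. *)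
Definition rotmean : probability B3 R := zon latitude_law.

Lemma integral_rotmean (h : B3 -> \bar R) : measurable_fun setT h -> (forall p, 0 <= h p) ->
  \int[rotmean]_p h p = \int[mu]_p avg h ((p : V) 0 ord_max)%R.
Proof.
move=> mh h0; rewrite /rotmean integral_zon// /latitude_law ge0_integral_distribution//.
  exact: measurable_avg.
by move=> x; exact: avg_ge0.
Qed.

Lemma on_sphere_rotmean : on_sphere rotmean.
Proof.
have mS := @measurable_sphere2 R.
have mo : measurable (~` [set` `[(-1)%R, 1%R]] : set R) by apply: measurableC; exact: measurable_itv.
apply: on_sphere_zon.
rewrite (_ : latitude_law _ = mu [set p : V | (~` [set` `[(-1)%R, 1%R]]) (p 0 ord_max)%R])//.
rewrite -(measure0 mu); apply: (measure_eq_off (measurableC mS)) => //.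
- rewrite (_ : mkset _ = setT `&` (fun p : V => (p 0 ord_max)%R) @^-1` (~` [set` `[(-1)%R, 1%R]])).
    exact: (measurable_coord ord_max).
  by rewrite setTI.
- exact: on_sphereC.
- move=> p /= /contrapT Sp; split=> //; apply; rewrite in_itv/= -ler_norml.
  exact: sphere2_coord.
Qed.

Section cap.
Variables (Q : V -> \bar R) (c : R).
Hypotheses (Qext : external_field Q) (Qrot : rotation_invariant Q).
Hypotheses (mu_eq : equilibrium_measure Q mu) (c1 : (-1 <= c)%R) (c2 : (c < 1)%R).
Hypothesis suppE : forall p : V, msupport mu p <-> sphere2 p /\ (c <= p 0 ord_max)%R.
Hypothesis Qfin : forall x : R, (c < x < 1)%R -> Q (sphx 0 x) = (qhat Q x)%:E.
Hypothesis hq : C1 c 1 (qhat Q).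

Let off : set B3 := ([set p : V | (p 0 ord_max < c)%R] `|` [set p : V | (p 0 ord_max)%R = c])
  `|` ([set p : V | (p 0 ord_max)%R = 1%R] `|` ~` S).

Let m_off : measurable off /\ mu off = 0.
Proof.
have mS := @measurable_sphere2 R.
have m1 := @measurable_level R 1; have m2 := @measurable_level R c.
have m3 : measurable ([set p : V | (p 0 ord_max < c)%R] : set B3).
  rewrite (_ : mkset _ = setT `&` (fun p : V => (p 0 ord_max)%R) @^-1` `]-oo, c[).
    by apply: (measurable_coord ord_max) => //; exact: measurable_itv.
  by rewrite setTI; apply/seteqP; split=> p /=; rewrite in_itv.
have h1 : mu ([set p : V | (p 0 ord_max < c)%R] `|` [set p : V | (p 0 ord_max)%R = c]) = 0.
  rewrite (measureU0 m3 m2); first exact: mu_below suppE.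
  exact: (mu_rim Qext Qrot mu_eq c1 c2 suppE Qfin hq).
have h2 : mu ([set p : V | (p 0 ord_max)%R = 1%R] `|` ~` S) = 0.
  rewrite (measureU0 m1 (measurableC mS) (on_sphereC smu)).
  exact: (mu_pole Qext Qrot mu_eq c1 c2 Qfin hq).
split; first by apply: measurableU; apply: measurableU => //; exact: measurableC.
rewrite /off (measureU0 _ _ h2)//; first exact: measurableU.
by apply: measurableU => //; exact: measurableC.
Qed.

Let off_in p : ~ off p -> sphere2 p /\ (c < (p : V) 0 ord_max < 1)%R.
Proof.
move=> np; have Sp : sphere2 p by apply: contrapT => h; apply: np; right; right.
have := sphere2_coord ord_max Sp; rewrite ler_norml => /andP[_ p1].
split=> //; rewrite !lt_neqAle p1 andbT [(c <= _)%R]leNgt -andbA; apply/and3P; split.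
- by apply/eqP => h; apply: np; left; right; rewrite /= h.
- by apply/negP => h; apply: np; left; left.
- by apply/eqP => h; apply: np; right; left.
Qed.

Lemma mu_off_cap : mu (~` [set p : V | (c < p 0 ord_max < 1)%R]) = 0.
Proof.
have [mo o0] := m_off.
rewrite -(measure0 mu); apply: (measure_eq_off mo) => //.
- apply: measurableC.
  rewrite (_ : mkset _ = setT `&` (fun p : V => (p 0 ord_max)%R) @^-1` [set` `]c, 1%R[]).
    by apply: (measurable_coord ord_max) => //; exact: measurable_itv.
  by rewrite setTI; apply/seteqP; split=> p /=; rewrite in_itv.
- by move=> p /off_in[_ h]; split=> // h'; apply: h'.
Qed.

Hypothesis atom : forall x : R, (c < x < 1)%R -> mu [set p : V | (p 0 ord_max)%R = x] = 0.

(** The averaged kernel depends on the pole only through its height, except on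
    the null latitude x. *)
Lemma avg_potential_rotmean (x : R) : (c < x < 1)%R -> avg (potential rotmean) x = avg (potential mu) x.
Proof.
move=> hx; have hx1 : (-1 <= x < 1)%R by have := c1; lra.
have [mo o0] := m_off; have mx := @measurable_level R x.
rewrite !avg_potential integral_rotmean; [|exact: measurable_avgk1|exact: avgk_ge0].
pose N : set B3 := off `|` [set p : V | (p 0 ord_max)%R = x].
have mN : measurable N by exact: measurableU.
have N0 : mu N = 0 by rewrite /N (measureU0 mo mx)//; exact: atom.
have mav : measurable_fun setT (avg (avgk x) : L -> \bar R).
  by apply: measurable_avg; [exact: measurable_avgk1|exact: avgk_ge0].
apply: (ge0_integral_eq_off mN N0).
- exact: measurable_latitude mav.
- exact: measurable_avgk1.
- by move=> p; apply: avg_ge0; exact: avgk_ge0.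
- by move=> p; exact: avgk_ge0.
move=> p /not_orP[/off_in[Sp hp] /= /eqP px]; apply: avg_cst => t.
have p1 : ((p : V) 0 ord_max < 1)%R by case/andP: hp.
rewrite (avgk_cop hx1 Sp p1 px) avgk_cop ?sphx2//.
by apply: sphx_sphere; have := c1; lra.
Qed.

Lemma integral_field_rotmean : \int[rotmean]_p field0 Q p = \int[mu]_p field0 Q p.
Proof.
have mQ := measurable_field0 Qext; have Q0 := field0_ge0 Qext.
have [mo o0] := m_off.
rewrite integral_rotmean//; apply: (ge0_integral_eq_off (R := R) mo) => //.
- by apply: measurable_latitude; exact: measurable_avg.
- by move=> p; exact: avg_ge0.
move=> p /off_in[Sp hp]; have p1 : (-1 <= (p : V) 0 ord_max <= 1)%R by have := c1; lra.
rewrite avg_field0// field0E//; apply: Qrot => //; first exact: sphx_sphere.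
by rewrite sphx2.
Qed.

(** The averaged potential bound gives I(rotmean, mu) <= I(mu, mu), Euler-
    Lagrange for rotmean gives the converse, and I(rotmean, rotmean) =
    I(rotmean, mu) because the averaged potentials agree. Hence all three
    energies coincide, and strict positive definiteness identifies mu with its
    rotation mean. *)
Lemma rotmean_eq A : measurable A -> mu A = rotmean A.
Proof.
have mQ := measurable_field0 Qext; have Q0 := field0_ge0 Qext.
have [mo o0] := m_off; have sr := on_sphere_rotmean.
have Jfin : menergy mu mu < +oo := menergy_mu_fin Qext Qrot mu_eq c1 c2 Qfin hq.
have Qmu : \int[mu]_x field0 Q x < +oo := field_mu_fin Qext Qrot mu_eq c1 c2 Qfin hq.
have FE := robinE Qext Qrot mu_eq c1 c2 Qfin hq.
have mavg n : measurable_fun setT (avg (potential n) : L -> \bar R).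
  by apply: measurable_avg; [exact: measurable_potential|exact: potential_ge0].
have a0 n x : 0 <= avg (potential n) x by apply: avg_ge0; exact: potential_ge0.
have J1 : menergy rotmean mu = \int[mu]_p avg (potential mu) ((p : V) 0 ord_max)%R.
  by rewrite /menergy integral_rotmean//; [exact: measurable_potential|exact: potential_ge0].
have J2 : menergy rotmean rotmean = menergy rotmean mu.
  rewrite J1 {1}/menergy integral_rotmean; [|exact: measurable_potential|exact: potential_ge0].
  apply: (ge0_integral_eq_off (R := R) mo o0).
  - exact: measurable_latitude (mavg _).
  - exact: measurable_latitude (mavg _).
  - by move=> p; exact: a0.
  - by move=> p; exact: a0.
  by move=> p /off_in[_ /avg_potential_rotmean].
have i0 : 0 <= \int[mu]_x field0 Q x by apply: integral_ge0 => p _; exact: Q0.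
have le : menergy rotmean mu + \int[mu]_p field0 Q p <= menergy mu mu + \int[mu]_p field0 Q p.
  have mavp := measurable_latitude (mavg mu).
  rewrite FE J1 -ge0_integralD//.
  apply: (@le_trans _ _ (\int[mu]_p cst (robin Q mu)%:E p)).
    pose g (p : B3) : \bar R := avg (potential mu) ((p : V) 0 ord_max)%R + field0 Q p.
    have mg : measurable_fun setT g by exact: emeasurable_funD.
    rewrite [leLHS](@ge0_negligible_integral _ _ _ mu setT off g)//; last first.
      by move=> p _; rewrite /g adde_ge0.
    rewrite [leRHS](@ge0_negligible_integral _ _ _ mu setT off)//; last first.
      by move=> p _; rewrite lee_fin; exact: (robin_ge0 Qext Qrot mu_eq c1 c2 Qfin hq).
    apply: ge0_le_integral => //.
    - exact: measurableD.
    - by move=> p _; rewrite /g adde_ge0.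
    - exact: measurable_funTS.
    move=> p [_ /off_in[Sp hp]]; rewrite /g field0E//.
    have -> : Q p = (qhat Q ((p : V) 0 ord_max)%R)%:E.
      rewrite -Qfin//; apply: Qrot => //; last by rewrite sphx2.
      by apply: sphx_sphere; have := c1; lra.
    exact: (potential_le Qext Qrot mu_eq c1 c2 suppE Qfin hq).
  by rewrite (integral_cst mu measurableT) [X in _ * X]probability_setT mule1.
have Qf : \int[mu]_p field0 Q p \is a fin_num by rewrite ge0_fin_numE.
rewrite leeD2rE// in le.
have ge := euler_lagrange mQ Q0 smu sr (weighted_energy_min mu_eq) Jfin Qmu.
rewrite J2 integral_field_rotmean leeD2rE// in ge.
have JE : menergy rotmean mu = menergy mu mu.
  by apply/eqP; rewrite eq_le le ge// (le_lt_trans le).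
have Jf : menergy mu mu = (fine (menergy mu mu))%:E by rewrite fineK// ge0_fin_numE ?menergy_ge0.
have e1 : energy2 mu mu = (fine (menergy mu mu))%:E by rewrite (energy2E smu smu) -Jf.
have e2 : energy2 rotmean rotmean = (fine (menergy mu mu))%:E.
  by rewrite (energy2E sr sr) J2 JE -Jf.
have e3 : energy2 mu rotmean = (fine (menergy mu mu))%:E.
  by rewrite (energy2E smu sr) menergyC JE -Jf.
exact: (energy2_eq smu sr e1 e2 e3).
Qed.

End cap.
End rotation_average.

(** * The mass of the field-free part *)

Section cap_totals.
Context {R : realType}.
Notation lam := (@lebesgue_measure R).
Implicit Types (c y t alpha : R).

(** The derivative of capE c at y. *)
Definition capd c y : R :=
  let s := Num.sqrt (1 + c) / Num.sqrt (y - c) in pi / 2 + (s - atan s).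

Lemma capd_ge0 c y : 0 <= capd c y.
Proof.
rewrite /capd; set s := Num.sqrt _ / _; have s0 : 0 <= s by rewrite divr_ge0 ?sqrtr_ge0.
by have := atan_ltpi2 s; lra.
Qed.

Lemma continuous_capd c y : c < y -> {for y, continuous (capd c)}.
Proof.
move=> cy; have cs : {for y, continuous (fun y => Num.sqrt (1 + c) / Num.sqrt (y - c))}.
  apply: cvgM; first exact: cvg_cst.
  by apply: cvgV; [rewrite gt_eqF// sqrtr_gt0; lra|exact: continuous_sqrtBl].
apply: cvgD; first exact: cvg_cst.
apply: cvgB => //; apply: continuous_comp cs _; exact: continuous_atan.
Qed.

Lemma capE_bounds c y : -1 <= c -> c < y <= 1 -> 0 <= capE c y <= 4 * Num.sqrt (y - c).
Proof.
move=> c1 /andP[cy y1].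
have mk : measurable_fun `]c, y[ (fun z => Num.sqrt (1 + z) / Num.sqrt (y - z)).
  apply: measurable_fun_oo => z zc; apply: cvgM.
    apply: continuous_comp; last exact: sqrt_continuous.
    by apply: cvgD; [exact: cvg_cst|exact: cvg_id].
  by apply: cvgV; [rewrite gt_eqF// sqrtr_gt0; lra|exact: continuous_sqrtBr].
have mk' : measurable_fun `]c, y[ (fun z => (Num.sqrt (y - z))^-1).
  apply: measurable_fun_oo => z zc.
  by apply: cvgV; [rewrite gt_eqF// sqrtr_gt0; lra|exact: continuous_sqrtBr].
rewrite -!lee_fin -integral_capE//; apply/andP; split.
  by apply: integral_ge0 => z _; rewrite lee_fin divr_ge0 ?sqrtr_ge0.
apply: (@le_trans _ _ (\int[lam]_(z in `]c, y[) (2%:E * ((Num.sqrt (y - z))^-1)%:E))%E).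
  apply: ge0_le_integral => //.
  - exact/measurable_EFinP.
  - by apply: emeasurable_funM => //; exact/measurable_EFinP.
  - move=> z; rewrite /= in_itv/= => hz; rewrite -EFinM lee_fin ler_wpM2r ?invr_ge0 ?sqrtr_ge0//.
    rewrite -[leRHS]ger0_norm// -sqrtr_sqr ler_wsqrtr//; lra.
rewrite ge0_integralZl//; last exact/measurable_EFinP.
by rewrite integral_inv_sqrtr// -EFinM lee_fin mulrA ler_wpM2r ?sqrtr_ge0//; lra.
Qed.

(** With h = alpha / 2 one has 1 + cos alpha = 2 cos^2 h and 1 - cos alpha = 2
    sin^2 h, so the arctangent in capE is pi / 2 - h. *)
Lemma capE1 alpha : 0 < alpha <= pi -> capE (cos alpha) 1 = sin alpha + alpha.
Proof.
move=> /andP[a0 api]; have p0 := pi_gt0 R.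
have cE : cos alpha = cos (alpha / 2 + alpha / 2) by congr cos; lra.
have sE : sin alpha = sin (alpha / 2 + alpha / 2) by congr sin; lra.
set h := alpha / 2; have h0 : 0 < h by rewrite /h; lra.
have hpi : h <= pi / 2 by rewrite /h; lra.
have sh : 0 < sin h by apply: sin_gt0_pi; rewrite /h; lra.
have ch : 0 <= cos h by apply: cos_ge0_pihalf; rewrite /h; lra.
have e1 := cos2Dsin2 h.
have c1 : 1 + cos alpha = (cos h ^+ 2) * 2.
  by rewrite cE cosD -/h; nra.
have c2 : 1 - cos alpha = (sin h ^+ 2) * 2.
  by rewrite cE cosD -/h; nra.
have s2 : 0 < Num.sqrt 2 :> R by rewrite sqrtr_gt0.
have r1 : Num.sqrt (1 + cos alpha) = cos h * Num.sqrt 2.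
  by rewrite c1 sqrtrM ?sqr_ge0// sqrtr_sqr ger0_norm.
have r2 : Num.sqrt (1 - cos alpha) = sin h * Num.sqrt 2.
  by rewrite c2 sqrtrM ?sqr_ge0// sqrtr_sqr gtr0_norm.
rewrite /capE r1 r2 -mulf_div divff ?gt_eqF// mulr1.
have -> : cos h / sin h = tan (pi / 2 - h).
  by rewrite /tan cosB sinB cos_pihalf sin_pihalf !mul0r !mul1r !add0r subr0.
rewrite tanK ?in_itv/=; last by rewrite /h; lra.
have -> : cos h * Num.sqrt 2 * (sin h * Num.sqrt 2) = cos h * sin h * (Num.sqrt 2 ^+ 2) by ring.
rewrite sqr_sqrtr// sE sinD -/h /h; lra.
Qed.

(** The total mass of the field-free part. The primitive - capE c (cos t)
    tends to 0 as t tends to alpha, where capd may be unbounded. *)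
Lemma integral_capd alpha : 0 < alpha <= pi ->
  (\int[lam]_(t in `]0%R, alpha[) (capd (cos alpha) (cos t) * sin t)%:E =
   (sin alpha + alpha)%:E)%E.
Proof.
move=> ha; have /andP[a0 api] := ha; set c := cos alpha.
have c1 : -1 <= c := cos_geN1 _.
have c2 : c < 1 by rewrite -cos0 cos_anti.
have dcap y : c < y -> is_derive y 1 (capE c) (capd c y) by exact: is_derive_capE.
rewrite -[X in _ = X%:E]opprK -[X in _ = X%:E]sub0r.
apply: (@ge0_FTC_oo R (fun t => capd c (cos t) * sin t) (fun t => - capE c (cos t))) => //.
- move=> t ht; have ct := cos_cap ha ht.
  apply: (der_eq (derN (der_comp (is_derive_cos t) (dcap _ _)))); first by case/andP: ct.
  by rewrite mulrN opprK.
- move=> t ht; apply: (cos_subst_continuous (lexx 0) api) ht => x hx.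
  by apply: continuous_capd; case/andP: hx.
- move=> t ht; rewrite mulr_ge0 ?capd_ge0// ltW//.
  by apply: (sin_oo (lexx 0) api).
- rewrite -capE1// -[X in capE c X]cos0; apply: cvgN.
  apply: cvg_at_right_filter.
  apply: (continuous_comp (@continuous_cos R 0)).
  by rewrite cos0; apply: der_continuous (dcap _ c2).
- rewrite -[X in _ --> X]oppr0; apply: cvgN.
  apply: (@squeeze_cvgr _ _ _ _ (fun=> 0) (fun t => 4 * Num.sqrt (cos t - c))).
  + near=> t; apply: capE_bounds => //.
    have ht : 0 < t < alpha by apply/andP; split; near: t; [exact: nbhs_left_gt|exact: nbhs_left_lt].
    by have /andP[-> /ltW ->] := cos_cap ha ht.
  + exact: cvg_cst.
  + have -> : (0 : R) = 4 * Num.sqrt (cos alpha - c) by rewrite subrr sqrtr0 mulr0.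
    apply: cvg_at_left_filter; apply: cvgM; first exact: cvg_cst.
    apply: continuous_comp; last exact: sqrt_continuous.
    by apply: cvgB; [exact: continuous_cos|exact: cvg_cst].
Unshelve. all: by end_near.
Qed.

End cap_totals.

(** * The density theorem *)

Section cap_geometry.
Context {R : realType}.
Local Notation V := 'rV[R]_3.
Implicit Types (t x alpha : R) (p : V).

Lemma sph_sphx theta t : 0 <= t <= pi -> sph theta t = sphx theta (cos t) :> V.
Proof.
move=> ht; have st : 0 <= sin t by exact: sin_ge0_pi.
have sE : Num.sqrt (1 - cos t ^+ 2) = sin t by rewrite -sin2cos2 sqrtr_sqr ger0_norm.
by apply: eq_row3; rewrite !mxE/= ?sE// mulrC.
Qed.

(** In terms of the third coordinate the cap is a half-space section, since
    the cosine decreases on [0, pi]. *)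
Lemma north_capE alpha p : 0 < alpha <= pi ->
  north_cap alpha p <-> sphere2 p /\ cos alpha <= p 0 ord_max.
Proof.
move=> ha; split.
  move=> [[w t] /= [_ ht]] <-; have ht' : 0 <= t <= pi by lra.
  rewrite sph_sphx// sphx2; split; first by apply: sphx_sphere; rewrite cos_geN1 cos_le1.
  by rewrite leNgt ltr_cos ?in_itv/= -?leNgt; lra.
move=> [Sp cp]; have [w hw pE] := sphere2_polar Sp.
have := sphere2_coord ord_max Sp; rewrite ler_norml => p1.
have aK : cos (acos (p 0 ord_max)) = p 0 ord_max by rewrite acosK// in_itv.
have a0 : 0 <= acos (p 0 ord_max) <= pi by rewrite acos_ge0 ?acos_lepi.
exists (w, acos (p 0 ord_max)) => /=; last by rewrite sph_sphx// aK.
split; first by lra.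
apply/andP; split; first by case/andP: a0.
by rewrite leNgt -ltr_cos ?in_itv/= ?aK -?leNgt//; lra.
Qed.

End cap_geometry.

Theorem theorem1p3 (R : realType) (Q : 'rV[R]_3 -> \bar R)
    (N : set 'rV[R]_3) (alpha : R) (mu : probability (borelR3 R) R)
    (Qext : external_field Q) (Qrot : rotation_invariant Q)
    (mu_eq : equilibrium_measure Q mu)
    (N_open : sphere_open N) (N_supp : msupport mu `<=` N)
    (Q_C2 : sphere_C2_on N Q)
    (alpha_range : 0 < alpha <= pi) (supp_cap : msupport mu = north_cap alpha) :
  let q := profile Q in
  let F := F_fun q alpha in
  [/\ forall t, 0 < t < alpha ->
        lebesgue_measure.-integrable `[0, t] (EFin \o g_integrand q t) /\
        derivable (g_integral q) t 1,
      forall phi, 0 < phi < alpha ->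
        lebesgue_measure.-integrable `[phi, alpha]
          (EFin \o F_integrand q phi) /\
        derivable (F_integral q alpha) phi 1,
      lebesgue_measure.-integrable `[0, alpha]
        (EFin \o (fun phi => F phi * sin phi)),
      forall A : set (borelR3 R), measurable A ->
        mu A = zonal_integral alpha (density q alpha (fine (FQ Q mu))) A
    & FQ Q mu = (pi / (sin alpha + alpha) *
        (1 - 2 * pi *
           \int[lebesgue_measure]_(phi in `[0, alpha]) (F phi * sin phi)))%:E].
Proof.
pose lam := @lebesgue_measure R.
move=> q F; pose c := cos alpha; have /andP[al0 alpi] := alpha_range.
have pi0 := pi_gt0 R.
have c1 : -1 <= c := cos_geN1 _.
have c2 : c < 1 by rewrite -cos0 cos_anti.
have suppE (p : 'rV[R]_3) : msupport mu p <-> sphere2 p /\ c <= p 0 ord_max.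
  by rewrite supp_cap; exact: north_capE.
have Nc x : c < x < 1 -> N (sphx 0 x).
  by move=> hx; apply/N_supp/suppE; rewrite sphx2; split; [apply: sphx_sphere; lra|lra].
have [hq hq'] := qhat_C2 c1 Q_C2 Nc.
have Qfin x (hx : c < x < 1) := Q_fin Q_C2 Nc hx.
have smu : on_sphere mu by case: mu_eq.
have qb x (hx : c < x < 1) := qhat_bounds Qext Qrot mu_eq c1 c2 suppE Qfin hq hx.
have F0 := robin_ge0 Qext Qrot mu_eq c1 c2 Qfin hq.
have T1 w (hw : c < w < 1) := mu_Smean Qext Qrot mu_eq c1 c2 suppE Qfin hq hw.
have T2 y (hy : c < y <= 1) := mu_Smean_cdf suppE hy.
have mS := @measurable_Smean R mu; have S0 := @Smean_ge0 R mu.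
have C1H : C1 c 1 (Hfun c (qhat Q)) := C1_Hfun c1 c2 F0 hq hq' qb mS S0 T1.
have iH y (hy : c < y <= 1) := integrable_Hfun c1 c2 F0 hq hq' qb mS S0 T1 T2 hy.
have cdf y (hy : c < y <= 1) := cdf_formula c1 c2 F0 hq hq' qb mS S0 T1 T2 hy.
have C1g : C1 c 1 (ghat (qhat Q)) := C1_ghat c1 hq hq' qb.
have C1A : C1 c 1 (Abel (qhat Q) 1) := C1_G hq qb.
have iA w (hw : c < w < 1) := integrable_Abel_qh hq qb hw.
have cq x (hx : c < x < 1) : {for x, continuous (qhat Q)} := C1_continuous hq hx.
have qE t : 0 < t < alpha -> q t = qhat Q (cos t).
  by move=> ht; rewrite /q /profile /qhat sph_sphx//; lra.
have FE t (ht : 0 < t < alpha) : F t = - (2 / pi) * derive1 (Hfun c (qhat Q)) (cos t).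
  exact: (F_funE alpha_range qE cq iA C1A C1g iH C1H ht).
pose k := robin Q mu.
(* The derivative of the distribution function of the height. *)
pose psi y := k / pi * capd c y - 4 * derive1 (Hfun c (qhat Q)) y.
have dM y : c < y < 1 -> is_derive y 1 (cap_cdf mu) (psi y).
  move=> hy; apply: (@eq_is_derive _ c 1
    (fun y => k / pi * capE c y - 4 * Hfun c (qhat Q) y)) => // [z hz|].
    rewrite cdf; last by lra.
    have alg (u v w p : R) : p != 0 -> u / p * v - 4 * w = (u * v - 4 * p * w) / p.
      by move=> p0; field.
    by rewrite -/k alg// gt_eqF.
  have cy : c < y by case/andP: hy.
  apply: (der_eq (derB (derM (der_cst (k / pi) y) (is_derive_capE c1 cy))
    (derM (der_cst 4 y) (C1_der C1H hy)))).
  by rewrite !mul0r !add0r.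
have cpsi y : c < y < 1 -> {for y, continuous psi}.
  move=> hy; have cy : c < y by case/andP: hy.
  have h1 := continuous_capd cy; have [_ h2] := C1H _ hy.
  by apply: cvgB; [apply: cvgM; [exact: cvg_cst|exact: h1]|
    apply: cvgM; [exact: cvg_cst|exact: h2]].
have mu_out := mu_off_cap smu Qext Qrot mu_eq c1 c2 suppE Qfin hq.
have psi0 t (ht : 0 < t < alpha) := angle_density_ge0 alpha_range mu_out dM ht.
have tot := integral_angle_density alpha_range mu_out dM cpsi.
have atom x (hx : c < x < 1) := latitude_atom alpha_range mu_out dM cpsi hx.
have cps t : 0 < t < alpha -> {for t, continuous (fun t => psi (cos t) * sin t)}.
  move=> ht; apply: (cos_subst_continuous (lexx 0) alpi) ht => x; rewrite cos0.
  exact: cpsi.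
have ccd t : 0 < t < alpha -> {for t, continuous (fun t => capd c (cos t) * sin t)}.
  move=> ht; apply: (cos_subst_continuous (lexx 0) alpi) ht => x /andP[cx _].
  exact: continuous_capd.
have sp t : 0 < t < alpha -> 0 < sin t by exact: (sin_oo (lexx 0) alpi).
have ips : lam.-integrable `]0, alpha[ (EFin \o (fun t => psi (cos t) * sin t)).
  by apply: ge0_integrable_oo => //; rewrite [X in (X < _)%E]tot ltry.
have icd : lam.-integrable `]0, alpha[ (EFin \o (fun t => capd c (cos t) * sin t)).
  apply: ge0_integrable_oo => //.
    by move=> t ht; rewrite mulr_ge0 ?capd_ge0 ?ltW ?sp.
  by rewrite [X in (X < _)%E]integral_capd ?ltry.
have FsE t : 0 < t < alpha -> F t * sin t =
    (2 * pi)^-1 * (psi (cos t) * sin t - k / pi * (capd c (cos t) * sin t)).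
  have alg (p h s u v : R) : p != 0 ->
      - (2 / p) * h * s = (2 * p)^-1 * ((u / p * v - 4 * h) * s - u / p * (v * s)).
    by move=> p0; field.
  by move=> ht; rewrite FE// /psi; apply: alg; rewrite gt_eqF.
have ikcd : lam.-integrable `]0, alpha[ (EFin \o (fun t => k / pi * (capd c (cos t) * sin t))).
  rewrite (_ : EFin \o _ = fun t => ((k / pi)%:E * (capd c (cos t) * sin t)%:E)%E).
    exact: integrableZl.
  by apply/funext => t; rewrite /= EFinM.
have idif : lam.-integrable `]0, alpha[
    (EFin \o (fun t => psi (cos t) * sin t - k / pi * (capd c (cos t) * sin t))).
  rewrite (_ : EFin \o _ = fun t =>
      ((psi (cos t) * sin t)%:E - (k / pi * (capd c (cos t) * sin t))%:E)%E).
    exact: integrableB.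
  by apply/funext => t; rewrite /= EFinB.
have Fint : lam.-integrable `]0, alpha[ (EFin \o (fun t => F t * sin t)).
  apply: (eq_integrable_oo FsE).
  rewrite (_ : EFin \o _ = fun t => (((2 * pi)^-1)%:E *
      (psi (cos t) * sin t - k / pi * (capd c (cos t) * sin t))%:E)%E).
    exact: integrableZl.
  by apply/funext => t; rewrite /= EFinM.
have FQk : FQ Q mu = k%:E := FQE Qext Qrot mu_eq c1 c2 Qfin hq.
have sa0 : 0 < sin alpha + alpha.
  by rewrite ltr_wpDl// sin_ge0_pi//; lra.
split.
- move=> t ht; split; first by have [] := g_integral_cos alpha_range qE cq iA ht.
  by have [] := is_derive_g_integral alpha_range qE cq iA C1A ht.
- move=> t ht; split.
    by have [] := F_integral_cos alpha_range qE cq iA C1A C1g iH ht.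
  by have [] := is_derive_F_integral alpha_range qE cq iA C1A C1g iH C1H ht.
- exact: integrable_oo_cc.
- move=> A mA.
  have tp := @two_pi_gt0 R.
  have dE t : 0 < t < alpha ->
      density q alpha (fine (FQ Q mu)) t * sin t = (2 * pi)^-1 * (psi (cos t) * sin t).
    move=> ht; rewrite /density -/F FE// FQk /=.
    have ct := cos_cap alpha_range ht.
    have -> : Num.sqrt ((1 + cos alpha) / (cos t - cos alpha)) =
        Num.sqrt (1 + c) / Num.sqrt (cos t - c).
      have h1 : 0 <= 1 + cos alpha by rewrite -/c; lra.
      have h2 : 0 <= cos t - cos alpha by lra.
      by rewrite (sqrtrM _ h1) (sqrtrV h2).
    rewrite /psi /capd; move: (_ / Num.sqrt _) => s.
    have alg (p h w u v : R) : p != 0 -> (u / (4 * p) * (1 + 2 / p * v) + - (2 / p) * h) * w =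
        (2 * p)^-1 * ((u / p * (p / 2 + v) - 4 * h) * w).
      by move=> p0; field.
    by apply: alg; rewrite gt_eqF.
  have mi : measurable_fun setT (fun p : borelR3 R => (\1_A p)%:E : \bar R).
    by apply/measurable_EFinP; exact: measurable_indic.
  have i0 (p : borelR3 R) : (0 <= (\1_A p)%:E :> \bar R)%E by rewrite lee_fin.
  have mav : measurable_fun setT (avg (fun p => (\1_A p)%:E) : measurableTypeR R -> \bar R).
    exact: measurable_avg.
  have av0 x : (0 <= avg (fun p => (\1_A p)%:E) x)%E by exact: avg_ge0.
  rewrite (rotmean_eq smu Qext Qrot mu_eq c1 c2 suppE Qfin hq atom mA).
  transitivity (\int[rotmean mu]_p (\1_A p)%:E)%E.
    by rewrite integral_indic ?setIT.
  rewrite (integral_rotmean mu mi i0).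
  rewrite (integral_latitude alpha_range mu_out dM cpsi mav av0).
  pose h t : \bar R := (avg (fun p => (\1_A p)%:E) (cos t) * (psi (cos t) * sin t)%:E)%E.
  have mh : measurable_fun `]0, alpha[ h.
    apply: emeasurable_funM; last by apply/measurable_EFinP; exact: measurable_fun_oo.
    apply: measurable_funTS; apply: measurableT_comp mav _.
    by apply: continuous_measurable_fun; exact: continuous_cos.
  have hE t : 0 < t < alpha -> (\int[lam]_(theta in `[0%R, (2 * pi)%R])
      (\1_A (sph theta t) * density q alpha (fine (FQ Q mu)) t * sin t)%:E = h t)%E.
    move=> ht; rewrite /h /avg muleC muleA -EFinM.
    under eq_integral => w _.
      rewrite -mulrA dE// EFinM muleC sph_sphx; last by lra.
      rewrite [(_ * (psi _ * _))%R]mulrC.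
      over.
    rewrite ge0_integralZl//.
      by apply: measurable_funTS; apply: measurableT_comp mi _; exact: measurable_sphxl.
    by rewrite lee_fin mulr_ge0 ?psi0// invr_ge0 ltW.
  rewrite /zonal_integral [RHS]integral_itv_bndoo//; last first.
    apply: eq_measurable_fun mh => t; rewrite inE/= in_itv/= => ht.
    by rewrite -hE.
  by apply: eq_integral => t; rewrite inE/= in_itv/= => ht; rewrite -/lam hE.
- rewrite FQk; congr EFin.
  rewrite Rintegral_cc_oo; last by apply/measurable_EFinP; case/integrableP: Fint.
  have I1 : \int[lam]_(t in `]0, alpha[) (psi (cos t) * sin t) = 1.
    by rewrite /Rintegral [X in fine X]tot.
  have I2 : \int[lam]_(t in `]0, alpha[) (capd c (cos t) * sin t) = sin alpha + alpha.
    by rewrite /Rintegral [X in fine X]integral_capd.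
  have -> : \int[lam]_(t in `]0, alpha[) (F t * sin t) =
      (2 * pi)^-1 * (1 - k / pi * (sin alpha + alpha)).
    rewrite -I2 -[X in _ * (X - _)]I1 -RintegralZl// -RintegralB// -RintegralZl//.
    by apply: eq_Rintegral => t; rewrite inE/= in_itv/= => ht; rewrite FsE.
  have alg (p u v : R) : p != 0 -> v != 0 ->
      u = p / v * (1 - 2 * p * ((2 * p)^-1 * (1 - u / p * v))).
    by move=> p0 v0; field; rewrite p0.
  by apply: alg; rewrite gt_eqF.
Qed.
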